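(* Let $(X_i,Y_i)$, $i=1,\dots,n$, be $n$ independent copies of a couple of random variables $(X,Y)\in\mathbb{R}^d\times\mathbb{R}$ and let $\theta_*\in\arg\min_{\theta\in\mathbb{R}^d}\mathbb{E}[(Y-\langle\theta,X\rangle)^2]$, with $\mathbb{E}[(Y-\langle\theta_*,X\rangle)^2]>0$. Assume that for positive constants $p,q\in(0,1]$, $\alpha_1,\alpha_2,\eta_1,\eta_2$, $$\mathbb{E}\Bigl\{\exp\Bigl[\frac{\alpha_1}2\bigl(\|G^{-1/2}X\|^{2p}-d^p-\eta_1\bigr)\Bigr]\Bigr\}\le1\quad\text{and}\quad\mathbb{E}\Bigl\{\exp\Bigl[\frac{\alpha_2}2\Bigl(\frac{(Y-\langle\theta_*,X\rangle)^{2q}}{\mathbb{E}[(Y-\langle\theta_*,X\rangle)^2]^q}-1-\eta_2\Bigr)\Bigr]\Bigr\}\le1 .$$ Let $K=(\sqrt{\kappa_1}+\sqrt{\kappa_2})^2$, with $\kappa_1,\kappa_2$, and $R$ as in the context, and consider $$\mu=\Bigl(\frac{2(K-1)}n\bigl[\log(\epsilon^{-1})+0.73(d+1)\bigr]\Bigr)^{1/2}+6.81\bigl(\sqrt{\kappa_1}+\sqrt{\kappa_2}\bigr)\sqrt{\frac{2(d+1)}n},\qquad\widehat\delta=\frac\mu{1-2\mu},$$ $$\gamma_-=\frac{2[\log(\epsilon^{-1})+0.73(d+1)]}{3(K-1)n},\qquad\gamma_+=\gamma_-R^4(1+\widehat\delta)^2,$$ $$\widehat\gamma_+=\frac{2[\log(\epsilon^{-1})+0.73(d+1)](1+\widehat\delta)^2}{3(K-1)n}\Bigl[\bigl(d^p+\eta_1+2\alpha_1^{-1}\log(n/\epsilon)\bigr)^{2/p}+\bigl(1+\eta_2+2\alpha_2^{-1}\log(n/\epsilon)\bigr)^{2/q}\Bigr]^2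 .$$ Consider any confidence parameter $\epsilon>0$ and any sample size $n$ such that $$n>\Biggl[20\bigl(\sqrt{\kappa_1}+\sqrt{\kappa_2}\bigr)\sqrt{d+1}+\Bigl(\frac52+\frac1{2(K-1)}\Bigr)\Bigl(2(K-1)\bigl[\log(\epsilon^{-1})+0.73(d+1)\bigr]\Bigr)^{1/2}\Biggr]^2=\mathbf{O}\bigl((\kappa_1+\kappa_2)[d+\log(\epsilon^{-1})]\bigr).$$ With probability at least $1-4\epsilon$, for any $\theta\in\mathbb{R}^d$, any $\xi\in\mathbb{R}$, $$-\frac{\widehat\delta+\gamma_-}{1+\widehat\delta}\le\frac{\overline N(\theta,\xi)}{N(\theta,\xi)}-1\le\frac{\widehat\delta+\gamma_+}{(1-\widehat\delta)_+(1-\gamma_+)_+}\le\frac{\widehat\delta+\widehat\gamma_+}{(1-\widehat\delta)_+(1-\widehat\gamma_+)_+},$$ so that in particular $$\left|\frac{\overline N(\theta,\xi)}{N(\theta,\xi)}-1\right|\le\frac{\widehat\delta+\widehat\gamma_+}{(1-\widehat\delta)_+(1-\widehat\gamma_+)_+}=\mathbf{O}_{n\to\infty}\Biggl(\sqrt{\frac{(\kappa_1+\kappa_2)[d+\log(\epsilon^{-1})]}{n}}\Biggr).$$ As a consequence, the empirical risk minimizer $\widehat\theta\in\arg\min_{\theta\in\mathbb{R}^d}\sum_{i=1}^n(Y_i-\langle\theta,X_i\rangle)^2$ is such that with probability at least $1-4\epsilon$, $$\mathbb{E}\bigl[(Y-\langle\widehat\theta,X\rangle)^2\bigr]-\mathbb{E}\bigl[(Y-\langle\theta_*,X\rangle)^2\bigr]\le\frac{\delta^2}{(1-\delta)(1-\delta^2)n}\sum_{i=1}^n\bigl(Y_i-\langle\widehat\theta,X_i\rangle\bigr)^2\le\frac{\delta^2}{(1-\delta)^2}\mathbb{E}\bigl[(Y-\langle\theta_*,X\rangle)^2\bigr],$$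 where $$\delta=\frac{\widehat\delta+\widehat\gamma_+}{(1-\widehat\delta)(1-\widehat\gamma_+)},\qquad\delta^2=\Biggl(\frac{\widehat\delta+\widehat\gamma_+}{(1-\widehat\delta)(1-\widehat\gamma_+)}\Biggr)^2=\mathbf{O}_{n\to\infty}\Bigl(\frac{(\kappa_1+\kappa_2)[d+\log(\epsilon^{-1})]}{n}\Bigr).$$
   Context: $G=\mathbb{E}(XX^\top)$, $G^{-1/2}$ is the symmetric square root of the pseudo-inverse of $G$, $(z)_+=\max\{z,0\}$, $N(\theta,\xi)=\mathbb{E}[(\xi Y-\langle\theta,X\rangle)^2]$, $\overline N(\theta,\xi)=\frac1n\sum_{i=1}^n(\xi Y_i-\langle\theta,X_i\rangle)^2$. The expression $\mathbb{E}[(Y-\langle\widehat\theta,X\rangle)^2]$ denotes the function $\theta\mapsto\mathbb{E}[(Y-\langle\theta,X\rangle)^2]$ evaluated at the random point $\widehat\theta$. $\kappa_1=\sup\{\mathbb{E}(\langle\theta,X\rangle^4):\theta\in\mathbb{R}^d,\ \mathbb{E}(\langle\theta,X\rangle^2)\le1\}$, $\kappa_2=\dfrac{\mathbb{E}[(Y-\langle\theta_*,X\rangle)^4]}{\mathbb{E}[(Y-\langle\theta_*,X\rangle)^2]^2}$ (the denominator being positive here). $$R=\max_{1\le i\le n}\sup\{\xi Y_i-\langle\theta,X_i\rangle:(\theta,\xi)\in\mathbb{R}^{d+1},\ \mathbb{E}[(\xi Y-\langle\theta,X\rangle)^2]\le1\}.$$ Convention: $0/0=1$ and $z/0=+\infty$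 for $z>0$ in quotients. $A=\mathbf{O}(B)$ means that there is a numerical constant $c$ such that $A\le cB$; $A=\mathbf{O}_{n\to\infty}(B)$ means that there is a numerical constant $c$ such that $\limsup_{n\to\infty}A/B\le c$.
   Formalization: The excess-risk display is stated only when the bound on |N̄/N−1| is below 1 (so δ̂, γ̂₊, δ<1); the three O(·) claims assume ε≤1, and the one for the sample size also G≠0. Without these conditions the displays can fail. *)

(* Defs.v *)
From HB Require Import structures.
From mathcomp Require Import all_boot all_order all_algebra.
From mathcomp Require Import all_classical all_reals all_analysis.

Set Implicit Arguments.
Unset Strict Implicit.
Unset Printing Implicit Defensive.

Import Order.TTheory GRing.Theory Num.Theory.
Import numFieldNormedType.Exports.

Local Open Scope classical_set_scope.
Local Open Scope ring_scope.

(* Quotients with the conventions 0/0 = 1 and z/0 = +oo for z > 0.  The        *)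
(* library inverse on \bar R already satisfies 0^-1 = +oo.                      *)
Definition equot (R : realType) (x y : \bar R) : \bar R :=
  if (x == 0%E) && (y == 0%E) then 1%E else (x / y)%E.

(* E has probability at least c; E itself need not be measurable. *)
Definition prob_ge (R : realType) (dT : measure_display)
    (T : measurableType dT) (P : probability T R) (c : R) (E : set T) : Prop :=
  exists A : set T, [/\ measurable A, (c%:E <= P A)%E & A `<=` E].

(* limsup_{n -> oo} A n / B n <= c *)
Definition limsup_ratio_le (R : realType) (c : R) (A : nat -> \bar R)
    (B : nat -> R) : Prop :=
  (limn_esup (fun n => A n / (B n)%:E) <= c%:E)%E.

Section LinearAlgebra.
Variables (R : realType) (d : nat).
Implicit Types (u v x : 'rV[R]_d) (G H S : 'M[R]_d).

Definition dot u v : R := \sum_(j < d) u 0 j * v 0 j.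

(* The norm `|u| of the library on 'rV[R]_d is the sup norm. *)
Definition enorm u : R := Num.sqrt (dot u u).

(* Moore-Penrose pseudo-inverse (the library's pinvmx is another one). *)
Definition is_pseudo_inverse G H : Prop :=
  [/\ G *m H *m G = G, H *m G *m H = H,
      (G *m H)^T = G *m H & (H *m G)^T = H *m G].

Definition is_symmetric_sqrt H S : Prop :=
  [/\ S^T = S, forall u, 0 <= dot (u *m S) u & S *m S = H].

(* S = G^{-1/2} *)
Definition is_inv_sqrt G S : Prop :=
  exists2 H, is_pseudo_inverse G H & is_symmetric_sqrt H S.

End LinearAlgebra.

(* Values of a couple (X, Y) in R^d x R, with the product Borel sigma-algebra. *)
Notation obs R d := (d.-tuple (measurableTypeR R) * measurableTypeR R)%type.

Section Observations.
Variables (R : realType) (d : nat).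

Definition covariate (z : obs R d) : 'rV[R]_d := \row_(j < d) tnth z.1 j.

Definition response (z : obs R d) : R := z.2.

Definition residual (theta : 'rV[R]_d) (xi : R) (z : obs R d) : R :=
  xi * response z - dot theta (covariate z).

End Observations.

Section Population.
Variables (R : realType) (dT : measure_display) (T : measurableType dT).
Variables (P : probability T R) (d : nat) (Z : {RV P >-> obs R d}).

Definition square_integrable : Prop :=
  (forall j : 'I_d, (fun w => covariate (Z w) 0 j) \in Lfun P 2%:E) /\
  (fun w => response (Z w)) \in Lfun P 2%:E.

Definition gram : 'M[R]_d :=
  \matrix_(i, j)
    fine ('E_P[fun w => (covariate (Z w) 0 i * covariate (Z w) 0 j)%R])%E.

(* N(theta, xi); N(theta, 1) is the quadratic risk of theta. *)
Definition popN (theta : 'rV[R]_d) (xi : R) : R :=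
  fine ('E_P[fun w => (residual theta xi (Z w) ^+ 2)%R])%E.

Definition is_risk_minimizer (theta : 'rV[R]_d) : Prop :=
  forall theta', popN theta 1 <= popN theta' 1.

(* Exponential moments as below make kappa1 and kappa2 finite, so that fine     *)
(* loses nothing there.                                                        *)
Definition kappa1 : R :=
  fine (ereal_sup
    [set 'E_P[fun w => (dot theta (covariate (Z w)) ^+ 4)%R]%E |
      theta in [set theta |
        ('E_P[fun w => (dot theta (covariate (Z w)) ^+ 2)%R] <= 1)%E]]).

Definition kappa2 (theta_s : 'rV[R]_d) : R :=
  fine ('E_P[fun w => (residual theta_s 1 (Z w) ^+ 4)%R])%E
  / popN theta_s 1 ^+ 2.

Definition covariate_exp_moment (S : 'M[R]_d) (p alpha eta : R) : Prop :=
  ('E_P[fun w => expR (alpha / 2 *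
     (enorm (covariate (Z w) *m S) `^ (2 * p) - d%:R `^ p - eta))%R] <= 1)%E.

Definition noise_exp_moment (theta_s : 'rV[R]_d) (q alpha eta : R) : Prop :=
  ('E_P[fun w => expR (alpha / 2 *
     (`|residual theta_s 1 (Z w)| `^ (2 * q) / popN theta_s 1 `^ q
      - 1 - eta))%R] <= 1)%E.

(* Zs 0, ..., Zs (n-1) are independent, each with the law of Z.  The product   *)
(* rule for subfamilies is the case where some of the A i are the full set.    *)
Definition independent_copies (n : nat) (Zs : 'I_n -> {RV P >-> obs R d})
    : Prop :=
  (forall (i : 'I_n) (A : set (obs R d)), measurable A ->
     P (Zs i @^-1` A) = P (Z @^-1` A)) /\
  (forall A : 'I_n -> set (obs R d), (forall i, measurable (A i)) ->
     P (\bigcap_(i in [set: 'I_n]) (Zs i @^-1` A i)) =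
     \prod_(i < n) P (Zs i @^-1` A i))%E.

(* R, as a function of the realized sample; it can be +oo on a null set. *)
Definition sample_radius (n : nat) (zs : 'I_n -> obs R d) : \bar R :=
  \big[maxe/-oo%E]_(i < n)
    ereal_sup [set (residual t.1 t.2 (zs i))%:E |
      t in [set t : 'rV[R]_d * R | popN t.1 t.2 <= 1]].

End Population.

Section Empirical.
Variables (R : realType) (d n : nat) (zs : 'I_n -> obs R d).

Definition rss (theta : 'rV[R]_d) : R :=
  \sum_(i < n) residual theta 1 (zs i) ^+ 2.

Definition empN (theta : 'rV[R]_d) (xi : R) : R :=
  n%:R^-1 * \sum_(i < n) residual theta xi (zs i) ^+ 2.

Definition is_erm (theta : 'rV[R]_d) : Prop :=
  forall theta', rss theta <= rss theta'.

End Empirical.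

Section Constants.
Variable R : realType.
Variables (d : nat) (k1 k2 eps : R).

Definition sumsqrt : R := Num.sqrt k1 + Num.sqrt k2.

Definition bigK : R := sumsqrt ^+ 2.

Definition complexity : R := ln eps^-1 + 73 / 100 * d.+1%:R.

Definition min_sample_size : R :=
  (20 * sumsqrt * Num.sqrt d.+1%:R
   + (5 / 2 + 1 / (2 * (bigK - 1)))
     * Num.sqrt (2 * (bigK - 1) * complexity)) ^+ 2.

Definition mu_hat (n : nat) : R :=
  Num.sqrt (2 * (bigK - 1) / n%:R * complexity)
  + 681 / 100 * sumsqrt * Num.sqrt (2 * d.+1%:R / n%:R).

Definition delta_hat (n : nat) : R := mu_hat n / (1 - 2 * mu_hat n).

Definition gamma_minus (n : nat) : R :=
  2 * complexity / (3 * (bigK - 1) * n%:R).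

Definition gamma_plus (n : nat) (rad : \bar R) : \bar R :=
  ((gamma_minus n)%:E * rad ^+ 4 * ((1 + delta_hat n) ^+ 2)%:E)%E.

Variables (p q alpha1 alpha2 eta1 eta2 : R).

Definition gamma_hat (n : nat) : R :=
  2 * complexity * (1 + delta_hat n) ^+ 2 / (3 * (bigK - 1) * n%:R)
  * ((d%:R `^ p + eta1 + 2 * alpha1^-1 * ln (n%:R / eps)) `^ (2 / p)
     + (1 + eta2 + 2 * alpha2^-1 * ln (n%:R / eps)) `^ (2 / q)) ^+ 2.

Definition rate (n : nat) : R := (k1 + k2) * (d%:R + ln eps^-1) / n%:R.

End Constants.

Section Bounds.
Variable R : realType.

(* (dl + g) / ((1 - dl)_+ (1 - g)_+) *)
Definition error_bound (dl : R) (g : \bar R) : \bar R :=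
  equot (dl%:E + g)%E (maxe (1 - dl%:E) 0 * maxe (1 - g) 0)%E.

Definition delta_of (dl g : R) : R := (dl + g) / ((1 - dl) * (1 - g)).

End Bounds.

(* Main.v *)
Require Import Defs.
From HB Require Import structures.
From mathcomp Require Import all_boot all_order all_algebra.
From mathcomp Require Import all_classical all_reals all_analysis.
From mathcomp Require Import measurable_realfun hoelder.
From mathcomp Require Import ring lra.

Set Implicit Arguments.
Unset Strict Implicit.
Unset Printing Implicit Defensive.

Import Order.TTheory GRing.Theory Num.Theory.
Import numFieldNormedType.Exports.

Local Open Scope classical_set_scope.
Local Open Scope ring_scope.

(** The statement compares the empirical form [empN] with the population form [popN]
    uniformly over all linear forms of the couple, for variables that only have
    finite fourth moments; beyond the finiteness of these, the exponential moments
    serve to bound [sample_radius].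

    The squared residuals are truncated.  The function [clip] satisfies
    exp (clip t) <= 1 + t + t^2/2, so that the sum over the sample of
    clip (lam (r^2 - 1)), where r is a residual, has an exponential moment
    controlled by the second and fourth moments of r.  The latter is at most K times
    the square of the former, by orthogonality of the noise and the covariate and by
    Minkowski's inequality ([residual_fourth]); hence the constant K.

    Uniformity comes from a weighted union bound over a lattice
    ([weighted_union]).  In whitened coordinates, where the population form is the
    squared Euclidean norm ([coords_norm]), a vector is replaced by a random
    rounding with independent coordinates, of mean the vector itself and of constant
    variance.  Up to a quadratic term [clip] is convex, so that its value at the
    vector is at most the average of its values at the roundings, up to a variance
    that is itself paid for on average ([clip_le_round]).  Averaging the bounds at
    the lattice points therefore gives a bound at every vector ([uniform_clip]), at a
    price proportional to d + 1.

    With the scale [lambda_hat], the right-hand side is nonpositive for the forms of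
    population norm 1 - e and 1 + e, where e is [delta_hat]: the mean of the
    truncated sum absorbs everything else ([error_balance]), and the lower bound on
    the sample size is what makes e large enough ([delta_hat_balance]).

    The truncation is then removed by its cubic loss ([clip_ge_cubic]).  For the
    lower bound the truncated quantity is at most lam, which produces [gamma_minus];
    for the upper bound it is controlled by the radius of the sample, which produces
    [gamma_plus].  A union bound over the sample of the exponential moment bounds
    replaces the radius by its deterministic majorant in [gamma_hat].  Two of the
    four eps are spent on this, the other two on the two signs of the deviation.

    For the empirical minimizer, the excess risk is the population form at the
    difference between the two minimizers.  Since the first-order terms vanish for
    both forms, comparing the two forms at two symmetric perturbations of the
    empirical minimizer bounds it to the second order ([erm_excess]).

    In the asymptotic bounds [delta_hat] is of order n^(-1/2), whereas the logarithms
    in [gamma_hat] leave it of order at most n^(-3/4) ([delta_eventually]). *)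

(** * A truncation of the identity *)

Lemma is_derive_ndecr (R : realType) (f f' : R -> R) :
  (forall x : R, is_derive x 1 f (f' x)) -> (forall x, 0 <= f' x) ->
  {homo f : x y / x <= y}.
Proof.
move=> df f'0 x y xy.
apply: (@ger0_derive1_ndecr R f x y) => //.
- by move=> r _; rewrite derive1E; case: (df r) => _ ->.
- apply: derivable_within_continuous => r _; by case: (df r).
Qed.

(** The identity, flattened at height 2/3 on the right and at -1 on the left.
    The cubic on [0, 1] is forced by the third-order gap that the final bound
    allows, see [clip_ge_cubic]. *)
Definition clip (R : realType) (t : R) : R :=
  if t <= -1 then -1 else if t <= 0 then t
  else if t <= 1 then t - t ^+ 3 / 3 else 2 / 3.

Section Clip.
Variable R : realType.
Implicit Types (s t : R).

Lemma clip_ge t : -1 <= clip t.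
Proof.
rewrite /clip; case: (leP t (-1)) => // h1; case: (leP t 0) => h2; first lra.
case: (leP t 1) => h3; last lra.
have : 0 <= t * (3 - t ^+ 2) by apply: mulr_ge0; nra.
nra.
Qed.

Lemma clip_le t : clip t <= 2 / 3.
Proof.
rewrite /clip; case: (leP t (-1)) => h1; first lra.
case: (leP t 0) => h2; first lra.
case: (leP t 1) => h3; last lra.
have : 0 <= (t - 1) ^+ 2 * (t + 2) by apply: mulr_ge0; [exact: sqr_ge0|lra].
nra.
Qed.

(** Truncation loses only a third-order term when the argument is bounded above;
    this term becomes the gammas of the final bound. *)
Lemma clip_ge_cubic t b : 0 <= b -> t <= b -> t - b ^+ 3 / 3 <= clip t.
Proof.
move=> b0 tb; have tb3 : 0 <= t -> t ^+ 3 <= b ^+ 3.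
  by move=> t0; apply: lerXn2r => //; rewrite nnegrE.
have b3 : 0 <= b ^+ 3 by exact: exprn_ge0.
rewrite /clip; case: (leP t (-1)) => h1; first lra.
case: (leP t 0) => h2; first lra.
have := tb3 (ltW h2).
case: (leP t 1) => h3 H; first lra.
have : 0 <= (t - 1) ^+ 2 * (t + 2) by apply: mulr_ge0; [exact: sqr_ge0|lra].
nra.
Qed.

(** Up to the quadratic (s - t)^2 the truncation is convex: its second
    derivative is at least -2.  This is what makes averaging against a law of
    small variance harmless. *)
Lemma clip_semiconvex t :
  exists p, forall s, clip t + p * (s - t) - (s - t) ^+ 2 <= clip s.
Proof.
have [t1|t1] := leP t (-1).
  exists 0 => s; rewrite {1}/clip t1.
  have := clip_ge s; have := sqr_ge0 (s - t); nra.
have [t0|t0] := leP t 0.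
  exists 1 => s; rewrite /clip (lt_geF t1) t0.
  have := sqr_ge0 (s - t).
  case: (leP s (-1)) => h1; first nra.
  case: (leP s 0) => h2; first nra.
  case: (leP s 1) => h3; last nra.
  move=> _; have : s ^+ 3 <= s ^+ 2 by rewrite exprS ler_piMl ?sqr_ge0.
  have : s ^+ 2 <= (s - t) ^+ 2 by nra.
  nra.
have t0' : t <= 0 = false by apply/negbTE; rewrite -ltNge.
have [t2|t2] := leP t 1.
  exists (1 - t ^+ 2) => s; rewrite /clip (lt_geF t1) t0' t2.
  case: (leP s (-1)) => h1.
    have : 0 <= t * (1 - t) * (t + 1) by apply: mulr_ge0; [apply: mulr_ge0|]; lra.
    nra.
  case: (leP s 0) => h2.
    have : 0 <= t ^+ 2 * (- s) by apply: mulr_ge0; [exact: sqr_ge0|lra].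
    have : 0 <= t ^+ 2 * (1 - t) by apply: mulr_ge0; [exact: sqr_ge0|lra].
    nra.
  case: (leP s 1) => h3.
    have : 0 <= (s - t) ^+ 2 * (3 - s - 2 * t).
      by apply: mulr_ge0; [exact: sqr_ge0|lra].
    nra.
  have : 0 <= (1 - t) * (1 - t) * (1 - t).
    by apply: mulr_ge0; [apply: mulr_ge0|]; lra.
  have : 0 <= (1 - t) ^+ 2 * t by apply: mulr_ge0; [exact: sqr_ge0|lra].
  have : 0 <= (1 - t) ^+ 2 * (s - 1) by apply: mulr_ge0; [exact: sqr_ge0|lra].
  have : 0 <= (s - t - (1 - t ^+ 2) / 2) ^+ 2 by exact: sqr_ge0.
  nra.
exists 0 => s; have t2' : t <= 1 = false by apply/negbTE; rewrite -ltNge.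
rewrite /clip (lt_geF t1) t0' t2' mul0r addr0.
case: (leP s (-1)) => h1; first nra.
case: (leP s 0) => h2; first nra.
case: (leP s 1) => h3; last by have := sqr_ge0 (s - t); nra.
have : 0 <= (1 - s) ^+ 2 * (1 - s) by apply: mulr_ge0; [exact: sqr_ge0|lra].
have : (1 - s) ^+ 2 <= (s - t) ^+ 2 by nra.
nra.
Qed.

Lemma expR_clip_nonpos (t : R) : t <= 0 -> expR t <= 1 + t + t ^+ 2 / 2.
Proof.
move=> t0.
(* x^2/2 exp(-x) is the derivative of this function *)
pose f (x : R) := - (1 + x + x ^+ 2 / 2) * expR (- x).
have H : {homo f : x y / x <= y}.
  apply: (@is_derive_ndecr R f (fun x => x ^+ 2 / 2 * expR (- x))).
    move=> x; rewrite /f; apply: is_derive_eq.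
    by rewrite /GRing.scale /=; field.
  by move=> x; rewrite mulr_ge0 ?expR_ge0// divr_ge0 ?sqr_ge0.
have := H _ _ t0.
rewrite /f oppr0 expR0 expRN mulNr mulr1.
by rewrite lerN2 expr0n/= mul0r !addr0 ler_pdivlMr ?expR_gt0 // mul1r.
Qed.

(** The exponential of the truncation stays below the second-order Taylor
    polynomial, so that second moments of the argument control its exponential
    moment. *)
Lemma expR_clip (t : R) : expR (clip t) <= 1 + t + t ^+ 2 / 2.
Proof.
pose g (x : R) := (1 + x + x ^+ 2 / 2) * expR (- (x - x ^+ 3 / 3)).
have H : {homo g : x y / x <= y}.
  apply: (@is_derive_ndecr R g
    (fun x => x ^+ 2 * (1 / 2 + x + x ^+ 2 / 2) * expR (- (x - x ^+ 3 / 3)))).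
    move=> x; rewrite /g; apply: is_derive_eq.
    by rewrite /GRing.scale /=; field.
  move=> x; rewrite mulr_ge0 ?expR_ge0// mulr_ge0 ?sqr_ge0 //.
  by have := sqr_ge0 (x + 1); nra.
have E (x : R) : 0 <= x -> expR (x - x ^+ 3 / 3) <= 1 + x + x ^+ 2 / 2.
  move=> x0; have := H _ _ x0.
  rewrite /g !expr0n/= !(mul0r, subr0, oppr0, addr0, mul1r) expR0 expRN.
  by rewrite ler_pdivlMr ?expR_gt0 // mul1r.
rewrite /clip; case: (leP t (-1)) => h1.
  rewrite expRN.
  have : (expR 1)^-1 <= 2^-1 :> R.
    by rewrite lef_pV2 ?posrE ?expR_gt0//; have := @expR_ge1Dx R 1; lra.
  by have := sqr_ge0 (t + 1); nra.
case: (leP t 0) => h2; first exact: expR_clip_nonpos.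
case: (leP t 1) => h3; first exact/E/ltW.
have := E 1 ler01; rewrite expr1n (_ : 1 - 1 / 3 = 2 / 3); last lra.
by move=> /le_trans; apply; nra.
Qed.

End Clip.

(** * Randomized rounding to a lattice *)

Section SeqDot.
Variable R : realType.

Fixpoint sdot (a b : seq R) : R :=
  match a, b with
  | x :: a', y :: b' => x * y + sdot a' b'
  | _, _ => 0
  end.

Lemma sdot_ge0 a : 0 <= sdot a a.
Proof. by elim: a => //= x a ih; rewrite addr_ge0// -expr2 sqr_ge0. Qed.

Lemma sdot_norm_le (a : seq R) (x : R) : x \in a -> x ^+ 2 <= sdot a a.
Proof.
elim: a => //= y a ih; rewrite in_cons => /orP[/eqP->|/ih h].
  by rewrite expr2 lerDl sdot_ge0.
by rewrite (le_trans h)// lerDr -expr2 sqr_ge0.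
Qed.

Lemma sdot_cs (a b : seq R) : sdot a b ^+ 2 <= sdot a a * sdot b b.
Proof.
elim: a b => [|x a ih] [|y b] /=; rewrite ?expr0n ?mul0r ?mulr0//=.
have := ih b; have := sdot_ge0 a; have := sdot_ge0 b.
set A := sdot a a; set B := sdot b b; set s := sdot a b => B0 A0 sAB.
have : 2 * (x * y * s) <= x ^+ 2 * B + y ^+ 2 * A.
  have r0 : 0 <= x ^+ 2 * B + y ^+ 2 * A.
    by rewrite addr_ge0// mulr_ge0// sqr_ge0.
  apply: le_trans (ler_norm _) _.
  rewrite -(@ler_pXn2r _ 2)// ?nnegrE//.
  rewrite real_normK ?num_real//.
  have : 0 <= (x ^+ 2 * B - y ^+ 2 * A) ^+ 2 by exact: sqr_ge0.
  have : (x ^+ 2 * y ^+ 2) * s ^+ 2 <= (x ^+ 2 * y ^+ 2) * (A * B).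
    by rewrite ler_wpM2l// mulr_ge0 ?sqr_ge0.
  nra.
nra.
Qed.

End SeqDot.

Section Rounding.
Variables (R : realType) (h : R).
Hypothesis h0 : 0 < h.

(** Expectation of [F] at a random point of the lattice of step [h] near [u],
    drawn among three neighbours with the quadratic B-spline weights.  These
    weights are chosen so that the mean is [u] and so that the variance, h^2/4,
    depends on nothing: it can then be subtracted exactly from a square. *)
Definition round1 (u : R) (F : R -> R) : R :=
  let a := h * (Num.floor (u / h + 1 / 2))%:~R in
  let t := (u - a) / h in
  (1 / 2 - t) ^+ 2 / 2 * F (a - h) + (3 / 4 - t ^+ 2) * F a
  + (1 / 2 + t) ^+ 2 / 2 * F (a + h).

(** Independent rounding of the coordinates. *)
Fixpoint round (us : seq R) (F : seq R -> R) : R :=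
  match us with
  | [::] => F [::]
  | u :: us' => round1 u (fun a => round us' (fun l => F (a :: l)))
  end.

Lemma round1_offset (u : R) : exists t : R,
  [/\ -(1 / 2) <= t, t <= 1 / 2 &
      h * (Num.floor (u / h + 1 / 2))%:~R = u - h * t].
Proof.
exists (u / h - (Num.floor (u / h + 1 / 2))%:~R).
have := ge_floor (u / h + 1 / 2); have := floorD1_gt (u / h + 1 / 2).
rewrite intrD; split; [lra..|].
by rewrite mulrBr mulrCA divff ?gt_eqF// mulr1; ring.
Qed.

Lemma round1E (u : R) : exists t : R, [/\ -(1 / 2) <= t, t <= 1 / 2 &
  forall F, round1 u F = (1 / 2 - t) ^+ 2 / 2 * F (u - h * (t + 1))
    + (3 / 4 - t ^+ 2) * F (u - h * t)
    + (1 / 2 + t) ^+ 2 / 2 * F (u + h * (1 - t))].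
Proof.
have [t [t1 t2 E]] := round1_offset u; exists t; split=> // F.
rewrite /round1 E.
have -> : (u - (u - h * t)) / h = t by field; rewrite gt_eqF.
have -> : u - h * t - h = u - h * (t + 1) by ring.
by have -> : u - h * t + h = u + h * (1 - t) by ring.
Qed.

Lemma round1D u F G :
  round1 u (fun a => F a + G a) = round1 u F + round1 u G.
Proof. by rewrite /round1 /=; ring. Qed.

Lemma round1Z u c F : round1 u (fun a => c * F a) = c * round1 u F.
Proof. by rewrite /round1 /=; ring. Qed.

Lemma round1_cst u c : round1 u (fun=> c) = c.
Proof. by have [t [_ _ ->]] := round1E u => /=; field. Qed.

Lemma round1_mean u : round1 u (fun a => a - u) = 0.
Proof. by have [t [_ _ ->]] := round1E u => /=; field. Qed.

Lemma round1_var u : round1 u (fun a => (a - u) ^+ 2) = h ^+ 2 / 4.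
Proof. by have [t [_ _ ->]] := round1E u => /=; field. Qed.

Lemma round1_fourth u :
  round1 u (fun a => (a - u) ^+ 4) <= 9 * (h ^+ 2 / 4) ^+ 2.
Proof.
have [t [t1 t2 ->]] := round1E u.
rewrite [leLHS](_ : _ = h ^+ 4 * ((1 / 2 - t) ^+ 2 / 2 * (t + 1) ^+ 4
  + (3 / 4 - t ^+ 2) * t ^+ 4 + (1 / 2 + t) ^+ 2 / 2 * (1 - t) ^+ 4)); last by field.
rewrite [leRHS](_ : _ = h ^+ 4 * (9 / 16)); last by field.
rewrite ler_pM2l ?exprn_gt0//.
rewrite [leLHS](_ : _ = 1 / 4 - 3 / 2 * t ^+ 2 + 3 * (t ^+ 2) ^+ 2); last by field.
have : t ^+ 2 <= 1 / 4 by nra.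
by have := sqr_ge0 t; nra.
Qed.

Lemma roundD us F G :
  round us (fun l => F l + G l) = round us F + round us G.
Proof.
elim: us F G => //= u us ih F G; rewrite -round1D; congr round1.
by apply/funext => a; rewrite ih.
Qed.

Lemma roundZ us c F : round us (fun l => c * F l) = c * round us F.
Proof.
elim: us F => //= u us ih F; rewrite -round1Z; congr round1.
by apply/funext => a; rewrite ih.
Qed.

Lemma round_cst us c : round us (fun=> c) = c.
Proof.
elim: us => //= u us ih; rewrite -[RHS](round1_cst u).
by congr round1; apply/funext => a; rewrite ih.
Qed.

Lemma round_sum us (I : Type) (s : seq I) (F : I -> seq R -> R) :
  round us (fun l => \sum_(i <- s) F i l) = \sum_(i <- s) round us (F i).
Proof.
elim: s => [|i s ih].
  by rewrite big_nil -[RHS](round_cst us); congr round; apply/funext=> l; rewrite big_nil.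
rewrite big_cons -ih -roundD; congr round; apply/funext => l.
by rewrite big_cons.
Qed.

Section Moments.
Implicit Types us zs : seq R.

Lemma round_mean us zs : size us = size zs ->
  round us (fun l => sdot l zs - sdot us zs) = 0.
Proof.
elim: us zs => [|u us ih] [|z zs] //=; first by move=> _; rewrite subrr.
move=> [sz]; rewrite -[RHS](mulr0 z) -(round1_mean u) -round1Z; congr round1.
apply/funext => a.
rewrite (_ : (fun l => _) =
    (fun l => z * (a - u) + (sdot l zs - sdot us zs))); last first.
  by apply/funext => l; ring.
by rewrite roundD round_cst ih// addr0.
Qed.

Lemma round_var us zs : size us = size zs ->
  round us (fun l => (sdot l zs - sdot us zs) ^+ 2) = h ^+ 2 / 4 * sdot zs zs.
Proof.
elim: us zs => [|u us ih] [|z zs] //=; first by move=> _; rewrite subrr; ring.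
move=> [sz].
under [X in round1 _ X]eq_fun => a.
  rewrite (_ : (fun l => _) = (fun l => (a - u) ^+ 2 * z ^+ 2 +
    (2 * (a - u) * z * (sdot l zs - sdot us zs) + (sdot l zs - sdot us zs) ^+ 2))); last first.
    by apply/funext => l; ring.
  rewrite 2!roundD (roundZ _ (2 * (a - u) * z)) round_cst round_mean// ih// mulr0 add0r.
  rewrite [_ * z ^+ 2]mulrC.
  over.
by rewrite round1D (round1Z _ (z ^+ 2)) round1_cst round1_var; ring.
Qed.

Lemma round_fourth us zs : size us = size zs ->
  round us (fun l => (sdot l zs - sdot us zs) ^+ 4)
    <= 9 * (h ^+ 2 / 4 * sdot zs zs) ^+ 2.
Proof.
elim: us zs => [|u us ih] [|z zs] //=.
  by move=> _; rewrite subrr expr0n/= !mulr0 expr0n/= mulr0.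
move=> [sz].
pose m3 := round us (fun l => (sdot l zs - sdot us zs) ^+ 3).
pose m4 := round us (fun l => (sdot l zs - sdot us zs) ^+ 4).
under [X in round1 _ X]eq_fun => a.
  rewrite (_ : (fun l => _) = (fun l => (a - u) ^+ 4 * z ^+ 4 +
    (4 * (a - u) ^+ 3 * z ^+ 3 * (sdot l zs - sdot us zs) +
    (6 * (a - u) ^+ 2 * z ^+ 2 * (sdot l zs - sdot us zs) ^+ 2 +
    (4 * (a - u) * z * (sdot l zs - sdot us zs) ^+ 3
     + (sdot l zs - sdot us zs) ^+ 4))))); last first.
    by apply/funext => l; ring.
  rewrite 4!roundD (roundZ _ (4 * (a - u) ^+ 3 * z ^+ 3)).
  rewrite (roundZ _ (6 * (a - u) ^+ 2 * z ^+ 2)) (roundZ _ (4 * (a - u) * z)).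
  rewrite round_cst round_mean// round_var// -/m3 -/m4 mulr0 add0r.
  rewrite (_ : _ + _ = z ^+ 4 * (a - u) ^+ 4 +
    (6 * z ^+ 2 * (h ^+ 2 / 4 * sdot zs zs) * (a - u) ^+ 2
     + (4 * z * m3 * (a - u) + m4))); last by ring.
  over.
rewrite 3!round1D (round1Z _ (z ^+ 4)).
rewrite (round1Z _ (6 * z ^+ 2 * (h ^+ 2 / 4 * sdot zs zs))) (round1Z _ (4 * z * m3)).
rewrite round1_cst round1_var round1_mean mulr0 add0r.
have z4 : z ^+ 4 * round1 u (fun a => (a - u) ^+ 4) <=
          z ^+ 4 * (9 * (h ^+ 2 / 4) ^+ 2).
  by rewrite ler_wpM2l ?round1_fourth// -[4%N]/((2 * 2)%N) exprM sqr_ge0.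
have m4le : m4 <= _ := ih _ sz.
have : 0 <= (h ^+ 2 / 4) ^+ 2 * z ^+ 2 * sdot zs zs.
  by rewrite mulr_ge0 ?sdot_ge0// mulr_ge0 ?sqr_ge0.
move: z4 m4le; set X := z ^+ 4 * round1 _ _; set s := h ^+ 2 / 4; set q := sdot zs zs.
rewrite (_ : 9 * (s * (z * z + q)) ^+ 2 = z ^+ 4 * (9 * s ^+ 2)
  + 18 * (s ^+ 2 * z ^+ 2 * q) + 9 * (s * q) ^+ 2); last by ring.
rewrite (_ : 6 * z ^+ 2 * (s * q) * s = 6 * (s ^+ 2 * z ^+ 2 * q)); last by ring.
by set Y := s ^+ 2 * _ * _; lra.
Qed.

Lemma round_norm us :
  round us (fun l => sdot l l) = sdot us us + h ^+ 2 / 4 * (size us)%:R.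
Proof.
elim: us => [|u us ih] /=; first by rewrite mulr0 addr0.
under [X in round1 _ X]eq_fun => a.
  rewrite roundD round_cst ih.
  rewrite (_ : a * a + _ = (a - u) ^+ 2 + (2 * u * (a - u) + (u ^+ 2 +
    (sdot us us + h ^+ 2 / 4 * (size us)%:R)))); last by ring.
  over.
rewrite 2!round1D (round1Z _ (2 * u)) round1_cst round1_var round1_mean mulr0 add0r.
by rewrite -[(size us).+1%:R]natr1; ring.
Qed.

End Moments.

Section Lattice.
Variable M : nat.

Definition lattice1 : seq R :=
  0 :: [seq h * k.+1%:R | k <- iota 0 M] ++ [seq - (h * k.+1%:R) | k <- iota 0 M].

Fixpoint lattice (D : nat) : seq (seq R) :=
  if D is D'.+1 then [seq a :: l | a <- lattice1, l <- lattice D'] else [:: [::]].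

Lemma mem_lattice1 (i : int) : `|i%:~R| <= M%:R :> R -> h * i%:~R \in lattice1.
Proof.
rewrite /lattice1 in_cons mem_cat; case: i => [[|n]|n] hi.
- by rewrite mulr0 eqxx.
- apply/orP; right; apply/orP; left; apply/mapP; exists n => //.
  by rewrite mem_iota add0n; move: hi; rewrite ger0_norm ?ler0n// ler_nat.
- apply/orP; right; apply/orP; right; apply/mapP; exists n.
    rewrite mem_iota add0n; move: hi; rewrite NegzE mulrNz normrN.
    by rewrite ger0_norm ?ler0n// ler_nat.
  by rewrite NegzE mulrNz mulrN.
Qed.

(** The rounding never leaves a large enough box, so that a bound on a finite
    box is enough. *)
Lemma ler_round us F G : (forall u, u \in us -> `|u| <= h * (M%:R - 2)) ->
  (forall l, l \in lattice (size us) -> F l <= G l) -> round us F <= round us G.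
Proof.
elim: us F G => [|u us ih] F G hu FG /=; first by apply: FG; rewrite inE.
have bu : `|u| <= h * (M%:R - 2) by apply: hu; rewrite inE eqxx.
have key a : a \in lattice1 ->
    round us (fun l => F (a :: l)) <= round us (fun l => G (a :: l)).
  move=> ain; apply: ih => [v vin|l lin].
    by apply: hu; rewrite inE vin orbT.
  by apply: FG; apply/allpairsP; exists (a, l).
have [t [t1 t2 E]] := round1_offset u.
have mem (i : int) : `|i%:~R : R| <= 1 ->
    h * (Num.floor (u / h + 1 / 2))%:~R + h * i%:~R \in lattice1.
  move=> i1; rewrite -mulrDr -intrD; apply: mem_lattice1.
  rewrite -(ler_pM2l h0) -[X in X * `|_|](gtr0_norm h0) -normrM intrD mulrDr E.
  move: bu i1; rewrite !ler_norml => /andP[b1 b2] /andP[i1 i2].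
  have ht1 : h * t <= h * (1 / 2) by rewrite ler_pM2l.
  have ht2 : h * (- (1 / 2)) <= h * t by rewrite ler_pM2l.
  have hi1 : h * i%:~R <= h * 1 by rewrite ler_pM2l.
  have hi2 : h * (- 1) <= h * i%:~R by rewrite ler_pM2l.
  apply/andP; split; lra.
rewrite /round1; set a := h * _ in E mem *; set s := (u - a) / h.
have -> : s = t by rewrite /s E; field; rewrite gt_eqF.
apply: lerD; first apply: lerD.
- rewrite ler_wpM2l ?divr_ge0 ?sqr_ge0//; apply: key.
  by have := mem (-1); rewrite normrN1 mulrN1; apply.
- rewrite ler_wpM2l//; first nra.
  by apply: key; have := mem 0; rewrite normr0 mulr0 addr0; apply; rewrite ler01.
- rewrite ler_wpM2l ?divr_ge0 ?sqr_ge0//; apply: key.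
  by have := mem 1; rewrite normr1 mulr1; apply.
Qed.

(** Normalization of the weights exp(-c |a|), uniformly in the size of the box. *)
Lemma lattice1_sum (c : R) : 0 < c ->
  \sum_(a <- lattice1) expR (- (c * `|a|)) <= 1 + 2 / (c * h).
Proof.
move=> c0; rewrite big_cons big_cat !big_map normr0 mulr0 oppr0 expR0 /=.
have ch : 0 < c * h by exact: mulr_gt0.
set r := expR (- (c * h)).
have r0 : 0 < r by exact: expR_gt0.
have r1 : r * (1 + c * h) <= 1.
  rewrite /r -[leRHS](expRxMexpNx_1 (c * h)) [leRHS]mulrC.
  by rewrite ler_pM2l ?expR_gt0// expR_ge1Dx.
have E1 k : expR (- (c * `|h * k.+1%:R|)) = r ^+ k.+1.
  rewrite /r -expRM_natl; congr expR.
  by rewrite normrM (gtr0_norm h0) ger0_norm ?ler0n//; ring.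
rewrite (eq_bigr (fun k => r ^+ k.+1)); last by move=> k _; rewrite E1.
rewrite [X in _ + (_ + X)](eq_bigr (fun k => r ^+ k.+1)); last first.
  by move=> k _; rewrite normrN E1.
have S m : (1 - r) * \sum_(j <- iota 0 m) r ^+ j.+1 = r - r ^+ m.+1.
  elim: m => [|m ih]; first by rewrite big_nil expr1; ring.
  rewrite -addn1 iotaD big_cat /= big_cons big_nil mulrDr ih add0n addr0 addn1.
  by rewrite (exprS _ m.+1); ring.
have := S M; set s := \sum_(j <- _) _ => Es.
have rM : 0 <= r ^+ M.+1 by rewrite exprn_ge0// ltW.
suff : s * (c * h) <= 1.
  by rewrite -ler_pdivlMr// => sle; rewrite lerD2l [leRHS](_ : _ = 1 / (c * h) + 1 / (c * h)); [lra|field; rewrite !gt_eqF].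
have : (1 - r) * (s * (c * h)) <= 1 - r.
  rewrite (_ : _ * _ = (1 - r) * s * (c * h)); last by ring.
  by rewrite Es; nra.
rewrite -[leRHS]mulr1 ler_pM2l //.
by nra.
Qed.

Lemma lattice_sum D (w : R -> R) :
  \sum_(l <- lattice D) \prod_(a <- l) w a = (\sum_(a <- lattice1) w a) ^+ D.
Proof.
elim: D => [|D ih]; first by rewrite big_seq1 big_nil expr0.
rewrite big_allpairs_dep exprS -ih big_distrl /=; apply: eq_bigr => a _.
by rewrite big_distrr /=; apply: eq_bigr => l _; rewrite big_cons.
Qed.

Lemma size_lattice D l : l \in lattice D -> size l = D.
Proof.
elim: D l => [|D ih] l; first by rewrite inE => /eqP->.
by move=> /allpairsP[[a l'] /= [_ /ih <- ->]].
Qed.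

End Lattice.

End Rounding.

(** * Averaging the truncated squares over the roundings *)

Section Smoothing.
Variables (R : realType) (h : R).
Hypothesis h0 : 0 < h.

Lemma round_le us (F G : seq R -> R) :
  (forall l, F l <= G l) -> round h us F <= round h us G.
Proof.
elim: us F G => [|u us ih] F G FG /=; first exact: FG.
have [t [t1 t2 E]] := round1E h0 u.
by rewrite !E; apply: lerD; [apply: lerD|];
  rewrite ler_wpM2l ?divr_ge0 ?sqr_ge0 ?ih//; nra.
Qed.

Lemma expR4_le : expR 4 <= 100 :> R.
Proof.
have e0 : 0 < expR (4^-1) :> R by exact: expR_gt0.
have e1 : expR (4^-1) <= 4 / 3 :> R.
  have := @expR_ge1Dx R (- 4^-1); rewrite expRN => H.
  have : (1 - 4^-1) * expR (4^-1) <= 1 :> R by rewrite -ler_pdivlMr// mul1r.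
  lra.
have -> : 4 = 16%:R * 4^-1 :> R by lra.
rewrite expRM_natl (@le_trans _ _ ((4 / 3) ^+ 16))//; last lra.
by rewrite lerXn2r// nnegrE// ltW.
Qed.

Variables (lam sg : R) (us zs : seq R).
Hypotheses (lam0 : 0 <= lam) (sg2 : sg ^+ 2 = 1) (szE : size us = size zs).

Let s := h ^+ 2 / 4 * sdot zs zs.
Let y := sdot us zs.
Let zeta (l : seq R) := sdot l zs - y.

(** The square at a lattice point, centred by the variance of the rounding. *)
Definition devT (l z : seq R) : R :=
  sg * lam * (sdot l z ^+ 2 - h ^+ 2 / 4 * sdot z z - 1).

(** A majorant, visible from the lattice point, of the loss incurred by averaging;
    it must be cut before exponentiation because it is not exponentially
    integrable. *)
Definition devA (l z : seq R) : R :=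
  16 * lam ^+ 2 * (h ^+ 2 / 4 * sdot z z) *
    (sdot l z ^+ 2 + 2 * (h ^+ 2 / 4 * sdot z z)).

Definition devF (l z : seq R) : R :=
  clip (devT l z) + Num.min (devA l z) (10 / 3).

Lemma devA_ge0 l z : 0 <= devA l z.
Proof.
have sz0 : 0 <= h ^+ 2 / 4 * sdot z z.
  by rewrite mulr_ge0 ?sdot_ge0// divr_ge0 ?sqr_ge0.
have l0 : 0 <= 16 * lam ^+ 2 by rewrite mulr_ge0 ?sqr_ge0.
rewrite /devA mulr_ge0 //; first exact: mulr_ge0.
by rewrite addr_ge0 ?sqr_ge0// mulr_ge0.
Qed.

Lemma devF_le l z : devF l z <= 4.
Proof.
rewrite /devF; have := clip_le (devT l z).
have : Num.min (devA l z) (10 / 3) <= 10 / 3 by rewrite ge_min lexx orbT.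
lra.
Qed.

(** Cutting at 10/3 keeps the exponent below 4, and exp 4 <= 100: the cut
    majorant then costs at most 100 times its mean. *)
Lemma expR_devF l z :
  expR (devF l z) <= 1 + devT l z + devT l z ^+ 2 / 2 + 100 * devA l z.
Proof.
rewrite /devF; set t := devT l z; set a := devA l z.
have a0 : 0 <= a := devA_ge0 l z.
set g := Num.min a _.
have g0 : 0 <= g by rewrite /g le_min a0/= divr_ge0.
have ga : g <= a by rewrite /g ge_min lexx.
have g3 : g <= 10 / 3 by rewrite /g ge_min lexx orbT.
have eg : expR g - 1 <= g * expR g.
  have := @expR_ge1Dx R (- g); rewrite expRN => H.
  have := expR_gt0 g => eg0.
  have : (1 - g) * expR g <= 1 by rewrite -ler_pdivlMr// mul1r.
  lra.
have e4 : expR (clip t) * expR g <= 100.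
  rewrite -expRD (le_trans _ expR4_le)// ler_expR.
  by have := clip_le t; lra.
rewrite expRD.
have := expR_clip t.
have : expR (clip t) * (expR g - 1) <= g * 100.
  rewrite (le_trans (y := expR (clip t) * (g * expR g)))//.
    by rewrite ler_wpM2l ?expR_ge0.
  by rewrite mulrCA ler_wpM2l.
have : g * 100 <= a * 100 by rewrite ler_wpM2r.
lra.
Qed.

Let s0 : 0 <= s.
Proof. by rewrite mulr_ge0 ?sdot_ge0// divr_ge0 ?sqr_ge0. Qed.

Let sdotE l : sdot l zs = y + zeta l. Proof. by rewrite /zeta; ring. Qed.

Let zeta1 : round h us zeta = 0. Proof. exact: round_mean. Qed.

Let zeta2 : round h us (fun l => zeta l ^+ 2) = s. Proof. exact: round_var. Qed.

Let zeta4 : round h us (fun l => zeta l ^+ 4) <= 9 * s ^+ 2.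
Proof. exact: round_fourth. Qed.

Let round_poly (c0 c1 c2 c4 : R) :
  round h us (fun l => c0 + (c1 * zeta l + (c2 * zeta l ^+ 2 + c4 * zeta l ^+ 4)))
  = c0 + c2 * s + c4 * round h us (fun l => zeta l ^+ 4).
Proof.
rewrite 3!roundD (roundZ _ _ c1) (roundZ _ _ c2) (roundZ _ _ c4).
by rewrite round_cst// zeta1 zeta2; ring.
Qed.

Let T := devT^~ zs.
Let t := sg * lam * (y ^+ 2 - 1).

Let T_E l : T l = t + sg * lam * (2 * y * zeta l + zeta l ^+ 2 - s).
Proof. by rewrite /T /devT -/s sdotE /t; ring. Qed.

Let T_sqr l : (T l - t) ^+ 2 <= lam ^+ 2 *
  (2 * s ^+ 2 + (8 * y ^+ 2 - 4 * s) * zeta l ^+ 2 + 2 * zeta l ^+ 4).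
Proof.
rewrite T_E addrAC subrr add0r exprMn exprMn sg2 mul1r ler_wpM2l ?sqr_ge0//.
rewrite -subr_ge0 [leRHS](_ : _ = (2 * y * zeta l - (zeta l ^+ 2 - s)) ^+ 2).
  by rewrite sqr_ge0.
by ring.
Qed.

Let vb := lam ^+ 2 * (8 * y ^+ 2 * s + 16 * s ^+ 2).

Let round_sqr : round h us (fun l => (T l - t) ^+ 2) <= vb.
Proof.
apply: le_trans (round_le us T_sqr) _.
rewrite (_ : (fun l => _) = (fun l => lam ^+ 2 * (2 * s ^+ 2) + (0 * zeta l +
  (lam ^+ 2 * (8 * y ^+ 2 - 4 * s) * zeta l ^+ 2 + lam ^+ 2 * 2 * zeta l ^+ 4)))).
  rewrite round_poly /vb.
  have : lam ^+ 2 * round h us (fun l => zeta l ^+ 4) <= lam ^+ 2 * (9 * s ^+ 2).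
    by rewrite ler_wpM2l ?sqr_ge0.
  set r := round _ _ _; move=> H.
  rewrite [leLHS](_ : _ = lam ^+ 2 * (8 * y ^+ 2 * s - 2 * s ^+ 2) +
    2 * (lam ^+ 2 * r)); last by ring.
  rewrite [leRHS](_ : _ = lam ^+ 2 * (8 * y ^+ 2 * s - 2 * s ^+ 2) +
    2 * (lam ^+ 2 * (9 * s ^+ 2))); last by ring.
  by lra.
by apply/funext => l; ring.
Qed.

Let round_T : round h us T = t.
Proof.
rewrite (_ : T = (fun l => (t - sg * lam * s) + (sg * lam * (2 * y) * zeta l +
  (sg * lam * zeta l ^+ 2 + 0 * zeta l ^+ 4)))).
  by rewrite round_poly; ring.
by apply/funext => l; rewrite T_E; ring.
Qed.

(** The truncated square at [us] is dominated by the average of [devF] over the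
    roundings of [us].  The variance of the rounded square, which semiconvexity
    costs, depends on [us]; it is bounded through y^2 <= 2 y'^2 + 2 zeta^2, where
    y' is the value at the lattice point. *)
Lemma clip_le_round :
  clip (sg * lam * (sdot us zs ^+ 2 - 1)) <= round h us (devF^~ zs).
Proof.
rewrite -/y -/t; have [p Hp] := clip_semiconvex t.
have s1 : clip t - vb <= round h us (fun l => clip (T l)).
  apply: le_trans (round_le us (fun l => Hp (T l))).
  have [k Ek] : {k | k = clip t - p * t} by exists (clip t - p * t).
  rewrite (_ : (fun l => _) = (fun l => k + (p * T l +
    (-1) * (T l - t) ^+ 2))); last by apply/funext => l; rewrite Ek; ring.
  rewrite 2!roundD (roundZ _ _ p) (roundZ _ _ (-1)) round_cst// round_T.
  by have := round_sqr; lra.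
have s2 : clip t - 5 / 3 <= round h us (fun l => clip (T l)).
  apply: (@le_trans _ _ (-1)); first by have := clip_le t; lra.
  by rewrite -(round_cst h0 us (-1)); apply: round_le => l; exact: clip_ge.
rewrite /devF roundD -lerBlDl.
set X := clip t - _.
have X1 : X <= vb by rewrite /X; lra.
have X2 : X <= 5 / 3 by rewrite /X; lra.
pose B l := 16 * lam ^+ 2 * s * sdot l zs ^+ 2 + 16 * lam ^+ 2 * s ^+ 2.
have ss : 0 <= lam ^+ 2 * s by rewrite mulr_ge0 ?sqr_ge0.
have key l : vb <= B l + 16 * lam ^+ 2 * s * zeta l ^+ 2.
  rewrite /B sdotE /vb -subr_ge0.
  rewrite (_ : _ - _ = 8 * (lam ^+ 2 * s) * (y + 2 * zeta l) ^+ 2); last by ring.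
  by rewrite mulr_ge0 ?sqr_ge0// mulr_ge0.
pose w := 16 * lam ^+ 2 * s ^+ 2.
have w0 : 0 <= w by rewrite /w -mulrA mulr_ge0// mulr_ge0 ?sqr_ge0.
pose m1 := round h us (fun l => Num.min (B l) (5 / 3)).
have B0 l : 0 <= B l.
  by rewrite addr_ge0// -[16 * _ * s]mulrA mulr_ge0 ?sqr_ge0// mulr_ge0.
have m10 : 0 <= m1.
  rewrite -(round_cst h0 us 0); apply: round_le => l.
  by rewrite le_min B0/= divr_ge0.
have X3 : X <= m1 + w.
  have k2 l : X + (- (16 * lam ^+ 2 * s)) * zeta l ^+ 2 <= Num.min (B l) (5 / 3).
    have := key l.
    have : 0 <= 16 * lam ^+ 2 * s * zeta l ^+ 2.
      by rewrite mulr_ge0 ?sqr_ge0// -mulrA mulr_ge0.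
    by rewrite le_min => ? ?; apply/andP; split; lra.
  have := round_le us k2.
  rewrite roundD (roundZ _ _ (- (16 * lam ^+ 2 * s))) round_cst// zeta2 -/m1.
  by rewrite /w; lra.
have X4 : X <= m1 + Num.min w (5 / 3).
  by have [|] := leP w (5 / 3) => _ //; lra.
apply: (le_trans X4); rewrite -(round_cst h0 us (Num.min w _)) -roundD.
apply: round_le => l.
have -> : devA l zs = B l + w by rewrite /devA -/s /B /w; ring.
rewrite le_min; apply/andP; split.
  by rewrite lerD// ge_min lexx.
have : Num.min (B l) (5 / 3) <= 5 / 3 by rewrite ge_min lexx orbT.
have : Num.min w (5 / 3) <= 5 / 3 by rewrite ge_min lexx orbT.
lra.
Qed.

(** Averaged over the roundings, the polynomial that bounds the exponential moment
    is the one at the rounded point itself, up to terms of the order of the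
    variance [s] of the rounding. *)
Lemma round_majorant :
  round h us (fun l => 1 + devT l zs + devT l zs ^+ 2 / 2 + 100 * devA l zs)
  <= 1 + t + t ^+ 2 / 2
     + lam ^+ 2 * (1604 * (y ^+ 2 * s) + 4808 * s ^+ 2).
Proof.
have [k Ek] : {k | k = 1 - t ^+ 2 / 2} by exists (1 - t ^+ 2 / 2).
rewrite (_ : (fun l => _) = (fun l => k + ((1 + t) * T l +
  ((1 / 2) * (T l - t) ^+ 2 + ((1600 * lam ^+ 2 * s * (y ^+ 2 + 2 * s)) +
   (1600 * lam ^+ 2 * s * 2 * y * zeta l +
     (1600 * lam ^+ 2 * s * zeta l ^+ 2 + 0 * zeta l ^+ 4))))))); last first.
  by apply/funext => l; rewrite /devA -/s sdotE -/(T l) Ek; field.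
rewrite 3!roundD (roundZ _ _ (1 + t)) (roundZ _ _ (1 / 2)) round_poly round_cst//.
rewrite round_T Ek; have := round_sqr; rewrite /vb.
set r := round _ _ _; lra.
Qed.

End Smoothing.

(** * Expectations of real random variables *)

Section Expectation.
Variables (R : realType) (dT : measure_display) (T : measurableType dT).
Variable P : probability T R.
Implicit Types (f g : T -> R).

Local Notation Ex f := (fine ('E_P[f%R])%E).

Definition itg f : Prop := P.-integrable setT (EFin \o f).

Lemma ExE f : Ex f = \int[P]_w f w.
Proof. by rewrite unlock. Qed.

Lemma itg_meas f : itg f -> measurable_fun setT f.
Proof. by move=> /integrableP[mf _]; apply/measurable_EFinP. Qed.

Lemma expectationE f : itg f -> ('E_P[f] = (Ex f)%:E)%E.
Proof.
by move=> fi; rewrite fineK// unlock; exact: (integrable_fin_num measurableT fi).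
Qed.

Lemma itg_cst (c : R) : itg (fun=> c).
Proof. exact: (finite_measure_integrable_cst P c measurableT). Qed.

Lemma itgD f g : itg f -> itg g -> itg (fun w => f w + g w).
Proof.
move=> fi gi; have := integrableD measurableT fi gi.
by apply: eq_integrable => // w _ /=.
Qed.

Lemma itgZ c f : itg f -> itg (fun w => c * f w).
Proof.
move=> fi; have := integrableZl measurableT c fi.
by apply: eq_integrable => // w _ /=.
Qed.

Lemma itg_sum (I : Type) (s : seq I) (F : I -> T -> R) :
  (forall i, itg (F i)) -> itg (fun w => \sum_(i <- s) F i w).
Proof.
move=> Fi; elim: s => [|i s ih].
  by under eq_fun do rewrite big_nil; exact: itg_cst.
by under eq_fun do rewrite big_cons; exact: itgD.
Qed.

Lemma itg_le f g : measurable_fun setT f -> itg g ->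
  (forall w, `|f w| <= g w) -> itg f.
Proof.
move=> mf gi fg; apply: (le_integrable measurableT _ _ gi).
  exact/measurable_EFinP.
by move=> w _ /=; rewrite lee_fin (le_trans (fg w))// ler_norm.
Qed.

Lemma itg_bounded f B : measurable_fun setT f -> (forall w, `|f w| <= B) -> itg f.
Proof. by move=> mf fB; apply: itg_le (itg_cst B) fB. Qed.

Lemma Ex_cst c : Ex (fun=> c) = c.
Proof.
rewrite ExE Rintegral_cst//.
by have /= -> := @probability_setT _ _ _ P; rewrite mulr1.
Qed.

Lemma ExD f g : itg f -> itg g -> Ex (fun w => f w + g w) = Ex f + Ex g.
Proof. by move=> fi gi; rewrite !ExE RintegralD. Qed.

Lemma ExZ c f : itg f -> Ex (fun w => c * f w) = c * Ex f.
Proof. by move=> fi; rewrite !ExE RintegralZl. Qed.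

Lemma Ex_le f g : itg f -> itg g -> (forall w, f w <= g w) -> Ex f <= Ex g.
Proof. by move=> fi gi fg; rewrite !ExE; apply: le_Rintegral. Qed.

Lemma Ex_ge0 f : (forall w, 0 <= f w) -> 0 <= Ex f.
Proof. by move=> f0; rewrite ExE; apply: Rintegral_ge0. Qed.

Lemma Ex_sum (I : Type) (s : seq I) (F : I -> T -> R) :
  (forall i, itg (F i)) ->
  Ex (fun w => \sum_(i <- s) F i w) = \sum_(i <- s) Ex (F i).
Proof.
move=> Fi; elim: s => [|i s ih].
  by under eq_fun do rewrite big_nil; rewrite Ex_cst big_nil.
under eq_fun do rewrite big_cons.
by rewrite ExD//; [rewrite ih big_cons|exact: itg_sum].
Qed.

Lemma itg_indic (A : set T) : measurable A -> itg (\1_A).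
Proof.
move=> mA; apply: (@itg_bounded _ 1); first exact: measurable_indic.
by move=> w; rewrite indicE; case: (_ \in _); rewrite /= ?normr1 ?normr0.
Qed.

Lemma Ex_indic (A : set T) : measurable A -> Ex (\1_A) = fine (P A).
Proof.
by move=> mA; rewrite ExE /Rintegral integral_indic// setIT.
Qed.

Lemma prob_le_Ex f (A : set T) : measurable A -> itg f ->
  (forall w, 0 <= f w) -> (forall w, A w -> 1 <= f w) ->
  (P A <= (Ex f)%:E)%E.
Proof.
move=> mA fi f0 f1; rewrite -[leLHS]fineK ?fin_num_measure// lee_fin -Ex_indic//.
apply: Ex_le => // [|w]; first exact: itg_indic.
rewrite indicE; case: (boolP (w \in A)) => [|_]; last exact: f0.
by rewrite inE => /f1.
Qed.

(** A nonnegative variable of zero mean vanishes almost surely. *)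
Lemma Ex_eq0 f : itg f -> (forall w, 0 <= f w) -> Ex f = 0 ->
  P [set w | f w != 0] = 0%E.
Proof.
move=> fi f0 Ef.
have mf : measurable_fun setT (EFin \o f) by apply/measurable_EFinP/itg_meas.
have I0 : (\int[P]_w (EFin \o f) w = 0)%E.
  by have := expectationE fi; rewrite Ef unlock.
have : {ae P, forall w, setT w -> (EFin \o f) w = 0%E}.
  apply/(ae_eq_integral_abs P measurableT mf).
  by under eq_integral do rewrite gee0_abs ?lee_fin ?f0//.
move=> [N [mN N0 sub]].
apply/eqP; rewrite eq_le measure_ge0 andbT -N0 le_measure ?inE//.
  have -> : [set w | f w != 0] = setT `&` f @^-1` (~` [set 0]).
    by rewrite setTI; apply/seteqP; split => w /= /eqP.
  by apply: (itg_meas fi) => //; apply: measurableC; exact: measurable_set1.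
move=> w /= fw; apply: sub => /= /(_ Logic.I) [] /eqP; exact/negP.
Qed.

Lemma prob_compl_ge (A : set T) (e : R) : measurable A ->
  (P A <= e%:E)%E -> ((1 - e)%:E <= P (~` A))%E.
Proof.
by move=> mA PA; rewrite probability_setC// EFinB leeB.
Qed.

End Expectation.

(** * Independent samples *)

Section Independence.
Variables (R : realType) (dT : measure_display) (T : measurableType dT).
Variables (P : probability T R) (d : nat) (Z : {RV P >-> obs R d}).
Variables (n : nat) (Zs : 'I_n -> {RV P >-> obs R d}).
Hypothesis ind : independent_copies Z Zs.

Local Notation Ex f := (fine ('E_P[f%R])%E).

Lemma Ex_prod_indic (A : 'I_n -> set (obs R d)) : (forall i, measurable (A i)) ->
  Ex (fun w => \prod_(i < n) \1_(A i) (Zs i w)) =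
  \prod_(i < n) Ex (fun w => \1_(A i) (Z w)).
Proof.
move=> mA; have [law ind'] := ind.
have mpre (X : {RV P >-> obs R d}) B : measurable B -> measurable (X @^-1` B).
  by move=> mB; rewrite -[_ @^-1` _]setTI; exact: measurable_funPT.
have -> : (fun w => \prod_(i < n) \1_(A i) (Zs i w)) =
    \1_(\bigcap_(i in [set: 'I_n]) (Zs i @^-1` A i)) :> (T -> R).
  apply/funext => w; rewrite [RHS]indicE.
  case: (boolP (w \in _)) => [|/negP].
    rewrite inE => h; apply: big1 => i _; rewrite indicE.
    by rewrite (_ : _ \in _)// inE; exact: h.
  rewrite inE => h; have /existsNP[i hi] : ~ forall i, A i (Zs i w).
    by move=> h'; apply: h => i _; exact: h'.
  rewrite (bigD1 i)//= indicE (_ : _ \in _ = false) ?mul0r//.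
  by apply/negP; rewrite inE.
rewrite Ex_indic; last by apply: fin_bigcap_measurable => // i _; exact: mpre.
rewrite ind'//.
have E i : P (Zs i @^-1` A i) = (Ex (fun w => \1_(A i) (Z w)))%:E.
  rewrite (law i _ (mA i)) -[LHS]fineK ?fin_num_measure//; last exact: mpre.
  by rewrite -Ex_indic//; exact: mpre.
under eq_bigr do rewrite E.
by rewrite prodEFin.
Qed.

(** The product rule for indicators extends to bounded functions by
    approximating them from above by step functions; only the inequality
    survives, in the exponential form which is convenient later. *)
Lemma Ex_prod_le (g : obs R d -> R) (B : R) : measurable_fun setT g ->
  (forall x, 0 <= g x) -> (forall x, g x <= B) ->
  Ex (fun w => \prod_(i < n) g (Zs i w)) <=
  expR (n%:R * (Ex (fun w => g (Z w)) - 1)).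
Proof.
move=> mg g0 gB.
have B0 : 0 <= B by exact: le_trans (g0 point) (gB point).
have mX (X : {RV P >-> obs R d}) : measurable_fun setT (fun w => g (X w)).
  by apply: measurableT_comp => //; exact: measurable_funPT.
have gX (X : {RV P >-> obs R d}) : itg P (fun w => g (X w)).
  by apply: (@itg_bounded _ _ _ _ _ B) => // w; rewrite ger0_norm.
have step (eta : R) : 0 < eta ->
    Ex (fun w => \prod_(i < n) g (Zs i w)) <=
    (Ex (fun w => g (Z w)) + eta) ^+ n.
  move=> e0.
  pose M := (Num.trunc (B / eta)).+1.
  pose A (k : 'I_M) := g @^-1` `[eta * k%:R, eta * k.+1%:R[%classic.
  have mA k : measurable (A k) by rewrite -[A k]setTI; exact: mg.
  pose gt x := \sum_(k < M) eta * k.+1%:R * \1_(A k) x.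
  have Ax x (k : 'I_M) : (\1_(A k) x : R) = (k == Num.trunc (g x / eta) :> nat)%:R.
    rewrite indicE; congr (_%:R); congr nat_of_bool; apply/idP/idP.
      rewrite inE /A /= in_itv /= => /andP[h1 h2].
      rewrite eq_sym; apply/eqP/Num.Theory.truncn_def.
      by rewrite ler_pdivlMr// ltr_pdivrMr// mulrC h1 mulrC.
    move=> /eqP kE; rewrite inE /A /= in_itv /= kE.
    have := @Num.Theory.truncn_itv R (g x / eta).
    by rewrite divr_ge0 ?(ltW e0)// => /(_ isT); rewrite ler_pdivlMr// ltr_pdivrMr// mulrC [X in _ < X]mulrC.
  have gtE x : gt x = eta * (Num.trunc (g x / eta)).+1%:R.
    have hk : (Num.trunc (g x / eta) < M)%N.
      by rewrite ltnS Num.Theory.le_truncn// ler_pM2r ?invr_gt0.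
    rewrite /gt (bigD1 (Ordinal hk))//= Ax eqxx mulr1 big1 ?addr0// => k kn.
    by rewrite Ax (_ : _ == _ = false) ?mulr0//; apply/negbTE; rewrite -val_eqE in kn.
  have gt1 x : g x <= gt x.
    rewrite gtE mulrC -ler_pdivrMr//.
    by have := @Num.Theory.truncn_itv R (g x / eta); rewrite divr_ge0 ?(ltW e0)// => /(_ isT) /andP[_ /ltW].
  have gt2 x : gt x <= g x + eta.
    rewrite gtE -natr1 mulrDr mulr1 lerD2r mulrC -ler_pdivlMr//.
    by have := @Num.Theory.truncn_itv R (g x / eta); rewrite divr_ge0 ?(ltW e0)// => /(_ isT) /andP[].
  have mgt : measurable_fun setT gt.
    by apply: measurable_sum => k; apply: measurable_funM.
  have gt0 x : 0 <= gt x := le_trans (g0 x) (gt1 x).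
  have gtB x : gt x <= B + eta by rewrite (le_trans (gt2 x))// lerD2r.
  have mgtX (X : {RV P >-> obs R d}) : measurable_fun setT (fun w => gt (X w)).
    by apply: measurableT_comp => //; exact: measurable_funPT.
  have iprod (f : 'I_n -> obs R d -> R) C : (forall i, measurable_fun setT (f i)) ->
      (forall i x, 0 <= f i x) -> (forall i x, f i x <= C) ->
      itg P (fun w => \prod_(i < n) f i (Zs i w)).
    move=> mf f0 fC; apply: (@itg_bounded _ _ _ _ _ (\prod_(i < n) C)).
      by apply: measurable_prod => i _; apply: measurableT_comp.
    move=> w; rewrite ger0_norm ?prodr_ge0//.
    by apply: ler_prod => i _; rewrite f0 fC.
  apply: (@le_trans _ _ (Ex (fun w => \prod_(i < n) gt (Zs i w)))).
    apply: Ex_le => [||w]; [exact: iprod (fun=> mg) _ _|exact: iprod (fun=> mgt) _ _|].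
    by apply: ler_prod => i _; rewrite g0 gt1.
  apply: (@le_trans _ _ (Ex (fun w => gt (Z w)) ^+ n)); last first.
    apply: lerXn2r; rewrite ?nnegrE ?addr_ge0 ?Ex_ge0 ?(ltW e0)//.
    rewrite -[eta in leRHS](Ex_cst P eta) -ExD//; last exact: itg_cst.
    apply: Ex_le => //; last by apply: itgD => //; exact: itg_cst.
    by apply: (@itg_bounded _ _ _ _ _ (B + eta)) => // w; rewrite ger0_norm.
  have mi k (X : {RV P >-> obs R d}) : itg P (fun w => \1_(A k) (X w)).
    apply: (@itg_bounded _ _ _ _ _ 1).
      by apply: measurableT_comp; [exact: measurable_indic (mA _)|exact: measurable_funPT].
    by move=> w; rewrite indicE; case: (_ \in _); rewrite /= ?normr1 ?normr0.
  under eq_fun do rewrite /gt bigA_distr_bigA /=.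
  pose pi (f : {ffun 'I_n -> 'I_M}) := \prod_(i < n) (eta * (f i).+1%:R).
  have i1 (f : {ffun 'I_n -> 'I_M}) :
      itg P (fun w => \prod_(i < n) \1_(A (f i)) (Zs i w)).
    apply: (iprod (fun i => \1_(A (f i))) 1) => [i|i x|i x].
    - exact: measurable_indic (mA _).
    - by rewrite indicE ler0n.
    - by rewrite indicE lern1 leq_b1.
  rewrite (_ : (fun w => _) = (fun w => \sum_(f : {ffun 'I_n -> 'I_M})
     pi f * \prod_(i < n) \1_(A (f i)) (Zs i w))); last first.
    by apply/funext => w; apply: eq_bigr => f _; rewrite big_split.
  rewrite Ex_sum => [|f]; last exact: itgZ.
  under eq_bigr => f _ do rewrite ExZ// Ex_prod_indic// -big_split /=.
  rewrite -(bigA_distr_bigA (fun (i : 'I_n) (k : 'I_M) =>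
    eta * k.+1%:R * Ex (fun w => \1_(A k) (Z w)))) /= prodr_const card_ord.
  apply: lerXn2r; rewrite ?nnegrE ?Ex_ge0//.
    apply: sumr_ge0 => k _.
    by rewrite mulr_ge0 ?Ex_ge0 ?mulr_ge0 ?ler0n ?(ltW e0).
  rewrite /gt Ex_sum => [|k]; last by apply: itgZ.
  by apply: ler_sum => k _; rewrite ExZ.
set E := Ex (fun w => g (Z w)) in step *.
set X := Ex _ in step *.
have X0 : 0 <= X by apply: Ex_ge0 => w; apply: prodr_ge0.
have E0 : 0 <= E by apply: Ex_ge0.
have main s : 0 < s -> X * (1 - n%:R * s) <= expR (n%:R * (E - 1)).
  move=> s0; have := step s s0 => Xs.
  have : X <= expR (n%:R * (E - 1)) * expR (n%:R * s).
    rewrite -expRD -mulrDr expRM_natl (le_trans Xs)// lerXn2r ?nnegrE ?expR_ge0//.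
      by rewrite addr_ge0// ltW.
    by rewrite (le_trans _ (@expR_ge1Dx R _))//; lra.
  rewrite -ler_pdivrMr ?expR_gt0// -expRN; apply: le_trans.
  by rewrite ler_wpM2l// expR_ge1Dx.
rewrite leNgt; apply/negP => lt; set Y := expR _ in main lt.
have d0 : 0 < X - Y by rewrite subr_gt0.
have k0 : 0 < 2 * (1 + n%:R) * (1 + X) by rewrite !mulr_gt0 ?ltr_pwDl.
have := main _ (divr_gt0 d0 k0); set D := X - Y in d0 *.
have : X * (n%:R * (D / (2 * (1 + n%:R) * (1 + X)))) <= D / 2.
  rewrite (_ : X * _ = (X / (1 + X)) * (n%:R / (1 + n%:R)) * (D / 2)); last first.
    by field; rewrite !gt_eqF// ltr_pwDl ?ler0n.
  have a1 : X / (1 + X) <= 1 by rewrite ler_pdivrMr ?ltr_pwDl// mul1r lerDr.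
  have a2 : n%:R / (1 + n%:R) <= 1 :> R by rewrite ler_pdivrMr ?ltr_pwDl// mul1r lerDr.
  have : X / (1 + X) * (n%:R / (1 + n%:R)) <= 1.
    by rewrite mulr_ile1 ?divr_ge0 ?addr_ge0.
  by move=> /(ler_wpM2r (divr_ge0 (ltW d0) (ler0n R 2))); rewrite mul1r.
rewrite mulrBr mulr1 /D; set q := X * _; lra.
Qed.

End Independence.

(** * A uniform deviation bound for truncated squares *)

Section Uniform.
Variables (R : realType) (dT : measure_display) (T : measurableType dT).
Variables (P : probability T R) (d : nat) (Z : {RV P >-> obs R d}).

Local Notation Ex f := (fine ('E_P[f%R])%E).

(** A weighted union bound: the exponential moments of all indices are averaged
    before Markov's inequality is applied. *)
Lemma weighted_union (n : nat) (Zs : 'I_n -> {RV P >-> obs R d}) (I : eqType)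
    (L : seq I) (w : I -> R) (F : I -> obs R d -> R) (B eps : R) :
  independent_copies Z Zs -> 0 < eps -> (forall l, 0 < w l) ->
  \sum_(l <- L) w l <= 1 ->
  (forall l, measurable_fun setT (F l)) -> (forall l x, F l x <= B) ->
  exists A : set T, [/\ measurable A, ((1 - eps)%:E <= P A)%E &
    forall om, A om -> forall l, l \in L -> \sum_(i < n) F l (Zs i om) <=
      n%:R * (Ex (fun om => expR (F l (Z om))) - 1) + ln (w l)^-1 + ln eps^-1].
Proof.
move=> ind e0 w0 w1 mF FB.
pose E l := n%:R * (Ex (fun om => expR (F l (Z om))) - 1).
pose S l om := \sum_(i < n) F l (Zs i om).
pose G om := \sum_(l <- L) (w l * expR (- E l)) * expR (S l om).
have mS l : measurable_fun setT (S l).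
  by apply: measurable_sum => i; apply: measurableT_comp.
have iS l : itg P (fun om => expR (S l om)).
  apply: (@itg_bounded _ _ _ _ _ (expR (\sum_(i < n) B))).
    by apply: measurableT_comp.
  move=> om; rewrite ger0_norm ?expR_ge0// ler_expR.
  by apply: ler_sum => i _; exact: FB.
have iG : itg P G by apply: itg_sum => l; exact: itgZ.
have G0 om : 0 <= G om.
  by apply: sumr_ge0 => l _; rewrite !mulr_ge0 ?expR_ge0// ltW.
have EG : Ex G <= 1.
  rewrite Ex_sum => [|l]; last exact: itgZ.
  apply: le_trans w1; apply: ler_sum => l _.
  rewrite ExZ// -mulrA -[leRHS]mulr1 ler_wpM2l ?(ltW (w0 l))//.
  rewrite -(expRxMexpNx_1 (- E l)) opprK ler_wpM2l ?expR_ge0//.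
  rewrite (_ : (fun om => _) = (fun om => \prod_(i < n) expR (F l (Zs i om)))).
    apply: (@Ex_prod_le _ _ _ _ _ _ _ _ ind (fun x => expR (F l x)) (expR B)).
    - by apply: measurableT_comp.
    - by move=> x; exact: expR_ge0.
    - by move=> x; rewrite ler_expR.
  by apply/funext => om; rewrite /S expR_sum.
have mA : measurable [set om | 1 < eps * G om].
  rewrite -[X in measurable X]setTI.
  apply: measurable_fun_ltr => //; apply: measurable_funM => //.
  exact: (itg_meas iG).
exists (~` [set om | 1 < eps * G om]); split.
- exact: measurableC.
- apply: prob_compl_ge => //.
  apply: (@le_trans _ _ (Ex (fun om => eps * G om))%:E).
    apply: prob_le_Ex => //; first exact: itgZ.
      by move=> om; rewrite mulr_ge0// ltW.
    by move=> om /= /ltW.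
  by rewrite lee_fin ExZ// -[leRHS]mulr1 ler_wpM2l// ltW.
- move=> om /negP; rewrite -leNgt => GA l lL.
  have : eps * ((w l * expR (- E l)) * expR (S l om)) <= 1.
    apply: le_trans GA; rewrite ler_wpM2l ?(ltW e0)// /G (big_rem l)//= lerDl.
    by apply: sumr_ge0 => l' _; rewrite !mulr_ge0 ?expR_ge0// ltW.
  have -> : eps * ((w l * expR (- E l)) * expR (S l om)) =
      expR (ln eps + ln (w l) - E l + S l om).
    by rewrite 3!expRD !lnK ?posrE//; ring.
  rewrite expR_le1 !lnV ?posrE// -/(S l om) -/(E l).
  by move=> h; lra.
Qed.

(** Fourth moments of the features are all that is needed to control the
    squared norm of the vector of features. *)
Lemma sdot_sq_le (z : seq R) :
  sdot z z ^+ 2 <= (size z)%:R * \sum_(x <- z) x ^+ 4.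
Proof.
have e1 : sdot z z = sdot (nseq (size z) 1) [seq x ^+ 2 | x <- z].
  by elim: z => //= x z ->; rewrite mul1r.
have e2 : (size z)%:R = sdot (nseq (size z) 1) (nseq (size z) 1) :> R.
  by elim: (size z) => //= k <-; rewrite mul1r -natr1 addrC.
have e3 : \sum_(x <- z) x ^+ 4 = sdot [seq x ^+ 2 | x <- z] [seq x ^+ 2 | x <- z].
  elim: z {e1 e2} => [|x z ih] /=; first by rewrite big_nil.
  by rewrite big_cons ih -exprD.
by rewrite e1 e2 e3; exact: sdot_cs.
Qed.

Section Swap.
Variable h : R.

Lemma Ex_round (us : seq R) (Q : seq R -> T -> R) : (forall l, itg P (Q l)) ->
  itg P (fun om => round h us (Q^~ om)) /\
  Ex (fun om => round h us (Q^~ om)) = round h us (fun l => Ex (Q l)).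
Proof.
elim: us Q => [|u us ih] Q iQ /=; first by split.
have ih' a := ih (fun l => Q (a :: l)) (fun l => iQ (a :: l)).
rewrite /round1; set a := h * _; set t := (u - a) / h.
have i1 c b : itg P (fun om => c * round h us (fun l => Q (b :: l) om)).
  by apply: itgZ; case: (ih' b).
split; first by apply: itgD => //; apply: itgD.
rewrite ExD//; last by apply: itgD.
rewrite ExD// !ExZ; [|by case: (ih' (a + h))|by case: (ih' a)|by case: (ih' (a - h))].
by have [_ ->] := ih' (a - h); have [_ ->] := ih' a; have [_ ->] := ih' (a + h).
Qed.

End Swap.

Variables (fs : seq (obs R d -> R)).
Hypothesis mfs : forall f, f \in fs -> measurable_fun setT f.

Definition feat (x : obs R d) : seq R := [seq f x | f <- fs].

Lemma size_feat x : size (feat x) = size fs. Proof. exact: size_map. Qed.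

Lemma measurable_sdotl (u : seq R) : measurable_fun setT (fun x => sdot u (feat x)).
Proof.
rewrite /feat; elim: fs mfs u => [|f s ih] ms [|a u] /=; try exact: measurable_cst.
apply: measurable_funD; last first.
  by apply: ih => g gs; apply: ms; rewrite inE gs orbT.
by apply: measurable_funM => //; apply: ms; rewrite inE eqxx.
Qed.

Lemma measurable_sdot2 : measurable_fun setT (fun x => sdot (feat x) (feat x)).
Proof.
rewrite /feat; elim: fs mfs => [|f s ih] ms /=; first exact: measurable_cst.
apply: measurable_funD; last first.
  by apply: ih => g gs; apply: ms; rewrite inE gs orbT.
by apply: measurable_funM => //; apply: ms; rewrite inE eqxx.
Qed.

Let q om := sdot (feat (Z om)) (feat (Z om)).
Let y u om := sdot u (feat (Z om)).

Hypothesis iq2 : itg P (fun om => q om ^+ 2).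

Let q0 om : 0 <= q om. Proof. exact: sdot_ge0. Qed.

Let mq : measurable_fun setT q.
Proof.
exact: measurableT_comp measurable_sdot2 (measurable_funPT Z).
Qed.

Let my u : measurable_fun setT (y u).
Proof.
exact: measurableT_comp (measurable_sdotl u) (measurable_funPT Z).
Qed.

Let iq : itg P q.
Proof.
apply: (itg_le mq (itgD (itg_cst P 1) iq2)) => om.
by rewrite ger0_norm//; have := sqr_ge0 (q om - 1); have := q0 om; lra.
Qed.

Let yq u om : y u om ^+ 2 <= sdot u u * q om. Proof. exact: sdot_cs. Qed.

Let iy2 u : itg P (fun om => y u om ^+ 2).
Proof.
apply: (@itg_le _ _ _ _ _ (fun om => sdot u u * q om));
  [exact: measurable_funX|exact: itgZ|].
by move=> om; rewrite ger0_norm ?sqr_ge0.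
Qed.

Let iy2q u : itg P (fun om => y u om ^+ 2 * q om).
Proof.
apply: (@itg_le _ _ _ _ _ (fun om => sdot u u * q om ^+ 2));
  [|exact: itgZ|].
  by apply: measurable_funM => //; exact: measurable_funX.
move=> om; rewrite ger0_norm; last by rewrite mulr_ge0// sqr_ge0.
by rewrite [q om ^+ 2]expr2 mulrA ler_wpM2r.
Qed.

Let iy4 u : itg P (fun om => y u om ^+ 4).
Proof.
apply: (@itg_le _ _ _ _ _ (fun om => sdot u u ^+ 2 * q om ^+ 2));
  [exact: measurable_funX|exact: itgZ|].
move=> om; rewrite -[4%N]/((2 * 2)%N) exprM ger0_norm ?sqr_ge0// -exprMn.
by rewrite lerXn2r ?nnegrE ?sqr_ge0// mulr_ge0// sdot_ge0.
Qed.

Let quad (u : seq R) (a0 a1 a2 a3 a4 a5 : R) om :=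
  a0 + (a1 * y u om ^+ 2 + (a2 * q om + (a3 * y u om ^+ 4 +
   (a4 * (y u om ^+ 2 * q om) + a5 * q om ^+ 2)))).

Let iquad u a0 a1 a2 a3 a4 a5 : itg P (quad u a0 a1 a2 a3 a4 a5).
Proof.
apply: itgD; first exact: itg_cst.
do 4! (apply: itgD; first by apply: itgZ; auto).
exact: itgZ.
Qed.

Let Ex_quad u a0 a1 a2 a3 a4 a5 : Ex (quad u a0 a1 a2 a3 a4 a5) =
  a0 + (a1 * Ex (fun om => y u om ^+ 2) + (a2 * Ex q +
   (a3 * Ex (fun om => y u om ^+ 4) +
   (a4 * Ex (fun om => y u om ^+ 2 * q om) + a5 * Ex (fun om => q om ^+ 2))))).
Proof.
rewrite /quad.
have i5 := itgZ a5 iq2.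
have i4 := itgD (itgZ a4 (iy2q u)) i5.
have i3 := itgD (itgZ a3 (iy4 u)) i4.
have i2 := itgD (itgZ a2 iq) i3.
have i1 := itgD (itgZ a1 (iy2 u)) i2.
rewrite (ExD (itg_cst P a0) i1) Ex_cst (ExD (itgZ a1 (iy2 u)) i2).
rewrite (ExD (itgZ a2 iq) i3) (ExD (itgZ a3 (iy4 u)) i4).
rewrite (ExD (itgZ a4 (iy2q u)) i5).
rewrite (ExZ a1 (iy2 u)) (ExZ a2 iq) (ExZ a3 (iy4 u)) (ExZ a4 (iy2q u)).
by rewrite (ExZ a5 iq2).
Qed.

Lemma Ex_devF_le (h lam sg : R) (l : seq R) :
  (forall l, measurable_fun setT (fun x => devF h lam sg l (feat x))) ->
  Ex (fun om => expR (devF h lam sg l (feat (Z om)))) <=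
  Ex (fun om => 1 + devT h lam sg l (feat (Z om))
    + devT h lam sg l (feat (Z om)) ^+ 2 / 2 + 100 * devA h lam l (feat (Z om))) /\
  itg P (fun om => 1 + devT h lam sg l (feat (Z om))
    + devT h lam sg l (feat (Z om)) ^+ 2 / 2 + 100 * devA h lam l (feat (Z om))).
Proof.
move=> mF.
pose s := h ^+ 2 / 4.
have E : (fun om => 1 + devT h lam sg l (feat (Z om))
    + devT h lam sg l (feat (Z om)) ^+ 2 / 2 + 100 * devA h lam l (feat (Z om)))
  = quad l (1 - sg * lam + (sg * lam) ^+ 2 / 2)
      (sg * lam - (sg * lam) ^+ 2) (- (sg * lam * s) + (sg * lam) ^+ 2 * s)
      ((sg * lam) ^+ 2 / 2) (- ((sg * lam) ^+ 2 * s) + 1600 * lam ^+ 2 * s)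
      ((sg * lam * s) ^+ 2 / 2 + 3200 * (lam * s) ^+ 2).
  by apply/funext => om; rewrite /quad /devT /devA -/(y l om) -/(q om) -/s; field.
have iE := iquad l (1 - sg * lam + (sg * lam) ^+ 2 / 2)
      (sg * lam - (sg * lam) ^+ 2) (- (sg * lam * s) + (sg * lam) ^+ 2 * s)
      ((sg * lam) ^+ 2 / 2) (- ((sg * lam) ^+ 2 * s) + 1600 * lam ^+ 2 * s)
      ((sg * lam * s) ^+ 2 / 2 + 3200 * (lam * s) ^+ 2).
rewrite -E in iE; split => //.
apply: Ex_le => // [|om]; last exact: expR_devF.
apply: (@itg_bounded _ _ _ _ _ (expR 4)).
  apply: measurableT_comp => //.
  exact: measurableT_comp (mF l) (measurable_funPT Z).
by move=> om; rewrite ger0_norm ?expR_ge0// ler_expR devF_le.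
Qed.

(** A formula without tests, from which measurability is visible. *)
Lemma clipE (t : R) : clip t =
  Num.max (-1) (Num.min t 0) + (Num.max 0 (Num.min t 1)
   - Num.max 0 (Num.min t 1) ^+ 3 / 3).
Proof.
rewrite /clip; case: (leP t (-1)) => h1.
  by rewrite !min_l; [rewrite !max_l ?expr0n/=; lra|lra..].
case: (leP t 0) => h2.
  by rewrite min_l; [rewrite max_r ?max_l ?expr0n/=; lra|lra].
case: (leP t 1) => h3.
  by rewrite [Num.max (-1) _]max_r ?[Num.max 0 _]max_r; lra.
by rewrite [Num.max (-1) _]max_r ?[Num.max 0 _]max_r ?expr1n; lra.
Qed.

Lemma measurable_clip (f : obs R d -> R) : measurable_fun setT f ->
  measurable_fun setT (fun x => clip (f x)).
Proof.
move=> mf; under eq_fun do rewrite clipE.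
have m1 : measurable_fun setT (fun x => Num.max 0 (Num.min (f x) 1)).
  by apply: measurable_maxr => //; exact: measurable_minr.
apply: measurable_funD.
  by apply: measurable_maxr => //; exact: measurable_minr.
apply: measurable_funB => //; apply: measurable_funM => //.
exact: measurable_funX.
Qed.

Lemma measurable_devF (h lam sg : R) (l : seq R) :
  measurable_fun setT (fun x => devF h lam sg l (feat x)).
Proof.
have mT : measurable_fun setT (fun x => sdot l (feat x) ^+ 2).
  by apply: measurable_funX; exact: measurable_sdotl.
have mq' : measurable_fun setT (fun x => h ^+ 2 / 4 * sdot (feat x) (feat x)).
  apply: measurable_funM; first exact: measurable_cst.
  exact: measurable_sdot2.
apply: measurable_funD.
  apply: measurable_clip; apply: measurable_funM; first exact: measurable_cst.
  by apply: measurable_funB; [exact: measurable_funB|exact: measurable_cst].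
apply: measurable_minr; last exact: measurable_cst.
apply: measurable_funM; first exact: measurable_funM.
by apply: measurable_funD => //; exact: measurable_funM.
Qed.

(** The union bound runs over the lattice points [l] only, and controls the sum of
    [devF] at [l].  For a vector [u] these bounds are averaged over the roundings of
    [u]: on the left the average dominates the truncated squares at [u], and on the
    right the exponential moment averages to its value at [u] plus rounding terms.
    The price of the union bound at [l] is the logarithm of the inverse weight; it
    is at most quadratic in [l], hence its average over the roundings is explicit. *)
Lemma uniform_clip (n : nat) (Zs : 'I_n -> {RV P >-> obs R d})
    (lam sg h m kap eps : R) (D := (size fs)%:R : R) (s := h ^+ 2 / 4) :
  independent_copies Z Zs -> 0 < eps -> 0 <= lam -> sg ^+ 2 = 1 -> 0 < h ->
  0 < m -> (0 < size fs)%N ->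
  Ex (fun om => q om ^+ 2) <= kap * D ^+ 2 ->
  exists A : set T, [/\ measurable A, ((1 - eps)%:E <= P A)%E &
    forall om, A om -> forall u : seq R, size u = size fs -> sdot u u = m ->
    Ex (fun om => y u om ^+ 2) = m ->
    Ex (fun om => y u om ^+ 4) <= kap * m ^+ 2 ->
    \sum_(i < n) clip (sg * lam * (sdot u (feat (Zs i om)) ^+ 2 - 1)) <=
    n%:R * (sg * lam * (m - 1) + lam ^+ 2 / 2 * (kap * m ^+ 2 - 2 * m + 1)
      + lam ^+ 2 * kap * (1604 * (m * (s * D)) + 4808 * (s * D) ^+ 2))
    + D * ((m + s * D + 1) / 2 + ln (1 + 2 / (Num.sqrt D * h))) + ln eps^-1].
Proof.
move=> ind e0 lam0 sg2 h0 m0 D0 Eq2.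
have Dp : 0 < D by rewrite ltr0n.
have c0 : 0 < Num.sqrt D by rewrite sqrtr_gt0.
pose Zc := 1 + 2 / (Num.sqrt D * h).
have Zc0 : 0 < Zc by rewrite addr_gt0// divr_gt0// mulr_gt0.
(* the rate sqrt D makes the price of a vector of norm 1 proportional to D *)
pose w1 (a : R) := expR (- (Num.sqrt D * `|a|)) / Zc.
have w10 a : 0 < w1 a by rewrite divr_gt0 ?expR_gt0.
pose w (l : seq R) := \prod_(a <- l) w1 a.
have w0 l : 0 < w l by apply: prodr_gt0.
(* |u_i| <= 1 + m since u_i^2 <= m: the box contains all roundings of u *)
pose M := (Num.trunc ((1 + m) / h + 2)).+1.
have hM : 1 + m <= h * (M%:R - 2).
  rewrite -ler_pdivrMl// mulrC lerBrDr.
  have := @truncn_itv R ((1 + m) / h + 2); rewrite addr_ge0 ?divr_ge0 ?(ltW h0)//.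
    by move=> /(_ isT) /andP[_ /ltW].
  by rewrite addr_ge0// ltW.
have ws : \sum_(l <- lattice h M (size fs)) w l <= 1.
  rewrite lattice_sum exprn_ile1//; first by apply: sumr_ge0 => a _; exact: ltW.
  by rewrite -mulr_suml ler_pdivrMr// mul1r lattice1_sum.
have lw l : ln (w l)^-1 <= (D * sdot l l + (size l)%:R) / 2 + (size l)%:R * ln Zc.
  rewrite /w; elim: l => [|a l ih] /=.
    by rewrite big_nil invr1 ln1; lra.
  rewrite big_cons invfM lnM ?posrE ?invr_gt0//; last exact: w0.
  have -> : ln (w1 a)^-1 = Num.sqrt D * `|a| + ln Zc.
    rewrite /w1 invf_div expRN invrK lnM ?posrE ?expR_gt0// expRK; lra.
  rewrite -natr1.
  have : 0 <= (Num.sqrt D * `|a| - 1) ^+ 2 by exact: sqr_ge0.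
  rewrite sqrrB exprMn sqr_sqrtr ?(ltW Dp)// real_normK ?num_real//; lra.
have mF := measurable_devF h lam sg.
have [A [mA PA HA]] := @weighted_union n Zs _ (lattice h M (size fs)) w
  (fun l x => devF h lam sg l (feat x)) 4 eps ind e0 w0 ws mF
  (fun l x => devF_le h lam sg l (feat x)).
exists A; split=> // om Aom u su uu Ey2 Ey4.
have sz x : size u = size (feat x) by rewrite size_feat.
apply: (@le_trans _ _ (round h u (fun l => \sum_(i < n) devF h lam sg l (feat (Zs i om))))).
  rewrite round_sum//; apply: ler_sum => i _.
  exact: clip_le_round.
pose Q l om := 1 + devT h lam sg l (feat (Z om))
    + devT h lam sg l (feat (Z om)) ^+ 2 / 2 + 100 * devA h lam l (feat (Z om)).
have QE l := Ex_devF_le l mF.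
apply: (@le_trans _ _ (round h u (fun l => (n%:R * Ex (Q l)) + (D / 2 * sdot l l
   + (- n%:R + (D / 2 + D * ln Zc + ln eps^-1))))) ).
  apply: (@ler_round _ _ h0 M) => [v vu|l].
    have := sdot_norm_le vu; rewrite uu => vm.
    apply: le_trans hM.
    by rewrite ler_norml; apply/andP; split; nra.
  rewrite su => lL; apply: le_trans (HA om Aom l lL) _.
  have := lw l; rewrite (size_lattice lL) -/D => lwl.
  have [le1 _] := QE l.
  have := ler_wpM2l (ler0n R n) le1; rewrite -/(Q l) => h1.
  lra.
rewrite roundD (roundZ _ _ n%:R) roundD (roundZ _ _ (D / 2)) round_cst// round_norm//.
rewrite su uu -/D -/s.
have [iQ <-] := Ex_round h u (fun l => (QE l).2).
(* Cauchy-Schwarz for y^2 and q, in the additive form with optimal weights *)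
have Eyq : Ex (fun om => y u om ^+ 2 * q om) <= kap * D * m.
  apply: (@le_trans _ _ (Ex (fun om => D / (2 * m) * y u om ^+ 4 +
      m / (2 * D) * q om ^+ 2))).
    apply: Ex_le => // [|o]; first by apply: itgD; exact: itgZ.
    rewrite -subr_ge0 (_ : _ - _ = (D * y u o ^+ 2 - m * q o) ^+ 2 / (2 * m * D)).
      by rewrite divr_ge0 ?sqr_ge0// !mulr_ge0// ltW.
    by field; rewrite !gt_eqF.
  rewrite ExD; [|exact: itgZ|exact: itgZ]; rewrite !ExZ//.
  have := ler_wpM2l (ltW (divr_gt0 Dp (mulr_gt0 (ltr0n R 2) m0))) Ey4.
  have := ler_wpM2l (ltW (divr_gt0 m0 (mulr_gt0 (ltr0n R 2) Dp))) Eq2.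
  rewrite (_ : m / (2 * D) * (kap * D ^+ 2) = kap * D * m / 2); last by field; rewrite gt_eqF.
  rewrite (_ : D / (2 * m) * (kap * m ^+ 2) = kap * D * m / 2); last by field; rewrite gt_eqF.
  lra.
have EQ : Ex (fun om => round h u (Q^~ om)) <= 1 + (sg * lam * (m - 1)
      + lam ^+ 2 / 2 * (kap * m ^+ 2 - 2 * m + 1)
      + lam ^+ 2 * kap * (1604 * (m * (s * D)) + 4808 * (s * D) ^+ 2)).
  apply: (@le_trans _ _ (Ex (quad u (1 - sg * lam + lam ^+ 2 / 2)
     (sg * lam - lam ^+ 2) 0 (lam ^+ 2 / 2) (lam ^+ 2 * 1604 * s)
     (lam ^+ 2 * 4808 * s ^+ 2)))).
    apply: Ex_le => [||o]; [exact: iQ|exact: iquad|].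
    have H := @round_majorant R h h0 lam sg u _ sg2 (sz (Z o)).
    apply: le_trans H _.
    rewrite le_eqVlt; apply/orP; left; apply/eqP.
    rewrite /quad -/(q o) -/(y u o) -/s.
    rewrite (_ : (sg * lam * (y u o ^+ 2 - 1)) ^+ 2 =
      sg ^+ 2 * (lam * (y u o ^+ 2 - 1)) ^+ 2); last by ring.
    by rewrite sg2; field.
  rewrite Ex_quad Ey2 mul0r add0r.
  have l2 : 0 <= lam ^+ 2 by exact: sqr_ge0.
  have s0 : 0 <= s by rewrite divr_ge0 ?sqr_ge0.
  have := ler_wpM2l (divr_ge0 l2 (ler0n R 2)) Ey4.
  have := ler_wpM2l (mulr_ge0 (mulr_ge0 l2 (ler0n R 1604)) s0) Eyq.
  have := ler_wpM2l (mulr_ge0 (mulr_ge0 l2 (ler0n R 4808)) (sqr_ge0 s)) Eq2.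
  lra.
have := ler_wpM2l (ler0n R n) EQ.
rewrite -/Zc; lra.
Qed.

End Uniform.

(** * Choice of the parameters *)

Section Numerics.
Variable R : realType.

Lemma ln_covering_le (x : R) : 0 < x -> x <= 2 -> ln (1 + 32 / x) <= 5 + 1 / x.
Proof.
move=> x0 x2; apply: (@le_trans _ _ (ln (34 / x))).
  rewrite ler_ln ?posrE ?addr_gt0 ?divr_gt0//.
  by rewrite ler_pdivlMr// mulrDl mul1r divfK ?gt_eqF//; lra.
rewrite lnM ?posrE ?invr_gt0//.
have h1 : ln (34 : R) <= 6.
  rewrite -[leRHS]expRK ler_ln ?posrE ?expR_gt0//.
  have -> : expR 6 = expR 1 ^+ 6 :> R by rewrite -expRM_natr mul1r.
  have e1 := @expR_ge1Dx R 1.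
  apply: (@le_trans _ _ (2 ^+ 6)); first lra.
  by rewrite lerXn2r ?nnegrE ?expR_ge0//; lra.
have : ln x^-1 <= 1 / x - 1.
  by have := @expR_ge1Dx R (ln x^-1); rewrite lnK ?posrE ?invr_gt0//; lra.
lra.
Qed.

(** The left-hand side collects the rounding loss and the part of the price of the
    union bound that exceeds 0.73 by coordinate; 13.62 is 2 times 6.81. *)
Lemma rounding_cost (x m e : R) : 0 < x -> x ^+ 2 <= 100 / 73 -> 0 <= e ->
  m <= 1 + e ->
  2 * (1604 / 1024 * m + 4808 / 1024 ^+ 2 * x ^+ 2)
    + ((m + x ^+ 2 / 1024 + 1) / 2 + ln (1 + 32 / x) - 73 / 100)
    <= 1362 / 100 * (1 / x) * (1 + e).
Proof.
move=> x0 x2 e0 me.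
have x1 : x <= 118 / 100 by nra.
have lnZ : ln (1 + 32 / x) <= 5 + 1 / x by apply: ln_covering_le => //; lra.
have y0 : 0 <= 1 / x by rewrite divr_ge0// ltW.
have yx : 84 / 100 <= 1 / x by rewrite ler_pdivlMr//; lra.
move: lnZ y0 yx x2; set l := ln _; set y := 1 / x; set z := x ^+ 2.
move=> lnZ y0 yx x2; clearbody l y z; clear x0 x1 x.
have h1 : 84 / 100 * (1 + e) <= y * (1 + e) by rewrite ler_wpM2r//; lra.
have h2 : 0 <= y * e by rewrite mulr_ge0.
lra.
Qed.

(** The balance of all error terms.  Here [x] measures the size of the rounding
    step, lam (K - 1) is the contribution of the variance, and [E] is the
    price of uniformity. *)
Lemma error_balance (n D K C L lam x E e m sg : R) (h := x / (16 * Num.sqrt D)) :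
  0 < n -> 0 < D -> 1 < K -> 0 < C -> 73 / 100 * D <= C ->
  L = C - 73 / 100 * D -> 0 < lam -> lam ^+ 2 * (K - 1) * n = 2 * C ->
  0 < x -> x ^+ 2 * (C * K) = D * (K - 1) ->
  n * lam * E * x = 1362 / 100 * D ->
  0 <= e -> sg ^+ 2 = 1 -> m = 1 - sg * e -> m <= 1 + e ->
  - e + lam * (K - 1) * (1 + e) + (lam * (K - 1) + lam) / 2 * e ^+ 2
    + E * (1 + e) <= 0 ->
  n * (sg * lam * (m - 1) + lam ^+ 2 / 2 * (K * m ^+ 2 - 2 * m + 1)
      + lam ^+ 2 * K * (1604 * (m * (h ^+ 2 / 4 * D)) + 4808 * (h ^+ 2 / 4 * D) ^+ 2))
    + D * ((m + h ^+ 2 / 4 * D + 1) / 2 + ln (1 + 2 / (Num.sqrt D * h))) + L <= 0.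
Proof.
move=> n0 D0 K1 C0 CD LE lam0 lamE x0 xE EE e0 sg2 mE me bal.
have sD0 : 0 < Num.sqrt D by rewrite sqrtr_gt0.
have hD : h ^+ 2 / 4 * D = x ^+ 2 / 1024.
  rewrite /h expr_div_n exprMn sqr_sqrtr ?(ltW D0)//.
  by field; rewrite gt_eqF.
have -> : 2 / (Num.sqrt D * h) = 32 / x.
  by rewrite /h; field; rewrite !gt_eqF.
rewrite hD; clear h hD sD0.
have K0 : 0 < K - 1 by rewrite subr_gt0.
have x2 : x ^+ 2 <= 100 / 73.
  have CK : 0 < C * K by rewrite mulr_gt0// (lt_trans ltr01).
  rewrite -(ler_pM2r CK) xE.
  have h1 : D * (K - 1) <= 100 / 73 * C * (K - 1).
    by rewrite ler_wpM2r// ?(ltW K0)//; clear -CD; lra.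
  by apply: le_trans h1 _; rewrite mulrA ler_wpM2l; clear -C0 K0; lra.
have X : n * (lam ^+ 2 * K) * x ^+ 2 = 2 * D.
  have CK : C != 0 by rewrite gt_eqF.
  apply: (mulIf CK); rewrite mulrC.
  have -> : C * (n * (lam ^+ 2 * K) * x ^+ 2) = lam ^+ 2 * n * (x ^+ 2 * (C * K)) by ring.
  rewrite xE.
  have -> : lam ^+ 2 * n * (D * (K - 1)) = D * (lam ^+ 2 * (K - 1) * n) by ring.
  by rewrite lamE; ring.
have nl0 : 0 < n * lam by rewrite mulr_gt0.
have EE' : n * lam * E = D * (1362 / 100 * (1 / x)).
  by apply: (mulIf (lt0r_neq0 x0)); rewrite EE; field; rewrite gt_eqF.
(* the price of uniformity pays for the rounding and for the lattice *)
have extra : D * (2 * (1604 / 1024 * m + 4808 / 1024 ^+ 2 * x ^+ 2)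
    + ((m + x ^+ 2 / 1024 + 1) / 2 + ln (1 + 32 / x) - 73 / 100))
    <= n * lam * (E * (1 + e)).
  rewrite [leRHS](_ : _ = D * (1362 / 100 * (1 / x) * (1 + e))).
    by rewrite ler_pM2l//; exact: rounding_cost.
  by rewrite mulrA EE'; ring.
have sgm : sg * (m - 1) = - e.
  have -> : sg * (m - 1) = - (sg ^+ 2 * e) by rewrite mE; ring.
  by rewrite sg2 mul1r.
have m2 : m ^+ 2 = e ^+ 2 + 2 * m - 1.
  have -> : e ^+ 2 = sg ^+ 2 * e ^+ 2 by rewrite sg2 mul1r.
  by rewrite mE; ring.
have big : n * (lam ^+ 2 / 2 * (K * m ^+ 2 - 2 * m + 1)) + C <=
    n * lam * (lam * (K - 1) * (1 + e) + (lam * (K - 1) + lam) / 2 * e ^+ 2).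
  have -> : C = n * (lam ^+ 2 / 2 * (K - 1)).
    have -> : n * (lam ^+ 2 / 2 * (K - 1)) = lam ^+ 2 * (K - 1) * n / 2 by ring.
    by rewrite lamE; field.
  have -> : n * lam * (lam * (K - 1) * (1 + e) + (lam * (K - 1) + lam) / 2 * e ^+ 2)
    = n * (lam ^+ 2 / 2 * (2 * (K - 1) * (1 + e) + (K - 1 + 1) * e ^+ 2)) by field.
  rewrite -mulrDr ler_pM2l// -mulrDr ler_pM2l ?divr_gt0 ?exprn_gt0//.
  have -> : K * m ^+ 2 - 2 * m + 1 = (K - 1) * m ^+ 2 + (m ^+ 2 - 2 * m + 1) by ring.
  have -> : m ^+ 2 - 2 * m + 1 = e ^+ 2 by rewrite m2; ring.
  have : (K - 1) * (m ^+ 2) <= (K - 1) * (1 + 2 * e + e ^+ 2).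
    by rewrite ler_pM2l// m2; clear -me; lra.
  by set a := (K - 1) * _; clear; lra.
have E1 := mulr_ge0_le0 (ltW nl0) bal.
have X' : n * (lam ^+ 2 * K * (1604 * (m * (x ^+ 2 / 1024)) + 4808 * (x ^+ 2 / 1024) ^+ 2))
   = D * (2 * (1604 / 1024 * m + 4808 / 1024 ^+ 2 * x ^+ 2)).
  rewrite [LHS](_ : _ = (n * (lam ^+ 2 * K) * x ^+ 2) *
    (1604 / 1024 * m + 4808 / 1024 ^+ 2 * x ^+ 2)); last by field.
  by rewrite X; ring.
have sgE : n * (sg * lam * (m - 1)) = - (n * lam * e).
  have -> : n * (sg * lam * (m - 1)) = n * lam * (sg * (m - 1)) by ring.
  by rewrite sgm mulrN.
set A := lam ^+ 2 / 2 * _ in big *; set B := lam ^+ 2 * K * _ in X' *.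
have -> : n * (sg * lam * (m - 1) + A + B) = n * (sg * lam * (m - 1)) + n * A + n * B.
  by ring.
rewrite X' sgE LE.
move: big extra E1; set a := n * A; set l := ln _; set y := _ + _ * x ^+ 2.
set b := (m + _ + 1) / 2; set P1 := lam * (K - 1) * (1 + e).
set P2 := _ / 2 * e ^+ 2; set P3 := E * (1 + e); set N := n * lam.
by clearbody a l y b P1 P2 P3 N; clear; move=> big extra E1; lra.
Qed.

Lemma sumsqrt_ge0 (k1 k2 : R) : 0 <= sumsqrt k1 k2.
Proof. by rewrite addr_ge0// sqrtr_ge0. Qed.

(** What the lower bound on the sample size is for: with M0 and E the two terms
    of [mu_hat], it says that 2 mu + (M0 + lam) / 2 < 1, which is exactly what
    makes [delta_hat] a supersolution of the balance equation. *)
Lemma delta_hat_balance (d n : nat) (k1 k2 eps : R) (K := bigK k1 k2)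
    (C := complexity d eps) (M0 := Num.sqrt (2 * (K - 1) / n%:R * C))
    (E := 681 / 100 * sumsqrt k1 k2 * Num.sqrt (2 * d.+1%:R / n%:R))
    (e := delta_hat d k1 k2 eps n) :
  1 <= K -> 0 <= C -> min_sample_size d k1 k2 eps < n%:R ->
  [/\ (0 < n)%N, 0 < mu_hat d k1 k2 eps n, 2 * mu_hat d k1 k2 eps n < 1, 0 < e &
    - e + M0 * (1 + e) + (M0 + M0 / (K - 1)) / 2 * e ^+ 2 + E * (1 + e) <= 0].
Proof.
move=> K1 C0 hn.
have n0 : 0 < n%:R :> R by apply: le_lt_trans hn; exact: sqr_ge0.
have S0 : 0 < sumsqrt k1 k2.
  rewrite lt_neqAle sumsqrt_ge0 andbT eq_sym; apply/eqP => S0.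
  by move: K1; rewrite /K /bigK S0 expr0n/= ler10.
have sD : 0 < Num.sqrt (d.+1%:R : R) by rewrite sqrtr_gt0.
have rn : 0 < Num.sqrt (n%:R : R) by rewrite sqrtr_gt0.
have M00 : 0 <= M0 by exact: sqrtr_ge0.
have Dn : 0 < 2 * d.+1%:R / n%:R :> R by rewrite divr_gt0// mulr_gt0.
have c0 : 0 < 681 / 100 :> R by clear; lra.
have E0 : 0 < E.
  by rewrite /E; apply: mulr_gt0; [exact: mulr_gt0|rewrite sqrtr_gt0].
set b := 5 / 2 + 1 / (2 * (K - 1)).
have b0 : 5 / 2 <= b by rewrite lerDl divr_ge0// mulr_ge0// subr_ge0.
have M0r : M0 * Num.sqrt n%:R = Num.sqrt (2 * (K - 1) * C).
  rewrite -sqrtrM; last by rewrite mulr_ge0// divr_ge0 ?mulr_ge0 ?subr_ge0// ltW.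
  by congr Num.sqrt; field; rewrite gt_eqF.
have Er : 2 * (E * Num.sqrt n%:R) <= 20 * sumsqrt k1 k2 * Num.sqrt d.+1%:R.
  have -> : E * Num.sqrt n%:R = 681 / 100 * sumsqrt k1 k2 * (Num.sqrt 2 * Num.sqrt d.+1%:R).
    rewrite /E -[LHS]mulrA -(sqrtrM _ (ltW Dn)) -(sqrtrM _ (ler0n R 2)).
    by rewrite divfK// gt_eqF.
  have s2 : Num.sqrt 2 <= 71 / 50 :> R.
    by rewrite -[leRHS]ger0_norm// -sqrtr_sqr ler_wsqrtr//; clear; lra.
  have SD : 0 < sumsqrt k1 k2 * Num.sqrt d.+1%:R by rewrite mulr_gt0.
  have := ler_wpM2r (ltW SD) s2.
  set r2 := Num.sqrt 2; set r3 := Num.sqrt _ in SD *; set r4 := sumsqrt _ _ in SD *.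
  by move: SD; clear; lra.
have lt1 : b * M0 + 2 * E < 1.
  rewrite -(ltr_pM2r rn) mul1r.
  apply: (@le_lt_trans _ _ (20 * sumsqrt k1 k2 * Num.sqrt d.+1%:R
     + b * Num.sqrt (2 * (K - 1) * C))).
    by rewrite mulrDl -(mulrA b) M0r addrC lerD2r -[leLHS]mulrA; exact: Er.
  rewrite -(@ltr_pXn2r _ 2)// ?nnegrE ?(ltW rn)//.
    by rewrite [ltRHS]sqr_sqrtr ?(ltW n0).
  by rewrite addr_ge0// mulr_ge0// ?mulr_ge0 ?sqrtr_ge0 ?(ltW S0)// (le_trans _ b0).
have bM : 5 / 2 * M0 <= b * M0 by rewrite ler_wpM2r.
have muE : mu_hat d k1 k2 eps n = M0 + E by [].
have mu0 : 0 < M0 + E by rewrite ltr_wpDl.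
have mu1 : 2 * (M0 + E) < 1 by clear -lt1 bM M00; lra.
have d0 : 0 < 1 - 2 * (M0 + E) by rewrite subr_gt0.
have ee : e * (1 - 2 * (M0 + E)) = M0 + E by rewrite /e /delta_hat muE divfK// gt_eqF.
have e0 : 0 < e by rewrite /e /delta_hat muE divr_gt0.
rewrite muE; split=> //; first by rewrite ltr0n in n0.
have -> : M0 / (K - 1) = M0 * (1 / (2 * (K - 1))) * 2.
  by rewrite div1r invfM; move: (K - 1)^-1 => z; field.
have h : (M0 + M0 * (1 / (2 * (K - 1))) * 2) / 2 <= 1 - 2 * (M0 + E).
  by move: lt1; rewrite /b mulrDl; set z := 1 / _; clear; lra.
have := ler_wpM2r (ltW e0) (ler_wpM2r (ltW e0) h).
rewrite -mulrA -expr2 [X in _ <= X * _ -> _]mulrC ee.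
by move: ee; set y := _ / 2; clear; lra.
Qed.

End Numerics.

(** * The inverse square root of the Gram matrix *)

Section DotProduct.
Variables (R : realType) (d : nat).
Implicit Types (u v : 'rV[R]_d) (A : 'M[R]_d).

Lemma dotE u v : dot u v = (u *m v^T) 0 0.
Proof. by rewrite mxE; apply: eq_bigr => j _; rewrite mxE. Qed.

Lemma dotC u v : dot u v = dot v u.
Proof. by apply: eq_bigr => j _; rewrite mulrC. Qed.

Lemma dotDl u v w : dot (u + v) w = dot u w + dot v w.
Proof. by rewrite -big_split; apply: eq_bigr => j _; rewrite mxE mulrDl. Qed.

Lemma dotZl (c : R) u v : dot (c *: u) v = c * dot u v.
Proof. by rewrite mulr_sumr; apply: eq_bigr => j _; rewrite mxE mulrA. Qed.

Lemma dotNl u v : dot (- u) v = - dot u v.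
Proof. by rewrite -scaleN1r dotZl mulN1r. Qed.

Lemma dotBl u v w : dot (u - v) w = dot u w - dot v w.
Proof. by rewrite dotDl dotNl. Qed.

Lemma dotMl u A v : dot (u *m A) v = dot u (v *m A^T).
Proof. by rewrite !dotE trmx_mul trmxK mulmxA. Qed.

Lemma dot_ge0 u : 0 <= dot u u.
Proof. by apply: sumr_ge0 => j _; rewrite -expr2 sqr_ge0. Qed.

Lemma dot_eq0 u : dot u u = 0 -> u = 0.
Proof.
move=> /eqP; rewrite psumr_eq0 => [/allP h|j _]; last by rewrite -expr2 sqr_ge0.
apply/rowP => j; rewrite mxE; have := h j (mem_index_enum j).
by rewrite mulf_eq0 orbb => /eqP.
Qed.

Lemma dot_delta (j : 'I_d) v : dot (delta_mx 0 j) v = v 0 j.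
Proof.
rewrite /dot (bigD1 j)//= mxE !eqxx mul1r big1 ?addr0// => k kj.
by rewrite mxE (negbTE kj) andbF mul0r.
Qed.

Lemma dot_rowE (A : 'M[R]_d) j v : dot (row j A) v = (v *m A^T) 0 j.
Proof. by rewrite mxE; apply: eq_bigr => k _; rewrite !mxE mulrC. Qed.

Lemma sdot_enum (a b : 'I_d -> R) :
  sdot [seq a j | j <- enum 'I_d] [seq b j | j <- enum 'I_d] = \sum_j a j * b j.
Proof.
rewrite -big_enum; elim: (enum _) => [|j s ih] /=; first by rewrite big_nil.
by rewrite big_cons ih.
Qed.

Lemma dot_cs u v : dot u v ^+ 2 <= dot u u * dot v v.
Proof. by rewrite /dot -!sdot_enum; exact: sdot_cs. Qed.

End DotProduct.

Section InvSqrt.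
Variables (R : realType) (d : nat) (G H S : 'M[R]_d).
Hypotheses (Gsym : G^T = G) (pinv : is_pseudo_inverse G H).
Hypothesis (sq : is_symmetric_sqrt H S).

Let GHG : G *m H *m G = G. Proof. by case: pinv. Qed.
Let HGH : H *m G *m H = H. Proof. by case: pinv. Qed.
Let Ssym : S^T = S. Proof. by case: sq. Qed.
Let SS : S *m S = H. Proof. by case: sq. Qed.

Let Hsym : H^T = H. Proof. by rewrite -SS trmx_mul Ssym. Qed.

Lemma proj_comm : G *m H = H *m G.
Proof. by case: pinv => _ _ <- _; rewrite trmx_mul Gsym Hsym. Qed.

Let projT : (G *m H)^T = G *m H. Proof. by case: pinv. Qed.

Let proj_sq : (G *m H) *m (G *m H) = G *m H.
Proof. by rewrite mulmxA GHG. Qed.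

Let projS : G *m H *m S = S.
Proof.
suff : (1%:M - G *m H) *m S = 0 by rewrite mulmxBl mul1mx => /subr0_eq <-.
apply/row_matrixP => i; rewrite row0; apply: dot_eq0.
rewrite row_mul dotMl Ssym -mulmxA SS dotC.
have -> : row i (1%:M - G *m H) *m H = 0.
  by rewrite -row_mul mulmxBl mul1mx proj_comm HGH subrr row0.
by rewrite /dot big1// => j _; rewrite mxE mul0r.
Qed.

Let Sproj : S *m (G *m H) = S.
Proof. by rewrite -[LHS]trmxK trmx_mul projT Ssym projS Ssym. Qed.

Let GS : G *m S = S *m G.
Proof.
rewrite -{1}Sproj proj_comm mulmxA -SS !mulmxA -(mulmxA G S S) SS.
by rewrite projS.
Qed.

Lemma SGS : S *m G *m S = G *m H.
Proof. by rewrite -GS -mulmxA SS. Qed.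

(** This quadratic form is a diagonal entry of an orthogonal projector. *)
Lemma proj_diag_le1 j : dot (row j S *m G) (row j S) <= 1.
Proof.
have E : dot (row j S *m G) (row j S) = (G *m H) j j.
  rewrite dotE tr_row Ssym -SGS [LHS]mxE [RHS]mxE; apply: eq_bigr => k _.
  by rewrite -row_mul [row _ _ _ _]mxE [col _ _ _ _]mxE.
rewrite E; have Ej : (G *m H) j j = \sum_k (G *m H) j k ^+ 2.
  rewrite -{1}proj_sq mxE; apply: eq_bigr => k _.
  by rewrite expr2; congr (_ * _); rewrite -{1}projT mxE.
have : (G *m H) j j ^+ 2 <= (G *m H) j j.
  rewrite {2}Ej (bigD1 j)//= lerDl.
  by apply: sumr_ge0 => k _; exact: sqr_ge0.
set p := (G *m H) j j; nra.
Qed.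

Lemma dot_sqrt (eta : 'rV[R]_d) :
  dot (eta *m G *m S) (eta *m G *m S) = dot (eta *m G) eta.
Proof.
rewrite dotMl Ssym -[_ *m S *m S]mulmxA SS dotMl Gsym.
by rewrite -(mulmxA eta G H) -(mulmxA eta (G *m H) G) GHG dotC.
Qed.

Lemma dot_sqrt_cross (eta x : 'rV[R]_d) :
  dot (eta *m G *m S) (x *m S) = dot (eta *m (G *m H)) x.
Proof. by rewrite dotC dotMl Ssym -[_ *m S *m S]mulmxA SS dotC mulmxA. Qed.

Lemma dot_proj (eta : 'rV[R]_d) :
  dot (eta *m (G *m H) *m G) (eta *m (G *m H)) = dot (eta *m G) eta.
Proof.
rewrite -[eta *m _ *m G]mulmxA GHG dotC dotMl projT -mulmxA [LHS]dotC.
by rewrite proj_comm [G *m (H *m G)]mulmxA GHG.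
Qed.

(** The projector fixes the rows of [G], so that the complementary directions
    have zero second moment. *)
Lemma proj_compl_zero (a : 'rV[R]_d) : (a - a *m (G *m H)) *m G = 0.
Proof. by rewrite mulmxBl -mulmxA GHG subrr. Qed.

End InvSqrt.

(** * Second moments of the observation *)

Lemma quad_linear_eq0 (R : realFieldType) (Q B : R) :
  0 <= Q -> (forall t : R, 0 <= t ^+ 2 * Q - 2 * t * B) -> B = 0.
Proof.
move=> Q0 key; have Q1 : 0 < 1 + Q by rewrite ltr_pwDl.
have := key (B / (1 + Q)).
rewrite (_ : _ - _ = - (B ^+ 2 * ((2 + Q) / (1 + Q) ^+ 2))); last first.
  by field; rewrite gt_eqF.
rewrite oppr_ge0 => h.
have c0 : 0 < (2 + Q) / (1 + Q) ^+ 2 by rewrite divr_gt0 ?exprn_gt0// ltr_pwDl.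
apply/eqP; rewrite -sqrf_eq0 eq_le sqr_ge0 andbT.
by rewrite -(pmulr_lle0 _ c0).
Qed.

Section Population.
Variables (R : realType) (dT : measure_display) (T : measurableType dT).
Variables (P : probability T R) (d : nat) (Z : {RV P >-> obs R d}).

Local Notation Ex f := (fine ('E_P[f%R])%E).

Implicit Types (theta eta a b : 'rV[R]_d).

Lemma measurable_covariate j :
  measurable_fun setT (fun z : obs R d => covariate z 0 j).
Proof.
have -> : (fun z : obs R d => covariate z 0 j) = (fun t => tnth t j) \o fst.
  by apply/funext => z; rewrite mxE.
by apply: measurableT_comp => //; exact: measurable_tnth.
Qed.

Lemma measurable_dot theta :
  measurable_fun setT (fun z : obs R d => dot theta (covariate z)).
Proof.
apply: measurable_sum => j; apply: measurable_funM; first exact: measurable_cst.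
exact: measurable_covariate.
Qed.

Lemma measurable_residual theta xi :
  measurable_fun setT (residual (d := d) (R := R) theta xi).
Proof.
apply: measurable_funB; last exact: measurable_dot.
apply: measurable_funM; first exact: measurable_cst.
exact: measurable_snd.
Qed.

Lemma measurable_comp_rv (f : obs R d -> R) (X : {RV P >-> obs R d}) :
  measurable_fun setT f -> measurable_fun setT (fun w => f (X w)).
Proof. by move=> mf; apply: measurableT_comp mf (measurable_funPT X). Qed.

Lemma itg_mul (f g : T -> R) : measurable_fun setT f -> measurable_fun setT g ->
  itg P (fun w => f w ^+ 2) -> itg P (fun w => g w ^+ 2) ->
  itg P (fun w => f w * g w).
Proof.
move=> mf mg if2 ig2; apply: (itg_le _ (itgD if2 ig2)).
  exact: measurable_funM.
move=> w; rewrite normrM.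
have := sqr_ge0 (`|f w| - `|g w|); rewrite sqrrB !real_normK ?num_real//.
have := normr_ge0 (f w); have := normr_ge0 (g w).
set x := `|f w|; set y := `|g w| => y0 x0.
have : 0 <= x * y by rewrite mulr_ge0.
set z := x * y; lra.
Qed.

Hypothesis sqi : square_integrable Z.

Let X w := covariate (Z w).

Let mX j : measurable_fun setT (fun w => X w 0 j).
Proof. exact: (measurable_comp_rv Z (measurable_covariate j)). Qed.

Let iX2 j : itg P (fun w => X w 0 j ^+ 2).
Proof. by case: sqi => h _; exact: Lfun2_integrable_sqr (h j). Qed.

Let iXX i j : itg P (fun w => X w 0 i * X w 0 j).
Proof. exact: itg_mul. Qed.

Let iY2 : itg P (fun w => response (Z w) ^+ 2).
Proof. by case: sqi => _; exact: Lfun2_integrable_sqr. Qed.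

Lemma gram_sym : (gram Z)^T = gram Z.
Proof.
apply/matrixP => i j; rewrite !mxE; congr fine; congr expectation.
by apply/funext => w; rewrite mulrC.
Qed.

Lemma Ex_dot_mul a b :
  itg P (fun w => dot a (X w) * dot b (X w)) /\
  Ex (fun w => dot a (X w) * dot b (X w)) = dot (a *m gram Z) b.
Proof.
have E : (fun w => dot a (X w) * dot b (X w)) =
    (fun w => \sum_i \sum_j a 0 i * b 0 j * (X w 0 i * X w 0 j)).
  apply/funext => w; rewrite mulr_suml; apply: eq_bigr => i _.
  by rewrite mulr_sumr; apply: eq_bigr => j _; ring.
have i1 i : itg P (fun w => \sum_j a 0 i * b 0 j * (X w 0 i * X w 0 j)).
  by apply: itg_sum => j; apply: itgZ; exact: iXX.
rewrite E; split; first exact: itg_sum.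
rewrite Ex_sum//.
under eq_bigr => i _.
  rewrite Ex_sum => [|j]; last by apply: itgZ; exact: iXX.
  under eq_bigr => j _ do rewrite ExZ//.
  over.
rewrite exchange_big; apply: eq_bigr => j _.
rewrite mxE mulr_suml; apply: eq_bigr => i _.
by rewrite mxE; ring.
Qed.

Let mdot a : measurable_fun setT (fun w => dot a (X w)).
Proof. exact: (measurable_comp_rv Z (measurable_dot a)). Qed.

Lemma itg_dot2 a : itg P (fun w => dot a (X w) ^+ 2).
Proof. by have [] := Ex_dot_mul a a. Qed.

Lemma Ex_dot2 a : Ex (fun w => dot a (X w) ^+ 2) = dot (a *m gram Z) a.
Proof. by have [_ <-] := Ex_dot_mul a a. Qed.

Lemma itg_residual2 theta xi : itg P (fun w => residual theta xi (Z w) ^+ 2).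
Proof.
apply: (itg_le (g := fun w => 2 * xi ^+ 2 * response (Z w) ^+ 2
    + 2 * dot theta (X w) ^+ 2)).
- apply: measurable_funX; exact: (measurable_comp_rv Z (measurable_residual _ _)).
- by apply: itgD; apply: itgZ => //; exact: itg_dot2.
- move=> w; rewrite ger0_norm ?sqr_ge0// /residual -/(X w).
  rewrite -subr_ge0.
  rewrite (_ : _ - _ = (xi * response (Z w) + dot theta (X w)) ^+ 2); last by ring.
  exact: sqr_ge0.
Qed.

Variable theta_s : 'rV[R]_d.
Hypothesis mini : is_risk_minimizer Z theta_s.

Let e w := residual theta_s 1 (Z w).

Lemma residual_decomp theta xi (z : obs R d) : residual theta xi z =
  xi * residual theta_s 1 z - dot (theta - xi *: theta_s) (covariate z).
Proof. by rewrite /residual dotBl dotZl; ring. Qed.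

Let me' : measurable_fun setT e.
Proof. exact: (measurable_comp_rv Z (measurable_residual _ _)). Qed.

Let iex a : itg P (fun w => e w * dot a (X w)).
Proof. by apply: itg_mul => //; [exact: itg_residual2|exact: itg_dot2]. Qed.

Let popN_expand xi a :
  Ex (fun w => (xi * e w - dot a (X w)) ^+ 2) =
  xi ^+ 2 * popN Z theta_s 1 - 2 * xi * Ex (fun w => e w * dot a (X w))
  + dot (a *m gram Z) a.
Proof.
have i1 : itg P (fun w => xi ^+ 2 * e w ^+ 2) by apply: itgZ; exact: itg_residual2.
have i2 : itg P (fun w => (- (2 * xi)) * (e w * dot a (X w))) by exact: itgZ.
rewrite (_ : (fun w => _) = (fun w => (xi ^+ 2 * e w ^+ 2
  + (- (2 * xi)) * (e w * dot a (X w))) + dot a (X w) ^+ 2)); last first.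
  by apply/funext => w; ring.
rewrite ExD; [|exact: itgD|exact: itg_dot2].
rewrite ExD// ExZ ?ExZ//; last exact: itg_residual2.
by rewrite Ex_dot2 -/(popN _ _ _); ring.
Qed.

(** First-order condition: the residual at the minimizer is orthogonal to all
    linear functions of the covariate. *)
Let ortho a : Ex (fun w => e w * dot a (X w)) = 0.
Proof.
set B := Ex _; set Q := dot (a *m gram Z) a.
have Q0 : 0 <= Q by rewrite /Q -Ex_dot2; apply: Ex_ge0 => w; exact: sqr_ge0.
have key (t : R) : 0 <= t ^+ 2 * Q - 2 * t * B.
  have := mini (theta_s + t *: a); rewrite {2}/popN.
  rewrite (_ : (fun w => _) = (fun w => (1 * e w - dot (t *: a) (X w)) ^+ 2)).
    rewrite popN_expand expr1n mul1r.
    have -> : dot ((t *: a) *m gram Z) (t *: a) = t ^+ 2 * Q.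
      by rewrite -scalemxAl dotZl dotC dotZl dotC; rewrite /Q; ring.
    have -> : Ex (fun w => e w * dot (t *: a) (X w)) = t * B.
      rewrite /B -ExZ//; congr fine; congr expectation.
      by apply/funext => w; rewrite dotZl; ring.
    lra.
  apply/funext => w; rewrite residual_decomp mul1r; congr ((_ - dot _ _) ^+ 2).
  by rewrite scale1r addrAC subrr add0r.
exact: quad_linear_eq0 Q0 key.
Qed.

Lemma popN_pythagoras theta xi : popN Z theta xi =
  xi ^+ 2 * popN Z theta_s 1 +
  dot ((theta - xi *: theta_s) *m gram Z) (theta - xi *: theta_s).
Proof.
rewrite {1}/popN (_ : (fun w => _) = (fun w =>
    (xi * e w - dot (theta - xi *: theta_s) (X w)) ^+ 2)).
  by rewrite popN_expand ortho; ring.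
by apply/funext => w; rewrite residual_decomp.
Qed.

End Population.

(** * Exponential moments *)

Section ExpMoment.
Variables (R : realType) (dT : measure_display) (T : measurableType dT).
Variable P : probability T R.
Local Notation Ex f := (fine ('E_P[f%R])%E).

Variables (f : T -> R) (p alpha c : R).
Hypotheses (mf : measurable_fun setT f) (f0 : forall w, 0 <= f w).
Hypotheses (p0 : 0 < p) (alpha0 : 0 < alpha).
Hypothesis mom : ('E_P[fun w => expR (alpha / 2 * (f w `^ (2 * p) - c))%R] <= 1)%E.

Let mr : measurable_fun setT (fun w => expR (alpha / 2 * (f w `^ (2 * p) - c))).
Proof.
apply: measurableT_comp => //; apply: measurable_funM; first exact: measurable_cst.
apply: measurable_funB; last exact: measurable_cst.
exact: measurableT_comp (measurable_powR _) mf.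
Qed.

Let itg_exp : itg P (fun w => expR (alpha / 2 * (f w `^ (2 * p) - c))).
Proof.
apply/integrableP; split; first exact/measurable_EFinP.
move: mom; rewrite unlock => h; apply: le_lt_trans (ltry 1).
rewrite (eq_integral (fun w => (expR (alpha / 2 * (f w `^ (2 * p) - c)))%:E))//.
by move=> w _ /=; rewrite ger0_norm// expR_ge0.
Qed.

Let Ex_exp : Ex (fun w => expR (alpha / 2 * (f w `^ (2 * p) - c))) <= 1.
Proof. by rewrite -lee_fin -expectationE. Qed.

(** One term of large enough degree of the exponential series dominates the fourth
    power. *)
Lemma exp_moment_itg4 : itg P (fun w => f w ^+ 4).
Proof.
pose N := (Num.trunc (2 / p)).+1.
pose C := N`!%:R * (2 / alpha) ^+ N * expR (alpha / 2 * c).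
apply: (itg_le (g := fun w => 1 + C * expR (alpha / 2 * (f w `^ (2 * p) - c)))).
- exact: measurable_funX.
- by apply: itgD; [exact: itg_cst|exact: itgZ].
move=> w; rewrite ger0_norm ?exprn_ge0//.
have C0 : 0 <= C.
  by rewrite !mulr_ge0 ?expR_ge0 ?exprn_ge0 ?divr_ge0// ltW.
have [fw|fw] := leP (f w) 1.
  rewrite (@le_trans _ _ 1)//; first exact: exprn_ile1.
  by rewrite lerDl mulr_ge0// expR_ge0.
set r := f w `^ (2 * p).
have r1 : 1 <= r.
  by rewrite -(powRr0 (f w)) ler_powR ?ltW// mulr_gt0.
have fr : f w ^+ 4 <= r ^+ N.
  rewrite -!powR_mulrn ?powR_ge0// -powRrM ler_powR ?(ltW fw)//.
  have := @truncn_itv R (2 / p); rewrite divr_ge0 ?(ltW p0)// => /(_ isT) /andP[_].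
  by rewrite ltr_pdivrMr// => h; rewrite -/N in h; lra.
apply: le_trans fr _.
have a2 : 0 <= alpha / 2 * r by rewrite mulr_ge0 ?divr_ge0 ?powR_ge0// ltW.
have := expR_ge1Dxn (Num.trunc (2 / p)) a2.
rewrite -/N => h.
have E : C * expR (alpha / 2 * (r - c)) = N`!%:R * (2 / alpha) ^+ N * expR (alpha / 2 * r).
  by rewrite /C -mulrA -expRD; congr (_ * expR _); ring.
rewrite E.
have Nf : 0 < N`!%:R :> R by rewrite ltr0n fact_gt0.
have A0 : 0 < (2 / alpha) ^+ N by rewrite exprn_gt0// divr_gt0.
have : N`!%:R * (2 / alpha) ^+ N * ((alpha / 2 * r) ^+ N / N`!%:R) <=
   N`!%:R * (2 / alpha) ^+ N * expR (alpha / 2 * r).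
  rewrite ler_pM2l ?mulr_gt0//; apply: le_trans h.
  by rewrite lerDr.
rewrite (_ : _ * ((_ * r) ^+ N / _) = r ^+ N); last first.
  have -> : (2 / alpha) ^+ N = ((alpha / 2) ^+ N)^-1 by rewrite -exprVn invf_div.
  rewrite [(_ * r) ^+ N]exprMn; move: ((alpha / 2) ^+ N) (exprn_gt0 N (divr_gt0 alpha0 (ltr0n R 2))) => z z0.
  by field; rewrite !gt_eqF.
by move=> /le_trans; apply; rewrite lerDr.
Qed.

Lemma exp_moment_tail (t : R) :
  measurable [set w | c + 2 / alpha * t < f w `^ (2 * p)] /\
  (P [set w | c + 2 / alpha * t < f w `^ (2 * p)]%R <= (expR (- t))%:E)%E.
Proof.
have mA : measurable [set w | c + 2 / alpha * t < f w `^ (2 * p)].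
  rewrite -[X in measurable X]setTI; apply: measurable_fun_ltr => //.
  exact: measurableT_comp (measurable_powR _) mf.
split=> //.
apply: (@le_trans _ _
  (Ex (fun w => expR (- t) * expR (alpha / 2 * (f w `^ (2 * p) - c))))%:E).
  apply: prob_le_Ex mA _ _ _ => [|w|w /= h].
  - exact: itgZ.
  - by rewrite mulr_ge0 ?expR_ge0.
  rewrite -expRD; apply: (@le_trans _ _ (expR 0)); first by rewrite expR0.
  rewrite ler_expR.
  have : 2 / alpha * t < f w `^ (2 * p) - c by lra.
  move/(ltW) => /(ler_wpM2l (divr_ge0 (ltW alpha0) (ler0n R 2))).
  have -> : alpha / 2 * (2 / alpha * t) = t by field; rewrite gt_eqF.
  by move=> h2; rewrite addrC subr_ge0.
by rewrite lee_fin ExZ// -[leRHS]mulr1 ler_wpM2l// expR_ge0.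
Qed.

End ExpMoment.

(** * Fourth moments of linear combinations *)

Section FourthMoment.
Variables (R : realType) (dT : measure_display) (T : measurableType dT).
Variable P : probability T R.
Local Notation Ex f := (fine ('E_P[f%R])%E).

Lemma itg_ae (f g : T -> R) (N : set T) : measurable_fun setT f -> itg P g ->
  measurable N -> P N = 0%E -> (forall w, ~ N w -> f w = g w) ->
  itg P f /\ Ex f = Ex g.
Proof.
move=> mf ig mN N0 fg.
have mg := itg_meas ig.
have ae : ae_eq P setT (EFin \o f) (EFin \o g).
  exists N; split=> // w /= h; apply: contrapT => Nw; apply: h => _.
  by rewrite (fg _ Nw).
split; last first.
  rewrite !ExE /Rintegral; congr fine; apply: ae_eq_integral => //;
  exact/measurable_EFinP.
apply/integrableP; split; first exact/measurable_EFinP.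
have /integrableP[_] := ig; apply: le_lt_trans.
rewrite le_eqVlt; apply/orP; left; apply/eqP.
apply: ge0_ae_eq_integral => //.
- by apply/measurable_EFinP; exact: measurableT_comp.
- by apply/measurable_EFinP; exact: measurableT_comp.
exists N; split=> // w /= h; apply: contrapT => Nw; apply: h => _.
by rewrite (fg _ Nw).
Qed.

Lemma pow4_convex (a b A B : R) : 0 < a -> 0 < b ->
  (A + B) ^+ 4 <= (a + b) ^+ 3 * (A ^+ 4 / a ^+ 3 + B ^+ 4 / b ^+ 3).
Proof.
move=> a0 b0; have ab0 : 0 < a + b by rewrite addr_gt0.
have sq U V : (a * U + b * V) ^+ 2 <= (a + b) * (a * U ^+ 2 + b * V ^+ 2).
  rewrite -subr_ge0 (_ : _ - _ = a * b * (U - V) ^+ 2); last by ring.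
  by rewrite mulr_ge0 ?sqr_ge0// mulr_ge0// ltW.
have h1 := sq (A / a) (B / b); have h2 := sq ((A / a) ^+ 2) ((B / b) ^+ 2).
have e1 : a * (A / a) + b * (B / b) = A + B by field; rewrite !gt_eqF.
rewrite e1 in h1.
rewrite (_ : (A + B) ^+ 4 = ((A + B) ^+ 2) ^+ 2); last by rewrite -exprM.
apply: (@le_trans _ _ (((a + b) * (a * (A / a) ^+ 2 + b * (B / b) ^+ 2)) ^+ 2)).
  by rewrite lerXn2r// nnegrE ?sqr_ge0// (le_trans _ h1) ?sqr_ge0.
rewrite exprMn.
apply: (@le_trans _ _ ((a + b) ^+ 2 * ((a + b) * (a * ((A / a) ^+ 2) ^+ 2 + b * ((B / b) ^+ 2) ^+ 2)))).
  by rewrite ler_wpM2l// sqr_ge0.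
rewrite le_eqVlt; apply/orP; left; apply/eqP; field.
by rewrite !gt_eqF.
Qed.

(** Minkowski's inequality in L^4. *)
Lemma minkowski4 (A B : T -> R) (a b : R) : 0 <= a -> 0 <= b ->
  measurable_fun setT A -> measurable_fun setT B ->
  itg P (fun w => A w ^+ 4) -> itg P (fun w => B w ^+ 4) ->
  Ex (fun w => A w ^+ 4) <= a ^+ 4 -> Ex (fun w => B w ^+ 4) <= b ^+ 4 ->
  itg P (fun w => (A w + B w) ^+ 4) /\
  Ex (fun w => (A w + B w) ^+ 4) <= (a + b) ^+ 4.
Proof.
move=> a0 b0 mA mB iA iB EA EB.
have p4 (x : R) : 0 <= x ^+ 4 by rewrite -[4%N]/((2 * 2)%N) exprM sqr_ge0.
have im (x y : R) : itg P (fun w => x * A w ^+ 4 + y * B w ^+ 4).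
  by apply: itgD; exact: itgZ.
have i4 : itg P (fun w => (A w + B w) ^+ 4).
  apply: (itg_le (g := fun w => 8 * A w ^+ 4 + 8 * B w ^+ 4)).
  - by apply: measurable_funX; exact: measurable_funD.
  - exact: im.
  move=> w; rewrite ger0_norm//; have := pow4_convex (A w) (B w) ltr01 ltr01.
  lra.
split=> //; set X := Ex _.
have X0 : 0 <= X by apply: Ex_ge0.
have key t : 0 < t -> X <= (a + b + 2 * t) ^+ 4.
  move=> t0; have a1 : 0 < a + t by lra. have b1 : 0 < b + t by lra.
  have S0 : 0 <= (a + t + (b + t)) ^+ 3 by rewrite exprn_ge0// addr_ge0// ltW.
  pose x := (a + t + (b + t)) ^+ 3 / (a + t) ^+ 3.
  pose y := (a + t + (b + t)) ^+ 3 / (b + t) ^+ 3.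
  have x0 : 0 <= x by rewrite divr_ge0// exprn_ge0// ltW.
  have y0 : 0 <= y by rewrite divr_ge0// exprn_ge0// ltW.
  apply: (@le_trans _ _ (Ex (fun w => x * A w ^+ 4 + y * B w ^+ 4))).
    apply: Ex_le => // w; apply: le_trans (pow4_convex _ _ a1 b1) _.
    by rewrite /x /y le_eqVlt; apply/orP; left; apply/eqP; ring.
  rewrite ExD; [|exact: itgZ|exact: itgZ]; rewrite !ExZ//.
  have EA' : Ex (fun w => A w ^+ 4) <= (a + t) ^+ 4.
    by apply: le_trans EA _; rewrite lerXn2r ?nnegrE//; lra.
  have EB' : Ex (fun w => B w ^+ 4) <= (b + t) ^+ 4.
    by apply: le_trans EB _; rewrite lerXn2r ?nnegrE//; lra.
  apply: le_trans (lerD (ler_wpM2l x0 EA') (ler_wpM2l y0 EB')) _.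
  rewrite /x /y le_eqVlt; apply/orP; left; apply/eqP; field.
  by rewrite !gt_eqF.
have rX : Num.sqrt (Num.sqrt X) <= a + b.
  apply/ler_addgt0Pr => t t0; have := key (t / 2) (divr_gt0 t0 (ltr0n R 2)).
  have -> : 2 * (t / 2) = t by field.
  have s0 : 0 <= a + b + t by rewrite addr_ge0 ?addr_ge0// ltW.
  rewrite (_ : (a + b + t) ^+ 4 = ((a + b + t) ^+ 2) ^+ 2); last by rewrite -exprM.
  move=> /ler_wsqrtr; rewrite sqrtr_sqr ger0_norm ?sqr_ge0//.
  by move=> /ler_wsqrtr; rewrite sqrtr_sqr ger0_norm.
rewrite -[leLHS]sqr_sqrtr// -[Num.sqrt X]sqr_sqrtr ?sqrtr_ge0// -exprM.
by rewrite lerXn2r// nnegrE ?sqrtr_ge0// addr_ge0.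
Qed.

End FourthMoment.

(** * Kurtosis of the observation *)

Section Kurtosis.
Variables (R : realType) (dT : measure_display) (T : measurableType dT).
Variables (P : probability T R) (d : nat) (Z : {RV P >-> obs R d}).
Variables (theta_s : 'rV[R]_d) (S H : 'M[R]_d).
Variables (p q alpha1 alpha2 eta1 eta2 : R).

Local Notation Ex f := (fine ('E_P[f%R])%E).
Local Notation G := (gram Z).
Local Notation N0 := (popN Z theta_s 1).
Local Notation X w := (covariate (Z w)).

Hypotheses (sqi : square_integrable Z) (mini : is_risk_minimizer Z theta_s).
Hypotheses (N0_gt0 : 0 < N0) (pinv : is_pseudo_inverse G H).
Hypothesis (sq : is_symmetric_sqrt H S).
Hypotheses (p0 : 0 < p) (q0 : 0 < q) (alpha10 : 0 < alpha1) (alpha20 : 0 < alpha2).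
Hypothesis mom1 : covariate_exp_moment Z S p alpha1 eta1.
Hypothesis mom2 : noise_exp_moment Z theta_s q alpha2 eta2.

Implicit Types (theta eta : 'rV[R]_d).

Lemma measurable_comp_sqrt d' (T' : measurableType d') (f : T' -> R) :
  measurable_fun setT f -> measurable_fun setT (fun x => Num.sqrt (f x)).
Proof.
by move=> mf; apply: measurableT_comp mf; apply: continuous_measurable_fun; exact: sqrt_continuous.
Qed.

Lemma measurable_mulmx (A : 'M[R]_d) j :
  measurable_fun setT (fun z : obs R d => (covariate z *m A) 0 j).
Proof.
rewrite (_ : (fun z => _) = (fun z : obs R d => dot (row j A^T) (covariate z))).
  exact: measurable_dot.
by apply/funext => z; rewrite dot_rowE trmxK.
Qed.

Definition whitened_norm (z : obs R d) : R := enorm (covariate z *m S).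

Lemma measurable_whitened : measurable_fun setT whitened_norm.
Proof.
apply: measurable_comp_sqrt; apply: measurable_sum => j.
by apply: measurable_funM; exact: measurable_mulmx.
Qed.

Definition noise (z : obs R d) : R := `|residual theta_s 1 z| / Num.sqrt N0.

Lemma measurable_noise : measurable_fun setT noise.
Proof.
apply: measurable_funM; last exact: measurable_cst.
by apply: measurableT_comp => //; exact: measurable_residual.
Qed.

Lemma whitened_ge0 z : 0 <= whitened_norm z. Proof. exact: sqrtr_ge0. Qed.

Lemma noise_ge0 z : 0 <= noise z.
Proof. by rewrite divr_ge0 ?sqrtr_ge0. Qed.

Lemma noise_powR z (r : R) : 0 <= r ->
  noise z `^ (2 * r) = `|residual theta_s 1 z| `^ (2 * r) / N0 `^ r.
Proof.
move=> r0; rewrite /noise powRM ?invr_ge0 ?sqrtr_ge0//; congr (_ * _).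
have <- := powR12_sqrt (ltW N0_gt0).
rewrite -(powR_inv1 (powR_ge0 N0 2^-1)) -powRN -!powRrM.
by congr (_ `^ _); field.
Qed.

Let mom1' : ('E_P[fun w => expR (alpha1 / 2 *
  (whitened_norm (Z w) `^ (2 * p) - (d%:R `^ p + eta1)))%R] <= 1)%E.
Proof.
move: mom1; rewrite /covariate_exp_moment; congr (_ <= _)%E; congr expectation.
by apply/funext => w; rewrite /whitened_norm; congr (expR (_ * _)); ring.
Qed.

Let mom2' : ('E_P[fun w => expR (alpha2 / 2 *
  (noise (Z w) `^ (2 * q) - (1 + eta2)))%R] <= 1)%E.
Proof.
move: mom2; rewrite /noise_exp_moment; congr (_ <= _)%E; congr expectation.
apply/funext => w; rewrite noise_powR ?(ltW q0)//; congr (expR (_ * _)); ring.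
Qed.

Let mw : measurable_fun setT (fun w => whitened_norm (Z w)).
Proof. exact: (measurable_comp_rv Z measurable_whitened). Qed.

Let mn : measurable_fun setT (fun w => noise (Z w)).
Proof. exact: (measurable_comp_rv Z measurable_noise). Qed.

Let iw4 : itg P (fun w => whitened_norm (Z w) ^+ 4).
Proof. exact: exp_moment_itg4 mw (fun w => whitened_ge0 _) p0 alpha10 mom1'. Qed.

Let in4 : itg P (fun w => noise (Z w) ^+ 4).
Proof. exact: exp_moment_itg4 mn (fun w => noise_ge0 _) q0 alpha20 mom2'. Qed.

Lemma whitened_tail (t : R) (A := [set z : obs R d |
    d%:R `^ p + eta1 + 2 / alpha1 * t < whitened_norm z `^ (2 * p)]) :
  measurable A /\ (P (Z @^-1` A) <= (expR (- t))%:E)%E.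
Proof.
split; last first.
  by have [] := exp_moment_tail mw alpha10 mom1' t.
rewrite -[B in measurable B]setTI; apply: measurable_fun_ltr => //.
exact: measurableT_comp (measurable_powR _) measurable_whitened.
Qed.

Lemma noise_tail (t : R) (A := [set z : obs R d |
    1 + eta2 + 2 / alpha2 * t < noise z `^ (2 * q)]) :
  measurable A /\ (P (Z @^-1` A) <= (expR (- t))%:E)%E.
Proof.
split; last first.
  by have [] := exp_moment_tail mn alpha20 mom2' t.
rewrite -[B in measurable B]setTI; apply: measurable_fun_ltr => //.
exact: measurableT_comp (measurable_powR _) measurable_noise.
Qed.

(** The part of the covariate outside the range of the Gram matrix. *)
Definition off_range (z : obs R d) : R :=
  \sum_(j < d) dot (delta_mx 0 j - delta_mx 0 j *m (G *m H)) (covariate z) ^+ 2.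

Lemma measurable_off_range : measurable_fun setT off_range.
Proof.
by apply: measurable_sum => j; apply: measurable_funX; exact: measurable_dot.
Qed.

Let projT : (G *m H)^T = G *m H. Proof. by case: pinv. Qed.

Lemma off_range_dot z theta : off_range z = 0 ->
  dot theta (covariate z) = dot (theta *m (G *m H)) (covariate z).
Proof.
move=> /eqP; rewrite psumr_eq0 => [/allP h|j _]; last exact: sqr_ge0.
rewrite dotMl projT; congr dot; apply/rowP => j.
have := h j (mem_index_enum j); rewrite sqrf_eq0 dotBl dot_delta subr_eq0 => /eqP ->.
by rewrite dotMl dot_delta projT.
Qed.

Lemma off_range_null : P (Z @^-1` [set z | off_range z != 0]) = 0%E.
Proof.
apply: (@Ex_eq0 _ _ _ _ (fun w => off_range (Z w))).
- by apply: itg_sum => j; exact: itg_dot2.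
- by move=> w; apply: sumr_ge0 => j _; exact: sqr_ge0.
rewrite Ex_sum => [|j]; last exact: itg_dot2.
apply: big1 => j _; rewrite Ex_dot2// (proj_compl_zero pinv).
by rewrite /dot big1// => k _; rewrite mxE mul0r.
Qed.

Let Gsym : G^T = G. Proof. exact: gram_sym. Qed.

(** Off a null set a linear form only sees the range of the Gram matrix, where it
    is bounded by its standard deviation times the whitened norm. *)
Lemma itg_dot4 theta : itg P (fun w => dot theta (X w) ^+ 4) /\
  Ex (fun w => dot theta (X w) ^+ 4) <=
  dot (theta *m G) theta ^+ 2 * Ex (fun w => whitened_norm (Z w) ^+ 4).
Proof.
pose f w := dot (theta *m (G *m H)) (X w) ^+ 4.
have fle w : `|f w| <= dot (theta *m G) theta ^+ 2 * whitened_norm (Z w) ^+ 4.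
  rewrite /f -(dot_sqrt_cross G sq) -[4%N]/((2 * 2)%N) 2!exprM ger0_norm ?sqr_ge0//.
  rewrite /whitened_norm sqr_sqrtr ?dot_ge0// -exprMn.
  rewrite lerXn2r ?nnegrE ?sqr_ge0//.
    by rewrite mulr_ge0 ?dot_ge0// -(dot_sqrt Gsym pinv sq) dot_ge0.
  by rewrite -(dot_sqrt Gsym pinv sq) dot_cs.
have mdot a : measurable_fun setT (fun w => dot a (X w) ^+ 4).
  by apply: measurable_funX; exact: (measurable_comp_rv Z (measurable_dot a)).
have if4 : itg P f.
  by apply: (itg_le _ (itgZ (dot (theta *m G) theta ^+ 2) iw4) fle); exact: mdot.
have mN : measurable (Z @^-1` [set z | off_range z != 0]).
  rewrite -[B in measurable B]setTI; apply: measurable_funPT => //.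
  rewrite (_ : [set z | _] = setT `&` off_range @^-1` (~` [set 0])).
    by apply: measurable_off_range => //; apply: measurableC; exact: measurable_set1.
  by rewrite setTI; apply/seteqP; split => w /= /eqP.
have fE w : ~ (Z @^-1` [set z | off_range z != 0]) w -> dot theta (X w) ^+ 4 = f w.
  by move=> /negP; rewrite /= negbK => /eqP h; rewrite (off_range_dot theta h).
have [i4 E4] := itg_ae (mdot theta) if4 mN off_range_null fE.
split=> //; rewrite E4 -ExZ//; apply: Ex_le => //; first exact: itgZ.
by move=> w; apply: le_trans (fle w); exact: ler_norm.
Qed.

Let k1 := kappa1 Z.
Let k2 := kappa2 Z theta_s.

Lemma gram_quad_ge0 theta : 0 <= dot (theta *m G) theta.
Proof. by rewrite -Ex_dot2//; apply: Ex_ge0 => w; exact: sqr_ge0. Qed.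

(** The supremum is finite, and by homogeneity it controls all directions; the
    directions of zero variance are covered by [itg_dot4]. *)
Lemma kappa1P : 0 <= k1 /\
  forall theta, Ex (fun w => dot theta (X w) ^+ 4) <= k1 * dot (theta *m G) theta ^+ 2.
Proof.
pose A := [set theta | ('E_P[fun w => (dot theta (X w) ^+ 2)%R] <= 1)%E].
pose f theta := ('E_P[fun w => (dot theta (X w) ^+ 4)%R])%E.
set C := Ex (fun w => whitened_norm (Z w) ^+ 4).
have C0 : 0 <= C by apply: Ex_ge0 => w; rewrite exprn_ge0// whitened_ge0.
have fE theta : f theta = (Ex (fun w => dot theta (X w) ^+ 4))%:E.
  by rewrite /f expectationE//; case: (itg_dot4 theta).
have AE theta : A theta <-> dot (theta *m G) theta <= 1.
  by rewrite /A /= expectationE ?lee_fin ?Ex_dot2//; exact: itg_dot2.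
have ub : (ereal_sup [set f theta | theta in A] <= C%:E)%E.
  apply: ge_ereal_sup => _ [theta /AE h <-]; rewrite fE lee_fin.
  have [_ /le_trans] := itg_dot4 theta; apply.
  rewrite -[leRHS]mul1r ler_wpM2r// exprn_ile1//; exact: gram_quad_ge0.
have lb theta : A theta -> (f theta <= ereal_sup [set f theta | theta in A])%E.
  by move=> h; apply: ereal_sup_ubound; exists theta.
have A0 : A 0 by apply/AE; rewrite mul0mx /dot big1 ?ler01// => j _; rewrite mxE mul0r.
have fin : ereal_sup [set f theta | theta in A] = k1%:E.
  rewrite /k1 /kappa1 fineK// fin_numE; apply/andP; split.
    apply/eqP => h; have := lb 0 A0; rewrite h fE.
    by rewrite leeNy_eq.
  by apply/eqP => h; move: ub; rewrite h leye_eq.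
have lb' theta : dot (theta *m G) theta <= 1 ->
    Ex (fun w => dot theta (X w) ^+ 4) <= k1.
  by move=> /AE /lb; rewrite fE fin lee_fin.
split.
  apply: le_trans (lb' 0 ((AE 0).1 A0)); apply: Ex_ge0 => w.
  by rewrite -[4%N]/((2 * 2)%N) exprM sqr_ge0.
move=> theta; have := gram_quad_ge0 theta; rewrite le_eqVlt => /predU1P[h|m0].
  by have [_] := itg_dot4 theta; rewrite -h expr0n/= mul0r mulr0.
set m := dot _ _ in m0 *.
have s0 : 0 < Num.sqrt m by rewrite sqrtr_gt0.
have := lb' ((Num.sqrt m)^-1 *: theta).
rewrite -scalemxAl dotZl dotC dotZl dotC -/m mulrA -expr2 exprVn sqr_sqrtr ?(ltW m0)//.
rewrite mulVf ?gt_eqF// => /(_ (lexx 1)).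
have -> : (fun w => dot ((Num.sqrt m)^-1 *: theta) (X w) ^+ 4) =
    (fun w => (m ^+ 2)^-1 * dot theta (X w) ^+ 4).
  apply/funext => w; rewrite dotZl exprMn; congr (_ * _).
  by rewrite exprVn -[4%N]/((2 * 2)%N) exprM sqr_sqrtr// ltW.
rewrite ExZ; last by case: (itg_dot4 theta).
by rewrite mulrC ler_pdivrMr// exprn_gt0.
Qed.

Lemma kappa1_ge1 : G != 0 -> 1 <= k1.
Proof.
move=> Gn0; have [k10 kP] := kappa1P.
have [theta m0] : exists theta, 0 < dot (theta *m G) theta.
  apply: contrapT => /forallNP h; move/eqP: Gn0; apply.
  have z theta : dot (theta *m G) theta = 0.
    by apply/eqP; rewrite eq_le gram_quad_ge0 andbT leNgt; apply/negP/h.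
  have GS0 : G *m S = 0.
    apply/row_matrixP => i; rewrite row0 rowE mulmxA; apply: dot_eq0.
    by rewrite (dot_sqrt Gsym pinv sq) z.
  by case: pinv => <- _ _ _; case: sq => _ _ <-; rewrite mulmxA GS0 !mul0mx.
have := kP theta; set m := dot _ _ in m0 *.
have i4 : itg P (fun w => dot theta (X w) ^+ 4) by case: (itg_dot4 theta).
have i2 := itg_dot2 sqi theta.
have : m ^+ 2 <= Ex (fun w => dot theta (X w) ^+ 4).
  have -> : m ^+ 2 = Ex (fun w => 2 * m * dot theta (X w) ^+ 2 + - m ^+ 2).
    rewrite ExD; [|exact: itgZ|exact: itg_cst].
    by rewrite ExZ// Ex_cst Ex_dot2// -/m; ring.
  apply: Ex_le => // [|w]; first by apply: itgD; [exact: itgZ|exact: itg_cst].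
  have := sqr_ge0 (dot theta (X w) ^+ 2 - m).
  by rewrite sqrrB -exprM; set u := _ ^+ (2 * 2); lra.
by move=> /le_trans h /h; rewrite -{1}[m ^+ 2]mul1r ler_pM2r ?exprn_gt0.
Qed.

Let e w := residual theta_s 1 (Z w).

Let e_noise w : e w ^+ 2 = N0 * noise (Z w) ^+ 2.
Proof.
rewrite /noise expr_div_n sqr_sqrtr ?(ltW N0_gt0)// real_normK ?num_real//.
by rewrite mulrC divfK ?gt_eqF.
Qed.

Lemma itg_residual4 : itg P (fun w => e w ^+ 4).
Proof.
rewrite (_ : (fun w => _) = (fun w => N0 ^+ 2 * noise (Z w) ^+ 4)); first exact: itgZ.
apply/funext => w; rewrite (_ : e w ^+ 4 = (e w ^+ 2) ^+ 2); last by rewrite -exprM.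
by rewrite e_noise exprMn -exprM.
Qed.

Lemma kappa2P : Ex (fun w => e w ^+ 4) = k2 * N0 ^+ 2.
Proof. by rewrite /k2 /kappa2 divfK// gt_eqF// exprn_gt0. Qed.

Lemma kappa2_ge1 : 1 <= k2.
Proof.
have i2 : itg P (fun w => e w ^+ 2) by exact: itg_residual2.
have : N0 ^+ 2 <= Ex (fun w => e w ^+ 4).
  have -> : N0 ^+ 2 = Ex (fun w => 2 * N0 * e w ^+ 2 + - N0 ^+ 2).
    rewrite ExD; [|exact: itgZ|exact: itg_cst].
    by rewrite ExZ// Ex_cst -[Ex _]/N0; ring.
  apply: Ex_le => // [||w]; last 1 first.
  - have := sqr_ge0 (e w ^+ 2 - N0).
    by rewrite sqrrB -exprM; set u := _ ^+ (2 * 2); lra.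
  - by apply: itgD; [exact: itgZ|exact: itg_cst].
  - exact: itg_residual4.
by rewrite kappa2P -{1}[N0 ^+ 2]mul1r ler_pM2r ?exprn_gt0.
Qed.

Lemma kappa_le_bigK : k1 <= bigK k1 k2 /\ k2 <= bigK k1 k2.
Proof.
have [k10 _] := kappa1P; have k20 : 0 <= k2 := le_trans ler01 kappa2_ge1.
rewrite /bigK /sumsqrt sqrrD !sqr_sqrtr//.
have : 0 <= Num.sqrt k1 * Num.sqrt k2 by rewrite mulr_ge0 ?sqrtr_ge0.
by rewrite mulr2n; set z := _ * _; split; lra.
Qed.

(** The constant K bounds the kurtosis of every linear form of the couple: the
    two parts of a linear form are orthogonal in L^2, and Minkowski's inequality
    in L^4 combines their kurtoses. *)
Lemma residual_fourth theta xi : itg P (fun w => residual theta xi (Z w) ^+ 4) /\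
  Ex (fun w => residual theta xi (Z w) ^+ 4) <= bigK k1 k2 * popN Z theta xi ^+ 2.
Proof.
set eta := theta - xi *: theta_s.
set m := dot (eta *m G) eta; have m0 : 0 <= m := gram_quad_ge0 eta.
have [k10 kP] := kappa1P; have k20 : 0 <= k2 := le_trans ler01 kappa2_ge1.
have b0 : 0 <= xi ^+ 2 * N0 by rewrite mulr_ge0 ?sqr_ge0// ltW.
pose a := Num.sqrt (Num.sqrt k1 * m); pose b := Num.sqrt (Num.sqrt k2 * (xi ^+ 2 * N0)).
have sa : 0 <= Num.sqrt k1 * m by rewrite mulr_ge0 ?sqrtr_ge0.
have sb : 0 <= Num.sqrt k2 * (xi ^+ 2 * N0) by rewrite mulr_ge0 ?sqrtr_ge0.
have a4 : a ^+ 4 = k1 * m ^+ 2.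
  by rewrite -[4%N]/((2 * 2)%N) exprM sqr_sqrtr// exprMn sqr_sqrtr.
have b4 : b ^+ 4 = k2 * (xi ^+ 2 * N0) ^+ 2.
  by rewrite -[4%N]/((2 * 2)%N) exprM sqr_sqrtr// exprMn sqr_sqrtr.
have E : (fun w => residual theta xi (Z w) ^+ 4) =
    (fun w => (xi * e w + dot (- eta) (X w)) ^+ 4).
  apply/funext => w; rewrite (residual_decomp theta_s) -/eta; congr (_ ^+ 4).
  by rewrite dotNl.
have iA : itg P (fun w => (xi * e w) ^+ 4).
  rewrite (_ : (fun w => _) = (fun w => xi ^+ 4 * e w ^+ 4)).
    exact: itgZ itg_residual4.
  by apply/funext => w; rewrite exprMn.
have EA : Ex (fun w => (xi * e w) ^+ 4) <= b ^+ 4.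
  rewrite (_ : (fun w => _) = (fun w => xi ^+ 4 * e w ^+ 4)).
    rewrite ExZ; last exact: itg_residual4.
    by rewrite kappa2P b4 exprMn -exprM mulrCA.
  by apply/funext => w; rewrite exprMn.
have mA : measurable_fun setT (fun w => xi * e w).
  apply: measurable_funM; first exact: measurable_cst.
  exact: (measurable_comp_rv Z (measurable_residual _ _)).
have mB : measurable_fun setT (fun w => dot (- eta) (X w)).
  exact: (measurable_comp_rv Z (measurable_dot _)).
have [iB _] := itg_dot4 (- eta).
have EB : Ex (fun w => dot (- eta) (X w) ^+ 4) <= a ^+ 4.
  rewrite a4 (le_trans (kP _))// -/m ler_wpM2l//.
  by rewrite mulNmx dotNl dotC dotNl opprK dotC.
have [i4 E4] := minkowski4 (sqrtr_ge0 _) (sqrtr_ge0 _) mA mB iA iB EA EB.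
rewrite E; split=> //; apply: le_trans E4 _.
rewrite (popN_pythagoras sqi mini theta xi) -/eta -/m /bigK.
rewrite -[4%N]/((2 * 2)%N) exprM.
rewrite [leRHS](_ : _ = (sumsqrt k1 k2 * (xi ^+ 2 * N0 + m)) ^+ 2); last by rewrite exprMn.
apply: lerXn2r.
- by rewrite nnegrE sqr_ge0.
- by rewrite nnegrE mulr_ge0 ?sumsqrt_ge0// addr_ge0.
rewrite /sumsqrt.
set r1 := Num.sqrt k1 in a sa a4 EB *; set r2 := Num.sqrt k2 in b sb b4 EA *.
have r10 : 0 <= r1 := sqrtr_ge0 _; have r20 : 0 <= r2 := sqrtr_ge0 _.
have a2 : a ^+ 2 = r1 * m by rewrite sqr_sqrtr.
have b2 : b ^+ 2 = r2 * (xi ^+ 2 * N0) by rewrite sqr_sqrtr.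
have ab : 2 * (a * b) <= r1 * (xi ^+ 2 * N0) + r2 * m.
  set z := xi ^+ 2 * N0 in b2 b0 *.
  rewrite -(@ler_pXn2r _ 2)// ?nnegrE.
  - rewrite exprMn (_ : (a * b) ^+ 2 = r1 * m * (r2 * z)); last by rewrite exprMn a2 b2.
    rewrite -subr_ge0 (_ : _ - _ = (r1 * z - r2 * m) ^+ 2) ?sqr_ge0//; ring.
  - by rewrite !mulr_ge0 ?sqrtr_ge0.
  - by rewrite addr_ge0// mulr_ge0.
move: ab; rewrite sqrrD a2 b2 [b * a]mulrC mulr2n.
by set u := a * b; set z := xi ^+ 2 * N0; lra.
Qed.

End Kurtosis.

(** * Coordinates of the linear forms *)

Section Coordinates.
Variables (R : realType) (dT : measure_display) (T : measurableType dT).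
Variables (P : probability T R) (d : nat) (Z : {RV P >-> obs R d}).
Variables (theta_s : 'rV[R]_d) (S H : 'M[R]_d).
Variables (p q alpha1 alpha2 eta1 eta2 : R).

Local Notation Ex f := (fine ('E_P[f%R])%E).
Local Notation G := (gram Z).
Local Notation N0 := (popN Z theta_s 1).
Local Notation k1 := (kappa1 Z).
Local Notation k2 := (kappa2 Z theta_s).

Hypotheses (sqi : square_integrable Z) (mini : is_risk_minimizer Z theta_s).
Hypotheses (N0_gt0 : 0 < N0) (pinv : is_pseudo_inverse G H).
Hypothesis (sq : is_symmetric_sqrt H S).
Hypotheses (p0 : 0 < p) (q0 : 0 < q) (alpha10 : 0 < alpha1) (alpha20 : 0 < alpha2).
Hypothesis mom1 : covariate_exp_moment Z S p alpha1 eta1.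
Hypothesis mom2 : noise_exp_moment Z theta_s q alpha2 eta2.

(** The standardized residual, followed by the coordinates of the whitened
    covariate. *)
Definition coord_fs : seq (obs R d -> R) :=
  (fun z => residual theta_s 1 z / Num.sqrt N0) ::
  [seq (fun z : obs R d => (covariate z *m S) 0 j) | j <- enum 'I_d].

Definition coords (theta : 'rV[R]_d) (xi : R) : seq R :=
  xi * Num.sqrt N0 ::
  [seq - ((theta - xi *: theta_s) *m G *m S) 0 j | j <- enum 'I_d].

Lemma size_coord_fs : size coord_fs = d.+1.
Proof. by rewrite /= size_map size_enum_ord. Qed.

Lemma size_coords theta xi : size (coords theta xi) = size coord_fs.
Proof. by rewrite /= !size_map. Qed.

Lemma featE z : feat coord_fs z = residual theta_s 1 z / Num.sqrt N0 ::
  [seq (covariate z *m S) 0 j | j <- enum 'I_d].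
Proof. by rewrite /feat /= -map_comp. Qed.

Let sN0 : Num.sqrt N0 ^+ 2 = N0. Proof. by rewrite sqr_sqrtr// ltW. Qed.

Let sN0_neq0 : Num.sqrt N0 != 0. Proof. by rewrite gt_eqF// sqrtr_gt0. Qed.

Lemma feat_norm z :
  sdot (feat coord_fs z) (feat coord_fs z) = noise Z theta_s z ^+ 2 + whitened_norm S z ^+ 2.
Proof.
rewrite featE /= sdot_enum /whitened_norm sqr_sqrtr ?dot_ge0// -/(dot _ _).
congr (_ + _); rewrite -expr2 /noise !expr_div_n; congr (_ / _).
by rewrite real_normK ?num_real.
Qed.

Let Gsym : G^T = G. Proof. exact: gram_sym. Qed.

(** The coordinates are an isometry for the population norm. *)
Lemma coords_norm theta xi :
  sdot (coords theta xi) (coords theta xi) = popN Z theta xi.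
Proof.
rewrite /coords /= sdot_enum (popN_pythagoras sqi mini theta xi); congr (_ + _).
  by rewrite -expr2 exprMn sN0.
rewrite -(dot_sqrt Gsym pinv sq); apply: eq_bigr => j _.
by rewrite mulrNN.
Qed.

(** A linear form is unchanged, for the population, when its covariate part is
    projected onto the range of the Gram matrix. *)
Definition range_part (theta : 'rV[R]_d) (xi : R) : 'rV[R]_d :=
  xi *: theta_s + (theta - xi *: theta_s) *m (G *m H).

Lemma popN_range_part theta xi : popN Z (range_part theta xi) xi = popN Z theta xi.
Proof.
rewrite !(popN_pythagoras sqi mini _ xi).
by rewrite /range_part addrAC subrr add0r (dot_proj Gsym pinv sq).
Qed.

Lemma coords_feat theta xi z :
  sdot (coords theta xi) (feat coord_fs z) = residual (range_part theta xi) xi z.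
Proof.
rewrite featE /coords /= sdot_enum.
rewrite (residual_decomp theta_s (range_part theta xi)) /range_part.
rewrite addrAC subrr add0r -(dot_sqrt_cross G sq); congr (_ + _).
  by rewrite -mulrA; congr (_ * _); rewrite mulrCA divff// mulr1.
by rewrite -sumrN; apply: eq_bigr => j _; rewrite mulNr.
Qed.

Lemma residual_range_part theta xi z : off_range Z H z = 0 ->
  residual (range_part theta xi) xi z = residual theta xi z.
Proof.
move=> h; rewrite !(residual_decomp theta_s _ xi); congr (_ - _).
by rewrite /range_part addrAC subrr add0r -(off_range_dot pinv _ h).
Qed.

Lemma measurable_coord f : f \in coord_fs -> measurable_fun setT f.
Proof.
rewrite inE => /orP[/eqP ->|/mapP[j _ ->]]; last exact: measurable_mulmx.
apply: measurable_funM; last exact: measurable_cst.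
exact: measurable_residual.
Qed.

(** Each coordinate is a linear form of variance at most 1, in the direction of a
    row of S or of the residual. *)
Lemma coord_fourth f : f \in coord_fs ->
  itg P (fun w => f (Z w) ^+ 4) /\ Ex (fun w => f (Z w) ^+ 4) <= bigK k1 k2.
Proof.
have [k1K k2K] := kappa_le_bigK sqi N0_gt0 pinv sq p0 q0 alpha10 alpha20 mom1 mom2.
rewrite inE => /orP[/eqP ->|/mapP[j _ ->]].
  have E : (fun w => (residual theta_s 1 (Z w) / Num.sqrt N0) ^+ 4) =
      (fun w => (N0 ^+ 2)^-1 * residual theta_s 1 (Z w) ^+ 4).
    apply/funext => w; rewrite expr_div_n mulrC; congr (_^-1 * _).
    by rewrite -[4%N]/((2 * 2)%N) exprM sN0.
  have i4 := itg_residual4 N0_gt0 q0 alpha20 mom2.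
  rewrite E; split; first exact: itgZ.
  rewrite ExZ// kappa2P// mulrCA mulVf ?mulr1//.
  by rewrite gt_eqF// exprn_gt0.
have [k10 kP] := kappa1P sqi pinv sq p0 alpha10 mom1.
have E : (fun w => (covariate (Z w) *m S) 0 j ^+ 4) =
    (fun w => dot (row j S) (covariate (Z w)) ^+ 4).
  by apply/funext => w; rewrite dot_rowE; case: sq => -> _ _.
have [i4 _] := itg_dot4 sqi pinv sq p0 alpha10 mom1 (row j S).
rewrite E; split => //; apply: le_trans (kP _) _; apply: le_trans k1K.
rewrite -[leRHS]mulr1 ler_wpM2l// exprn_ile1//; first exact: gram_quad_ge0.
exact: (proj_diag_le1 Gsym pinv sq).
Qed.

Lemma feat_norm_moment :
  itg P (fun w => sdot (feat coord_fs (Z w)) (feat coord_fs (Z w)) ^+ 2) /\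
  Ex (fun w => sdot (feat coord_fs (Z w)) (feat coord_fs (Z w)) ^+ 2) <=
  bigK k1 k2 * (size coord_fs)%:R ^+ 2.
Proof.
have le w : sdot (feat coord_fs (Z w)) (feat coord_fs (Z w)) ^+ 2 <=
    (size coord_fs)%:R * \sum_(f <- coord_fs) f (Z w) ^+ 4.
  by rewrite (le_trans (sdot_sq_le _))// size_feat /feat big_map.
pose F (i : 'I_(size coord_fs)) w := (nth (fun=> 0) coord_fs i) (Z w) ^+ 4.
have FP i := coord_fourth (mem_nth (fun=> 0) (ltn_ord i)).
have iF i : itg P (F i) by case: (FP i).
have EF w : \sum_(f <- coord_fs) f (Z w) ^+ 4 = \sum_i F i w.
  by rewrite (big_nth (fun=> 0)) big_mkord.
have iS : itg P (fun w => (size coord_fs)%:R * \sum_i F i w).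
  by apply: itgZ; exact: itg_sum.
have i2 : itg P (fun w => sdot (feat coord_fs (Z w)) (feat coord_fs (Z w)) ^+ 2).
  apply: itg_le iS _.
    apply: measurable_funX.
    exact: (measurable_comp_rv Z (measurable_sdot2 measurable_coord)).
  by move=> w; rewrite ger0_norm ?sqr_ge0// -EF.
split=> //; apply: le_trans (Ex_le i2 iS _) _; first by move=> w; rewrite -EF.
rewrite ExZ; last exact: itg_sum.
rewrite Ex_sum// expr2 mulrCA ler_wpM2l//.
apply: le_trans (ler_sum _ (fun i _ => (FP i).2)) _.
by rewrite sumr_const card_ord mulr_natr.
Qed.

End Coordinates.

(** * Deviations of the truncated squared residuals *)

Section Deviation.
Variables (R : realType) (dT : measure_display) (T : measurableType dT).
Variables (P : probability T R) (d : nat) (Z : {RV P >-> obs R d}).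
Variables (theta_s : 'rV[R]_d) (S H : 'M[R]_d).
Variables (p q alpha1 alpha2 eta1 eta2 : R).

Local Notation G := (gram Z).
Local Notation N0 := (popN Z theta_s 1).
Local Notation k1 := (kappa1 Z).
Local Notation k2 := (kappa2 Z theta_s).

Hypotheses (sqi : square_integrable Z) (mini : is_risk_minimizer Z theta_s).
Hypotheses (N0_gt0 : 0 < N0) (pinv : is_pseudo_inverse G H).
Hypothesis (sq : is_symmetric_sqrt H S).
Hypotheses (p0 : 0 < p) (q0 : 0 < q) (alpha10 : 0 < alpha1) (alpha20 : 0 < alpha2).
Hypothesis mom1 : covariate_exp_moment Z S p alpha1 eta1.
Hypothesis mom2 : noise_exp_moment Z theta_s q alpha2 eta2.

(** The scale that balances the variance term n lam^2 (K - 1) / 2 with the price of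
    uniformity. *)
Definition lambda_hat (eps : R) (n : nat) : R :=
  Num.sqrt (2 * (bigK k1 k2 - 1) / n%:R * complexity d eps) / (bigK k1 k2 - 1).

Lemma lambda_hat_sqr eps n : (0 < n)%N -> 1 < bigK k1 k2 -> 0 <= complexity d eps ->
  lambda_hat eps n ^+ 2 * (bigK k1 k2 - 1) * n%:R = 2 * complexity d eps.
Proof.
move=> n0 K1 C0; have K0 : 0 < bigK k1 k2 - 1 by rewrite subr_gt0.
have nn : 0 < n%:R :> R by rewrite ltr0n.
rewrite /lambda_hat expr_div_n sqr_sqrtr; last first.
  by rewrite mulr_ge0// divr_ge0 ?(ltW nn)// mulr_ge0// ltW.
by field; rewrite !gt_eqF.
Qed.

Lemma complexity_ge (eps : R) : 0 < eps <= 1 ->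
  0 <= ln eps^-1 /\ 73 / 100 * d.+1%:R <= complexity d eps.
Proof.
move=> /andP[e0 e1]; have L0 : 0 <= ln eps^-1.
  by apply: ln_ge0; rewrite invf_ge1.
by split=> //; rewrite /complexity lerDr.
Qed.

(** The truncated squares of the forms with population norm 1 - sg e have a
    nonpositive sum: their mean, of order - lam e for each observation, absorbs the
    variance, the rounding and the union bound.  By homogeneity these forms
    represent all those which are not null. *)
Lemma deviation (n : nat) (Zs : 'I_n -> {RV P >-> obs R d}) (eps sg : R)
    (e := delta_hat d k1 k2 eps n) :
  independent_copies Z Zs -> 0 < eps <= 1 -> 1 < bigK k1 k2 ->
  min_sample_size d k1 k2 eps < n%:R -> sg ^+ 2 = 1 -> 0 < 1 - sg * e ->
  1 - sg * e <= 1 + e ->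
  exists A : set T, [/\ measurable A, ((1 - eps)%:E <= P A)%E &
    forall om, A om -> (forall i, off_range Z H (Zs i om) = 0) ->
    forall theta xi, popN Z theta xi = 1 - sg * e ->
    \sum_(i < n) clip (sg * lambda_hat eps n *
      (residual theta xi (Zs i om) ^+ 2 - 1)) <= 0].
Proof.
move=> ind eps01 K1 nmin sg2 m0 me.
have [L0 CD] := complexity_ge eps01.
have /andP[eps0 eps1] := eps01.
set C := complexity d eps in CD.
set K := bigK k1 k2 in K1.
set D := (d.+1%:R : R) in CD.
have D0 : 0 < D by rewrite ltr0n.
have C0 : 0 < C by apply: lt_le_trans CD; rewrite mulr_gt0// divr_gt0.
have [n0 mu0 mu1 e0 bal] := delta_hat_balance (ltW K1) (ltW C0) nmin.
rewrite -/e in e0 bal.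
have nn : 0 < n%:R :> R by rewrite ltr0n.
have K0 : 0 < K - 1 by rewrite subr_gt0.
have Kp : 0 < K by rewrite (lt_trans ltr01).
set lam := lambda_hat eps n.
have lamE := lambda_hat_sqr n0 K1 (ltW C0).
have lam0 : 0 < lam.
  by rewrite divr_gt0// sqrtr_gt0 !mulr_gt0 ?invr_gt0.
have lamM : lam * (K - 1) = Num.sqrt (2 * (K - 1) / n%:R * C).
  by rewrite /lam /lambda_hat divfK// gt_eqF.
rewrite -/lam -/K -/C in lamE; clearbody lam.
(* with this x the rounding loss n lam^2 K h^2 D is a fixed multiple of D, like
   the logarithm of the number of relevant lattice points *)
pose x := Num.sqrt (D * (K - 1) / (C * K)).
have CK : 0 < C * K by rewrite mulr_gt0.
have x0 : 0 < x by rewrite sqrtr_gt0 divr_gt0// mulr_gt0.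
have xE : x ^+ 2 * (C * K) = D * (K - 1).
  have q0' : 0 <= D * (K - 1) / (C * K) by apply: ltW; rewrite divr_gt0// mulr_gt0.
  by rewrite sqr_sqrtr// divfK// gt_eqF.
pose E := 681 / 100 * sumsqrt k1 k2 * Num.sqrt (2 * D / n%:R).
have EE : n%:R * lam * E * x = 1362 / 100 * D.
  have y0 : 0 <= n%:R * lam * sumsqrt k1 k2 * Num.sqrt (2 * D / n%:R) * x.
    apply: mulr_ge0 (ltW x0); apply: mulr_ge0 (sqrtr_ge0 _).
    apply: mulr_ge0 (sumsqrt_ge0 _ _); exact: ltW (mulr_gt0 nn lam0).
  have : n%:R * lam * sumsqrt k1 k2 * Num.sqrt (2 * D / n%:R) * x = 2 * D.
    apply/eqP; rewrite -(@eqrXn2 _ 2)//; last by rewrite mulr_ge0// ltW.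
    apply/eqP.
    have s2 : Num.sqrt (2 * D / n%:R) ^+ 2 = 2 * D / n%:R.
      by rewrite sqr_sqrtr//; apply: ltW; rewrite divr_gt0// mulr_gt0.
    rewrite !exprMn s2 -/(bigK k1 k2) -/K.
    have K1n : K - 1 != 0 by rewrite gt_eqF.
    have C1n : C != 0 by rewrite gt_eqF.
    apply: (mulIf K1n); apply: (mulIf C1n).
    rewrite [LHS](_ : _ = (lam ^+ 2 * (K - 1) * n%:R) * (x ^+ 2 * (C * K)) * (2 * D)).
      by rewrite lamE xE; ring.
    by field; rewrite gt_eqF.
  move=> h; rewrite (_ : _ * x = 681 / 100 * (n%:R * lam * sumsqrt k1 k2 *
    Num.sqrt (2 * D / n%:R) * x)); last by rewrite /E; ring.
  by rewrite h; field.
pose h := x / (16 * Num.sqrt D).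
have sD0 : 0 < Num.sqrt D by rewrite sqrtr_gt0.
have h0 : 0 < h by rewrite divr_gt0// mulr_gt0.
have [iq2 Eq2] := feat_norm_moment sqi N0_gt0 pinv sq p0 q0 alpha10 alpha20 mom1 mom2.
have Ds : (size (coord_fs Z theta_s S))%:R = D by rewrite size_coord_fs.
have s0 : (0 < size (coord_fs Z theta_s S))%N by rewrite size_coord_fs.
have [A [mA PA HA]] := uniform_clip (measurable_coord (theta_s := theta_s) (S := S) (Z := Z)) iq2 ind eps0
  (ltW lam0) sg2 h0 m0 s0 Eq2.
exists A; split=> // om Aom off theta xi Nm.
have y2 : (fun w => sdot (coords Z theta_s S theta xi) (feat (coord_fs Z theta_s S) (Z w)) ^+ 2) =
   (fun w => residual (range_part Z theta_s H theta xi) xi (Z w) ^+ 2).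
  by apply/funext => w; rewrite (coords_feat N0_gt0 sq).
have y4 : (fun w => sdot (coords Z theta_s S theta xi) (feat (coord_fs Z theta_s S) (Z w)) ^+ 4) =
   (fun w => residual (range_part Z theta_s H theta xi) xi (Z w) ^+ 4).
  by apply/funext => w; rewrite (coords_feat N0_gt0 sq).
have := HA om Aom (coords Z theta_s S theta xi).
rewrite y2 y4 size_coords (coords_norm sqi mini N0_gt0 pinv sq).
rewrite -/(popN _ _ _) (popN_range_part sqi mini pinv sq) Nm.
have [_ F4] := residual_fourth sqi mini N0_gt0 pinv sq p0 q0 alpha10 alpha20 mom1 mom2 (range_part Z theta_s H theta xi) xi.
rewrite (popN_range_part sqi mini pinv sq) Nm in F4.
move=> /(_ erefl erefl erefl F4).
rewrite (eq_bigr (fun i => clip (sg * lam * (residual theta xi (Zs i om) ^+ 2 - 1)))); last first.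
  move=> i _; by rewrite (coords_feat N0_gt0 sq) (residual_range_part theta_s pinv).
move=> /le_trans; apply; rewrite Ds.
apply: (@error_balance R n%:R D K C (ln eps^-1) lam x E e (1 - sg * e) sg) => //.
- by rewrite /C /complexity -/D addrK.
- exact: ltW.
- rewrite lamM; move: bal; rewrite -lamM mulfK ?gt_eqF//; exact.
Qed.

End Deviation.

(** * From truncated squares to the empirical risk *)

Section Deterministic.
Variables (R : realType) (n : nat) (s : 'I_n -> R) (lam m : R).
Hypotheses (n0 : (0 < n)%N) (lam0 : 0 < lam) (m0 : 0 < m).
Hypothesis s0 : forall i, 0 <= s i.

Let nn : 0 < n%:R :> R. Proof. by rewrite ltr0n. Qed.

(** For the lower bound the argument of the truncation is at most lam, whatever the
    sample. *)
Lemma mean_ge_of_clip : \sum_(i < n) clip (-1 * lam * (m * s i - 1)) <= 0 ->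
  1 - lam ^+ 2 / 3 <= m * (n%:R^-1 * \sum_(i < n) s i).
Proof.
move=> h.
have : \sum_(i < n) (-1 * lam * (m * s i - 1) - lam ^+ 3 / 3) <= 0.
  apply: le_trans h; apply: ler_sum => i _; apply: clip_ge_cubic; first exact: ltW.
  have : 0 <= lam * (m * s i) by rewrite mulr_ge0 ?(ltW lam0)// mulr_ge0// ltW.
  lra.
have -> : \sum_(i < n) (-1 * lam * (m * s i - 1) - lam ^+ 3 / 3) =
    lam * (n%:R * (1 - lam ^+ 2 / 3) - m * \sum_(i < n) s i).
  rewrite (eq_bigr (fun i => (lam - lam ^+ 3 / 3) + (- (lam * m)) * s i)); last by move=> i _; ring.
  by rewrite big_split /= -mulr_sumr sumr_const card_ord -mulr_natl; field.
rewrite pmulr_rle0// subr_le0 mulrCA => h2.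
by rewrite ler_pdivlMl.
Qed.

(** For the upper bound the argument is unbounded a priori; the cubic loss is
    bounded through s^3 <= r^4 s and moved to the left-hand side. *)
Lemma mean_le_of_clip (r : R) : (forall i, s i <= r ^+ 2) ->
  \sum_(i < n) clip (1 * lam * (m * s i - 1)) <= 0 ->
  m * (n%:R^-1 * \sum_(i < n) s i) * (1 - lam ^+ 2 / 3 * r ^+ 4 * m ^+ 2) <= 1.
Proof.
move=> sr h.
have : \sum_(i < n) (1 * lam * (m * s i - 1) - (lam * m) ^+ 3 / 3 * r ^+ 4 * s i) <= 0.
  apply: le_trans h; apply: ler_sum => i _.
  apply: (@le_trans _ _ (1 * lam * (m * s i - 1) - (lam * (m * s i)) ^+ 3 / 3)).
    rewrite lerD2l lerN2 mulrA !exprMn.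
    have : s i ^+ 3 <= r ^+ 4 * s i.
      rewrite exprSr ler_wpM2r// -[4%N]/((2 * 2)%N) exprM lerXn2r// nnegrE//.
      exact: sqr_ge0.
    have : 0 <= lam ^+ 3 * m ^+ 3 / 3 by rewrite divr_ge0// mulr_ge0// exprn_ge0// ltW.
    by move=> a0 /(ler_wpM2l a0); lra.
  apply: clip_ge_cubic.
    by rewrite mulr_ge0 ?(ltW lam0)// mulr_ge0// ltW.
  by have := lam0; lra.
have -> : \sum_(i < n) (1 * lam * (m * s i - 1) - (lam * m) ^+ 3 / 3 * r ^+ 4 * s i) =
    lam * (m * (1 - lam ^+ 2 / 3 * r ^+ 4 * m ^+ 2) * (\sum_(i < n) s i) - n%:R).
  rewrite (eq_bigr (fun i => (- lam) + (lam * m - (lam * m) ^+ 3 / 3 * r ^+ 4) * s i)); last by move=> i _; ring.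
  by rewrite big_split /= -mulr_sumr sumr_const card_ord -mulr_natl; field.
rewrite pmulr_rle0// subr_le0 => h2.
rewrite [leLHS](_ : _ = n%:R^-1 * (m * (1 - lam ^+ 2 / 3 * r ^+ 4 * m ^+ 2) * \sum_(i < n) s i)); last by ring.
by rewrite ler_pdivrMl// mulr1.
Qed.

End Deterministic.

Section Events.
Variables (R : realType) (dT : measure_display) (T : measurableType dT).
Variables (P : probability T R).

Lemma prob_inter (A B : set T) (a b : R) : measurable A -> measurable B ->
  ((1 - a)%:E <= P A)%E -> ((1 - b)%:E <= P B)%E ->
  ((1 - (a + b))%:E <= P (A `&` B))%E.
Proof.
move=> mA mB PA PB.
have mC : measurable (~` A `|` ~` B) by apply: measurableU; exact: measurableC.
have <- : ~` (~` A `|` ~` B) = A `&` B by rewrite setCU !setCK.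
have h (C : set T) c : measurable C -> ((1 - c)%:E <= P C)%E -> (P (~` C) <= c%:E)%E.
  move=> mC' hC; rewrite probability_setC//.
  rewrite -[P C]fineK ?fin_num_measure// -EFinB lee_fin.
  by move: hC; rewrite -{1}[P C]fineK ?fin_num_measure// lee_fin; lra.
apply: prob_compl_ge => //; rewrite EFinD.
apply: le_trans (measureU2 _ _ _) _; [exact: measurableC|exact: measurableC|].
by apply: leeD; exact: h.
Qed.

Variables (d : nat) (Z : {RV P >-> obs R d}).

(** A rare property of one observation is avoided by the whole sample. *)
Lemma sample_avoid (n : nat) (Zs : 'I_n -> {RV P >-> obs R d}) (B : set (obs R d)) (c : R) :
  independent_copies Z Zs -> measurable B -> (P (Z @^-1` B) <= c%:E)%E ->
  exists A : set T, [/\ measurable A, ((1 - n%:R * c)%:E <= P A)%E &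
    forall om, A om -> forall i, ~ B (Zs i om)].
Proof.
move=> [law _] mB PB.
have mi i : measurable (Zs i @^-1` B).
  by rewrite -[X in measurable X]setTI; exact: measurable_funPT.
pose U := [set om | 1 <= \sum_(i < n) (\1_B (Zs i om) : R)].
have pre i : (fun om => \1_B (Zs i om)) = \1_(Zs i @^-1` B) :> (T -> R).
  apply/funext => om; rewrite !indicE.
  suff -> : (Zs i om \in B) = (om \in Zs i @^-1` B) by [].
  by apply/idP/idP => /set_mem h; exact/mem_set.
have iB i : itg P (fun om => \1_B (Zs i om)).
  by rewrite pre; exact: itg_indic.
have mU : measurable U.
  rewrite -[X in measurable X]setTI; apply: measurable_fun_ler => //.
  by apply: measurable_sum => i; exact: itg_meas (iB i).
exists (~` U); split; first exact: measurableC.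
  apply: prob_compl_ge => //.
  apply: (@le_trans _ _ (fine ('E_P[fun om => (\sum_(i < n) (\1_B (Zs i om)))%R])%E)%:E).
    apply: prob_le_Ex mU _ _ _ => [|om|om //]; first exact: itg_sum.
    by apply: sumr_ge0 => i _; rewrite indicE.
  rewrite lee_fin Ex_sum// mulr_natl -[X in _ *+ X](card_ord n) -sumr_const.
  apply: ler_sum => i _.
  by rewrite pre Ex_indic// -lee_fin fineK ?fin_num_measure// law.
move=> om h i Bi; apply: h; rewrite /U /= (bigD1 i)//= indicE mem_set// lerDl.
by apply: sumr_ge0 => j _; rewrite indicE.
Qed.

End Events.

(** * The good event *)

Section GoodEvent.
Variables (R : realType) (dT : measure_display) (T : measurableType dT).
Variables (P : probability T R) (d : nat) (Z : {RV P >-> obs R d}).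
Variables (theta_s : 'rV[R]_d) (S H : 'M[R]_d).
Variables (p q alpha1 alpha2 eta1 eta2 : R).

Local Notation G := (gram Z).
Local Notation N0 := (popN Z theta_s 1).

Hypothesis d0 : (0 < d)%N.
Hypotheses (sqi : square_integrable Z) (mini : is_risk_minimizer Z theta_s).
Hypotheses (N0_gt0 : 0 < N0) (pinv : is_pseudo_inverse G H).
Hypothesis (sq : is_symmetric_sqrt H S).
Hypotheses (p0 : 0 < p) (q0 : 0 < q) (alpha10 : 0 < alpha1) (alpha20 : 0 < alpha2).
Hypotheses (eta10 : 0 < eta1) (eta20 : 0 < eta2).
Hypothesis mom1 : covariate_exp_moment Z S p alpha1 eta1.
Hypothesis mom2 : noise_exp_moment Z theta_s q alpha2 eta2.

Lemma residualZ (c : R) (theta : 'rV[R]_d) (xi : R) (z : obs R d) :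
  residual (c *: theta) (c * xi) z = c * residual theta xi z.
Proof. by rewrite /residual dotZl; ring. Qed.

Lemma popNZ (c : R) (theta : 'rV[R]_d) (xi : R) :
  popN Z (c *: theta) (c * xi) = c ^+ 2 * popN Z theta xi.
Proof.
rewrite /popN -ExZ; last exact: itg_residual2.
by congr fine; congr expectation; apply/funext => w; rewrite residualZ exprMn.
Qed.

Lemma popN_ge0 (theta : 'rV[R]_d) (xi : R) : 0 <= popN Z theta xi.
Proof. by apply: Ex_ge0 => w; exact: sqr_ge0. Qed.

(** Off a null set, a linear form is bounded by its standard deviation times
    the norm of the vector of coordinates. *)
Lemma residual_sqr_le theta xi z : off_range Z H z = 0 ->
  residual theta xi z ^+ 2 <=
  popN Z theta xi * (noise Z theta_s z ^+ 2 + whitened_norm S z ^+ 2).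
Proof.
move=> off; rewrite -(residual_range_part theta_s pinv theta xi off).
rewrite -(coords_feat N0_gt0 sq) -(feat_norm Z theta_s S z).
by rewrite -(coords_norm sqi mini N0_gt0 pinv sq) sdot_cs.
Qed.

Lemma sqr_le_powR (x r b : R) : 0 <= x -> 0 < r -> 1 <= b -> x `^ (2 * r) <= b ->
  x ^+ 2 <= b `^ (2 / r).
Proof.
move=> x0 r0 b1 xb.
have -> : x ^+ 2 = (x `^ (2 * r)) `^ r^-1.
  by rewrite -powRrM -mulrA divff ?gt_eqF// mulr1 powR_mulrn.
apply: (@le_trans _ _ (b `^ r^-1)).
  by apply: ge0_ler_powR; rewrite ?nnegrE ?invr_ge0 ?powR_ge0 ?(ltW r0)// (le_trans ler01).
rewrite ler_powR//.
by rewrite -[leLHS]mul1r ler_wpM2r ?invr_ge0 ?(ltW r0)//; lra.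
Qed.

Section Sample.
Variables (n : nat) (eps : R).
Hypotheses (n0 : (0 < n)%N) (eps01 : 0 < eps <= 1).

Let b1 := d%:R `^ p + eta1 + 2 * alpha1^-1 * ln (n%:R / eps).
Let b2 := 1 + eta2 + 2 * alpha2^-1 * ln (n%:R / eps).
Let B := b1 `^ (2 / p) + b2 `^ (2 / q).

Let ln0 : 0 <= ln (n%:R / eps).
Proof.
have /andP[e0 e1] := eps01; apply: ln_ge0; rewrite ler_pdivlMr// mul1r.
by rewrite (le_trans e1)// ler1n.
Qed.

Let b1_ge1 : 1 <= b1.
Proof.
have : 1 <= d%:R `^ p.
  apply: (@le_trans _ _ (1 `^ p)); first by rewrite powR1.
  apply: ge0_ler_powR; rewrite ?nnegrE ?ler0n ?(ltW p0)//.
  by rewrite ler1n.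
have : 0 <= 2 * alpha1^-1 * ln (n%:R / eps).
  by rewrite mulr_ge0// mulr_ge0// invr_ge0 ltW.
by rewrite /b1; have := eta10; lra.
Qed.

Let b2_ge1 : 1 <= b2.
Proof.
have : 0 <= 2 * alpha2^-1 * ln (n%:R / eps).
  by rewrite mulr_ge0// mulr_ge0// invr_ge0 ltW.
by rewrite /b2; have := eta20; lra.
Qed.

Lemma radius_base_ge2 : 2 <= B.
Proof.
have h (b r : R) : 1 <= b -> 0 < r -> 1 <= b `^ (2 / r).
  move=> b1' r0; apply: (@le_trans _ _ (1 `^ (2 / r))); first by rewrite powR1.
  have b0 : 0 <= b := le_trans ler01 b1'.
  by apply: ge0_ler_powR; rewrite ?nnegrE// divr_ge0// ltW.
by have := h b1 p b1_ge1 p0; have := h b2 q b2_ge1 q0; rewrite /B; lra.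
Qed.

(** The set of forms of population norm at most 1 is symmetric, so that the
    supremum of the residuals bounds their absolute values. *)
Lemma sample_radius_finite (zs : 'I_n -> obs R d) :
  (forall i, off_range Z H (zs i) = 0) ->
  (forall i, whitened_norm S (zs i) `^ (2 * p) <= b1) ->
  (forall i, noise Z theta_s (zs i) `^ (2 * q) <= b2) ->
  exists r : R, [/\ sample_radius Z zs = r%:E, 0 <= r, r ^+ 4 <= B ^+ 2 &
    forall i theta xi, popN Z theta xi <= 1 -> residual theta xi (zs i) ^+ 2 <= r ^+ 2].
Proof.
move=> off w1 w2.
have B0 : 0 <= B by rewrite (le_trans _ radius_base_ge2).
have le_B i theta xi : popN Z theta xi <= 1 -> residual theta xi (zs i) <= Num.sqrt B.
  move=> N1; apply: le_trans (ler_norm _) _; rewrite -sqrtr_sqr ler_wsqrtr//.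
  apply: le_trans (residual_sqr_le theta xi (off i)) _.
  apply: (@le_trans _ _ (1 * (noise Z theta_s (zs i) ^+ 2 + whitened_norm S (zs i) ^+ 2))).
    by rewrite ler_wpM2r// addr_ge0// sqr_ge0.
  rewrite mul1r addrC; apply: lerD; apply: sqr_le_powR => //.
  - exact: whitened_ge0.
  - exact: noise_ge0.
pose si i := ereal_sup [set (residual t.1 t.2 (zs i))%:E |
      t in [set t : 'rV[R]_d * R | popN Z t.1 t.2 <= 1]].
have siB i : (si i <= (Num.sqrt B)%:E)%E.
  by apply: ge_ereal_sup => _ [[theta xi] /= h <-]; rewrite lee_fin le_B.
have si_ge i theta xi : popN Z theta xi <= 1 -> ((residual theta xi (zs i))%:E <= si i)%E.
  by move=> h; apply: ereal_sup_ubound; exists (theta, xi).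
have ub : (sample_radius Z zs <= (Num.sqrt B)%:E)%E.
  by apply: bigmax_le => [|i _]; [rewrite leNye|exact: siB].
have lb i : (si i <= sample_radius Z zs)%E by exact: le_bigmax.
have z0 : popN Z 0 0 <= 1.
  by have := popNZ 0 0 0; rewrite scale0r mul0r expr0n/= mul0r => ->.
have lb0 : (0 <= sample_radius Z zs)%E.
  apply: le_trans (lb (Ordinal n0)); apply: le_trans (si_ge _ _ _ z0).
  rewrite lee_fin /residual mul0r /dot big1 ?subr0// => j _.
  by rewrite mxE mul0r.
have fin : sample_radius Z zs \is a fin_num.
  by rewrite ge0_fin_numE// (le_lt_trans ub)// ltry.
exists (fine (sample_radius Z zs)); set r := fine _.
have rE : sample_radius Z zs = r%:E by rewrite /r fineK.
have r0 : 0 <= r by rewrite -lee_fin -rE.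
have rB : r <= Num.sqrt B by rewrite -lee_fin -rE.
split=> //.
  have -> : B ^+ 2 = Num.sqrt B ^+ 4 by rewrite -[4%N]/((2 * 2)%N) exprM sqr_sqrtr.
  by rewrite lerXn2r// nnegrE ?sqrtr_ge0.
move=> i theta xi N1.
have le_r theta' xi' : popN Z theta' xi' <= 1 -> residual theta' xi' (zs i) <= r.
  by move=> h; rewrite -lee_fin -rE; apply: le_trans (lb i); exact: si_ge.
have a1 := le_r _ _ N1.
have a2 : - residual theta xi (zs i) <= r.
  rewrite -mulN1r -residualZ; apply: le_r.
  by rewrite popNZ sqrrN expr1n mul1r.
by rewrite -[leLHS]real_normK ?num_real// lerXn2r ?nnegrE// ler_norml; apply/andP; split; lra.
Qed.

Variable Zs : 'I_n -> {RV P >-> obs R d}.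
Hypothesis ind : independent_copies Z Zs.

Lemma radius_event : exists A : set T,
  [/\ measurable A, ((1 - 2 * eps)%:E <= P A)%E &
    forall om, A om -> (forall i, off_range Z H (Zs i om) = 0) /\
    exists r : R, [/\ sample_radius Z (fun i => Zs i om) = r%:E, 0 <= r,
      r ^+ 4 <= B ^+ 2 &
      forall i theta xi, popN Z theta xi <= 1 ->
        residual theta xi (Zs i om) ^+ 2 <= r ^+ 2]].
Proof.
have /andP[e0 e1] := eps01.
have nn : 0 < n%:R :> R by rewrite ltr0n.
have tE : expR (- ln (n%:R / eps)) = eps / n%:R.
  by rewrite expRN lnK ?posrE ?divr_gt0// invf_div.
have nE : n%:R * (eps / n%:R) = eps by rewrite mulrCA divff ?mulr1// gt_eqF.
have [m1 P1] := whitened_tail alpha10 mom1 (ln (n%:R / eps)).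
have [m2 P2] := noise_tail N0_gt0 q0 alpha20 mom2 (ln (n%:R / eps)).
rewrite tE in P1 P2.
have m3 : measurable [set z : obs R d | off_range Z H z != 0].
  rewrite (_ : [set z | _] = setT `&` off_range Z H @^-1` (~` [set 0])).
    by apply: measurable_off_range => //; apply: measurableC; exact: measurable_set1.
  by rewrite setTI; apply/seteqP; split => w /= /eqP.
have P3 : (P (Z @^-1` [set z | (off_range Z H z != 0)%R]) <= 0%:E)%E.
  by rewrite off_range_null.
have [A1 [mA1 PA1 HA1]] := sample_avoid ind m1 P1.
have [A2 [mA2 PA2 HA2]] := sample_avoid ind m2 P2.
have [A3 [mA3 PA3 HA3]] := sample_avoid ind m3 P3.
rewrite nE in PA1; rewrite nE in PA2; rewrite mulr0 in PA3.
exists ((A1 `&` A2) `&` A3); split.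
- by apply: measurableI => //; exact: measurableI.
- have := prob_inter (measurableI _ _ mA1 mA2) mA3 (prob_inter mA1 mA2 PA1 PA2) PA3.
  by rewrite addr0 mulr_natl mulr2n.
- move=> om [[a1 a2] a3].
  have off i : off_range Z H (Zs i om) = 0.
    by apply/eqP; apply: contrapT => /negP h; exact: (HA3 _ a3 i).
  split=> //; apply: sample_radius_finite => // i.
    by rewrite leNgt; apply/negP; exact: (HA1 _ a1 i).
  by rewrite leNgt; apply/negP; exact: (HA2 _ a2 i).
Qed.

End Sample.

End GoodEvent.

(** * Uniform concentration of the empirical risk *)

Section Concentration.
Variables (R : realType) (dT : measure_display) (T : measurableType dT).
Variables (P : probability T R) (d : nat) (Z : {RV P >-> obs R d}).
Variables (theta_s : 'rV[R]_d) (S H : 'M[R]_d).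
Variables (p q alpha1 alpha2 eta1 eta2 : R).

Local Notation Ex f := (fine ('E_P[f%R])%E).
Local Notation G := (gram Z).
Local Notation N0 := (popN Z theta_s 1).
Local Notation k1 := (kappa1 Z).
Local Notation k2 := (kappa2 Z theta_s).

Hypothesis d0 : (0 < d)%N.
Hypotheses (sqi : square_integrable Z) (mini : is_risk_minimizer Z theta_s).
Hypotheses (N0_gt0 : 0 < N0) (pinv : is_pseudo_inverse G H).
Hypothesis (sq : is_symmetric_sqrt H S).
Hypotheses (p0 : 0 < p) (q0 : 0 < q) (alpha10 : 0 < alpha1) (alpha20 : 0 < alpha2).
Hypotheses (eta10 : 0 < eta1) (eta20 : 0 < eta2).
Hypothesis mom1 : covariate_exp_moment Z S p alpha1 eta1.
Hypothesis mom2 : noise_exp_moment Z theta_s q alpha2 eta2.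

Variables (n : nat) (eps : R) (Zs : 'I_n -> {RV P >-> obs R d}).
Hypotheses (eps01 : 0 < eps <= 1) (ind : independent_copies Z Zs).
Hypothesis nmin : min_sample_size d k1 k2 eps < n%:R.

Let e := delta_hat d k1 k2 eps n.
Let gm := gamma_minus d k1 k2 eps n.
Let K := bigK k1 k2.

Let K_ge1 : 1 <= K.
Proof.
have [_ h] := kappa_le_bigK sqi N0_gt0 pinv sq p0 q0 alpha10 alpha20 mom1 mom2.
by apply: le_trans h; exact: kappa2_ge1 sqi N0_gt0 q0 alpha20 mom2.
Qed.

Let C_gt0 : 0 < complexity d eps.
Proof.
have [_ h] := complexity_ge d eps01.
by apply: lt_le_trans h; rewrite mulr_gt0// divr_gt0.
Qed.

Let n_gt0 : (0 < n)%N.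
Proof. by have [] := delta_hat_balance K_ge1 (ltW C_gt0) nmin. Qed.

Let nn : 0 < n%:R :> R. Proof. by rewrite ltr0n. Qed.

Let e_gt0 : 0 < e.
Proof. by have [] := delta_hat_balance K_ge1 (ltW C_gt0) nmin. Qed.

Definition concentrated (r : R) (zs : 'I_n -> obs R d) : Prop :=
  forall theta xi,
  (popN Z theta xi = 0 -> empN zs theta xi = 0) /\
  (0 < popN Z theta xi ->
     1 - gm <= (1 + e) * (empN zs theta xi / popN Z theta xi) /\
     (e < 1 -> (1 - e) * (empN zs theta xi / popN Z theta xi) *
        (1 - gm * r ^+ 4 * (1 + e) ^+ 2) <= 1)).

Let null_residual om (off : forall i, off_range Z H (Zs i om) = 0) theta xi :
  popN Z theta xi = 0 -> empN (fun i => Zs i om) theta xi = 0.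
Proof.
move=> N1; rewrite /empN big1 ?mulr0// => i _.
have := residual_sqr_le sqi mini N0_gt0 pinv sq theta xi (off i).
by rewrite N1 mul0r => h; apply/eqP; rewrite eq_le h sqr_ge0.
Qed.

Let empN_ratio zs theta xi : empN zs theta xi / popN Z theta xi =
  n%:R^-1 * \sum_(i < n) residual theta xi (zs i) ^+ 2 / popN Z theta xi.
Proof. by rewrite /empN -mulrA mulr_suml. Qed.

Let sign_event sg : 1 < K -> sg ^+ 2 = 1 -> 0 < 1 - sg * e -> 1 - sg * e <= 1 + e ->
  exists A : set T, [/\ measurable A, ((1 - eps)%:E <= P A)%E &
    forall om, A om -> (forall i, off_range Z H (Zs i om) = 0) ->
    forall theta xi, 0 < popN Z theta xi ->
    \sum_(i < n) clip (sg * lambda_hat Z theta_s eps n *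
     ((1 - sg * e) * (residual theta xi (Zs i om) ^+ 2 / popN Z theta xi) - 1)) <= 0].
Proof.
move=> K1 sg2 m0 me.
have [A [mA PA HA]] := deviation sqi mini N0_gt0 pinv sq p0 q0 alpha10 alpha20
  mom1 mom2 ind eps01 K1 nmin sg2 m0 me.
exists A; split=> // om Aom off theta xi N1.
set m := 1 - sg * e in m0 *; set N := popN Z theta xi in N1 *.
have c2 : Num.sqrt (m / N) ^+ 2 = m / N by rewrite sqr_sqrtr// divr_ge0 ?ltW.
have Nm : popN Z (Num.sqrt (m / N) *: theta) (Num.sqrt (m / N) * xi) = m.
  by rewrite popNZ// c2 -/N divfK// gt_eqF.
have := HA om Aom off _ _ Nm.
rewrite (eq_bigr (fun i => clip (sg * lambda_hat Z theta_s eps n *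
     (m * (residual theta xi (Zs i om) ^+ 2 / N) - 1))))// => i _.
by rewrite residualZ exprMn c2; congr (clip (_ * (_ - 1))); ring.
Qed.

Let gm_lam : 1 < K -> gm = lambda_hat Z theta_s eps n ^+ 2 / 3.
Proof.
move=> K1; have := lambda_hat_sqr n_gt0 K1 (ltW C_gt0).
rewrite /gm /gamma_minus => <-.
have K0 : K - 1 != 0 by rewrite gt_eqF// subr_gt0.
by rewrite -/K; field; rewrite K0 gt_eqF.
Qed.

Let concentration_gt1 : 1 < K -> exists A : set T,
  [/\ measurable A, ((1 - 4 * eps)%:E <= P A)%E &
    forall om, A om -> exists r : R,
     [/\ sample_radius Z (fun i => Zs i om) = r%:E, 0 <= r,
      r ^+ 4 <= ((d%:R `^ p + eta1 + 2 * alpha1^-1 * ln (n%:R / eps)) `^ (2 / p)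
      + (1 + eta2 + 2 * alpha2^-1 * ln (n%:R / eps)) `^ (2 / q)) ^+ 2 &
      concentrated r (fun i => Zs i om)]].
Proof.
move=> K1.
have lam0 : 0 < lambda_hat Z theta_s eps n.
  by rewrite divr_gt0 ?subr_gt0// sqrtr_gt0 !mulr_gt0 ?invr_gt0 ?subr_gt0.
have [A1 [mA1 PA1 HA1]] := radius_event d0 sqi mini N0_gt0 pinv sq p0 q0 alpha10
  alpha20 eta10 eta20 mom1 mom2 n_gt0 eps01 ind.
have [A2 [mA2 PA2 HA2]] : exists A : set T, [/\ measurable A, ((1 - eps)%:E <= P A)%E &
    forall om, A om -> (forall i, off_range Z H (Zs i om) = 0) ->
    forall theta xi, 0 < popN Z theta xi ->
    \sum_(i < n) clip (-1 * lambda_hat Z theta_s eps n *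
     ((1 + e) * (residual theta xi (Zs i om) ^+ 2 / popN Z theta xi) - 1)) <= 0].
  have E : 1 - -1 * e = 1 + e by ring.
  have := @sign_event (-1) K1; rewrite sqrrN expr1n E.
  by apply=> //; rewrite addr_gt0.
have [A3 [mA3 PA3 HA3]] : exists A : set T, [/\ measurable A, ((1 - eps)%:E <= P A)%E &
    forall om, A om -> (forall i, off_range Z H (Zs i om) = 0) -> e < 1 ->
    forall theta xi, 0 < popN Z theta xi ->
    \sum_(i < n) clip (1 * lambda_hat Z theta_s eps n *
     ((1 - e) * (residual theta xi (Zs i om) ^+ 2 / popN Z theta xi) - 1)) <= 0].
  have [e1|e1] := ltP e 1; last first.
    exists setT; split; [exact: measurableT| |move=> om _ _ e1'; exfalso; lra].
    rewrite probability_setT lee_fin.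
    by have /andP[? _] := eps01; lra.
  have E : 1 - 1 * e = 1 - e by ring.
  have := @sign_event 1 K1; rewrite expr1n E => h.
  have [||| A [mA PA HA]] := h _ _ _ => //; first by rewrite subr_gt0.
    by have := e_gt0; lra.
  by exists A; split=> // om h1 h2 _; exact: HA.
exists ((A1 `&` A2) `&` A3); split.
- by apply: measurableI => //; exact: measurableI.
- have := prob_inter (measurableI _ _ mA1 mA2) mA3 (prob_inter mA1 mA2 PA1 PA2) PA3.
  by rewrite (_ : 2 * eps + eps + eps = 4 * eps)//; ring.
move=> om [[a1 a2] a3]; have [off [r [rE r0 rB rR]]] := HA1 om a1.
exists r; split=> // theta xi; split; first exact: null_residual.
move=> N1; rewrite empN_ratio gm_lam//.
pose s i := residual theta xi (Zs i om) ^+ 2 / popN Z theta xi.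
have s0 i : 0 <= s i by rewrite divr_ge0 ?sqr_ge0// ltW.
have me : 0 < 1 + e by rewrite addr_gt0.
split.
  by have := mean_ge_of_clip n_gt0 lam0 me s0 (HA2 om a2 off theta xi N1).
move=> e1; have m1 : 0 < 1 - e by rewrite subr_gt0.
have sr i : s i <= r ^+ 2.
  have c2 : (Num.sqrt (popN Z theta xi))^-1 ^+ 2 = (popN Z theta xi)^-1.
    by rewrite exprVn sqr_sqrtr// ltW.
  have := rR i ((Num.sqrt (popN Z theta xi))^-1 *: theta) ((Num.sqrt (popN Z theta xi))^-1 * xi).
  rewrite popNZ// c2 mulVf ?gt_eqF// => /(_ (lexx 1)).
  by rewrite residualZ exprMn c2 mulrC.
have := mean_le_of_clip n_gt0 lam0 m1 s0 sr (HA3 om a3 off e1 theta xi N1).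
apply: le_trans; rewrite ler_wpM2l//.
  apply: mulr_ge0 (ltW m1) _; apply: mulr_ge0; first by rewrite invr_ge0 ltW.
  by apply: sumr_ge0 => i _; exact: s0.
rewrite lerD2l lerN2 ler_wpM2l//.
  by apply: mulr_ge0; [rewrite divr_ge0 ?sqr_ge0|exact: exprn_ge0].
by rewrite lerXn2r ?nnegrE ?(ltW m1) ?(ltW me)//; have := e_gt0; lra.
Qed.

(** When K = 1 the covariate vanishes and the squared noise is constant, so that
    the empirical and the population forms coincide almost surely. *)
Let concentration_eq1 : K = 1 -> exists A : set T,
  [/\ measurable A, ((1 - 4 * eps)%:E <= P A)%E &
    forall om, A om -> exists r : R,
     [/\ sample_radius Z (fun i => Zs i om) = r%:E, 0 <= r,
      r ^+ 4 <= ((d%:R `^ p + eta1 + 2 * alpha1^-1 * ln (n%:R / eps)) `^ (2 / p)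
      + (1 + eta2 + 2 * alpha2^-1 * ln (n%:R / eps)) `^ (2 / q)) ^+ 2 &
      concentrated r (fun i => Zs i om)]].
Proof.
move=> K1; have /andP[eps0 _] := eps01.
have [A1 [mA1 PA1 HA1]] := radius_event d0 sqi mini N0_gt0 pinv sq p0 q0 alpha10
  alpha20 eta10 eta20 mom1 mom2 n_gt0 eps01 ind.
have [k10 _] := kappa1P sqi pinv sq p0 alpha10 mom1.
have k21 := kappa2_ge1 sqi N0_gt0 q0 alpha20 mom2.
have k20 : 0 <= k2 := le_trans ler01 k21.
have KE : K = k1 + k2 + 2 * (Num.sqrt k1 * Num.sqrt k2).
  by rewrite /K /bigK /sumsqrt sqrrD !sqr_sqrtr//; ring.
have s0 : 0 <= Num.sqrt k1 * Num.sqrt k2 by rewrite mulr_ge0 ?sqrtr_ge0.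
have k2E : k2 = 1 by lra.
have k1E : k1 = 0 by lra.
have G0 : G = 0.
  apply/eqP; apply: contrapT => /negP h.
  by have := kappa1_ge1 sqi pinv sq p0 alpha10 mom1 h; rewrite k1E ler10.
pose v (z : obs R d) := (residual theta_s 1 z ^+ 2 - N0) ^+ 2.
have mv : measurable_fun setT v.
  apply: measurable_funX; apply: measurable_funB; last exact: measurable_cst.
  by apply: measurable_funX; exact: measurable_residual.
have i2 : itg P (fun w => residual theta_s 1 (Z w) ^+ 2) by exact: itg_residual2.
have i4 : itg P (fun w => residual theta_s 1 (Z w) ^+ 4).
  exact: itg_residual4 N0_gt0 q0 alpha20 mom2.
have vE : (fun w => v (Z w)) = (fun w => residual theta_s 1 (Z w) ^+ 4 +
    ((- (2 * N0)) * residual theta_s 1 (Z w) ^+ 2 + N0 ^+ 2)).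
  by apply/funext => w; rewrite /v; ring.
have iv : itg P (fun w => v (Z w)).
  by rewrite vE; apply: itgD => //; apply: itgD; [exact: itgZ|exact: itg_cst].
have Ev : Ex (fun w => v (Z w)) = 0.
  rewrite vE ExD//; last by apply: itgD; [exact: itgZ|exact: itg_cst].
  rewrite ExD; [|exact: itgZ|exact: itg_cst].
  by rewrite ExZ// Ex_cst kappa2P// k2E -/(popN _ _ _); ring.
have mB : measurable [set z | v z != 0].
  rewrite (_ : [set z | _] = setT `&` v @^-1` (~` [set 0])).
    by apply: mv => //; apply: measurableC; exact: measurable_set1.
  by rewrite setTI; apply/seteqP; split => w /= /eqP.
have PB : (P (Z @^-1` [set z | (v z != 0)%R]) <= 0%:E)%E.
  by rewrite (Ex_eq0 iv _ Ev)// => w; exact: sqr_ge0.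
have [A2 [mA2 PA2 HA2]] := sample_avoid ind mB PB.
rewrite mulr0 in PA2.
exists (A1 `&` A2); split; first exact: measurableI.
  apply: le_trans (prob_inter mA1 mA2 PA1 PA2).
  by rewrite lee_fin; lra.
move=> om [a1 a2]; have [off [r [rE r0 rB rR]]] := HA1 om a1.
exists r; split=> // theta xi; split; first exact: null_residual.
have res2 i : residual theta xi (Zs i om) ^+ 2 = xi ^+ 2 * N0.
  rewrite (residual_decomp theta_s) (off_range_dot pinv _ (off i)) G0 mul0mx mulmx0.
  rewrite (_ : dot 0 _ = 0) ?subr0; last first.
    by rewrite /dot big1// => j _; rewrite mxE mul0r.
  rewrite exprMn; congr (_ * _); apply/eqP; rewrite -subr_eq0 -sqrf_eq0.
  by apply: contrapT => /negP h; exact: (HA2 om a2 i).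
have NE : popN Z theta xi = xi ^+ 2 * N0.
  rewrite (popN_pythagoras sqi mini theta xi) G0 mulmx0 (_ : dot 0 _ = 0) ?addr0//.
  by rewrite /dot big1// => j _; rewrite mxE mul0r.
move=> N1; have -> : empN (fun i => Zs i om) theta xi = popN Z theta xi.
  rewrite /empN (eq_bigr (fun=> popN Z theta xi)) => [|i _]; last by rewrite res2.
  by rewrite sumr_const card_ord -[popN Z theta xi *+ n]mulr_natl mulrA mulVf ?mul1r// gt_eqF.
have gm0 : gm = 0 by rewrite /gm /gamma_minus -/K K1 subrr mulr0 mul0r invr0 mulr0.
rewrite divff ?gt_eqF// gm0; have := e_gt0.
by split; [lra|move=> _; rewrite !mul0r; lra].
Qed.

Lemma concentration : exists A : set T,
  [/\ measurable A, ((1 - 4 * eps)%:E <= P A)%E &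
    forall om, A om -> exists r : R,
     [/\ sample_radius Z (fun i => Zs i om) = r%:E, 0 <= r,
      r ^+ 4 <= ((d%:R `^ p + eta1 + 2 * alpha1^-1 * ln (n%:R / eps)) `^ (2 / p)
      + (1 + eta2 + 2 * alpha2^-1 * ln (n%:R / eps)) `^ (2 / q)) ^+ 2 &
      concentrated r (fun i => Zs i om)]].
Proof.
have := K_ge1; rewrite le_eqVlt => /predU1P[h|]; last exact: concentration_gt1.
exact: concentration_eq1.
Qed.

End Concentration.

(** * From concentration to relative errors and to the empirical risk minimizer *)

Section ErrorBound.
Variable R : realType.
Implicit Types (e g : R).

Lemma error_bound_fin e g : 0 < e < 1 -> 0 <= g < 1 ->
  error_bound e g%:E = ((e + g) / ((1 - e) * (1 - g)))%:E.
Proof.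
move=> /andP[e0 e1] /andP[g0 g1]; rewrite /error_bound /equot.
have d0 : 0 < (1 - e) * (1 - g) by rewrite mulr_gt0 ?subr_gt0.
rewrite -!EFinB -!EFin_max !max_l ?subr_ge0 ?ltW// -EFinM -EFinD.
by rewrite !eqe (gt_eqF d0) andbF inver (gt_eqF d0) -EFinM.
Qed.

Lemma error_bound_infty e g : 0 < e -> 0 <= g -> 1 <= e \/ 1 <= g ->
  error_bound e g%:E = +oo%E.
Proof.
move=> e0 g0 h; rewrite /error_bound /equot.
rewrite -!EFinB -!EFin_max -EFinM -EFinD.
have -> : Num.max (1 - e) 0 * Num.max (1 - g) 0 = 0.
  case: h => h; first by rewrite [X in X * _]max_r ?mul0r// subr_le0.
  by rewrite [X in _ * X]max_r ?mulr0// subr_le0.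
have eg : 0 < e + g by rewrite ltr_pwDl.
by rewrite !eqe (gt_eqF eg) andFb inver eqxx gt0_muley// lte_fin.
Qed.

(** Both forms of the upper bound on the ratio rest on
    1 / ((1 - e) (1 - g)) - 1 <= (e + g) / ((1 - e) (1 - g)). *)
Lemma ratio_bounds (e gm gp gh A N : R) : 0 < e -> 0 <= gm -> 0 <= gp ->
  gm <= gh -> gp <= gh -> 0 <= N ->
  (N = 0 -> A = 0) ->
  (0 < N -> 1 - gm <= (1 + e) * (A / N) /\
     (e < 1 -> (1 - e) * (A / N) * (1 - gp) <= 1)) ->
  let ratio := equot A%:E N%:E in
  [/\ ((- ((e + gm) / (1 + e)))%:E <= ratio - 1)%E,
      (ratio - 1 <= error_bound e gp%:E)%E,
      (error_bound e gp%:E <= error_bound e gh%:E)%E &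
      (`|ratio - 1| <= error_bound e gh%:E)%E].
Proof.
move=> e0 gm0 gp0 gmh gph N0 AN0 AN1.
have [rho [rhoE rho1 rho2]] : exists rho : R, [/\ equot A%:E N%:E = rho%:E,
    1 - gm <= (1 + e) * rho & e < 1 -> (1 - e) * rho * (1 - gp) <= 1].
  move: N0; rewrite le_eqVlt => /predU1P[N0|N0].
    exists 1; split; first by rewrite /equot -N0 AN0// !eqxx.
      by lra.
    by move=> e1; nra.
  exists (A / N); rewrite /equot !eqe (gt_eqF N0) andbF inver (gt_eqF N0) -EFinM.
  by have [? ?] := AN1 N0.
have gh0 : 0 <= gh := le_trans gm0 gmh.
have me : 0 < 1 + e by rewrite addr_gt0.
cbv zeta; rewrite rhoE -[(rho%:E - 1)%E]/((rho - 1)%:E) -[(`|(rho - 1)%:E|)%E]/(`|rho - 1|%:E).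
have lo : - ((e + gm) / (1 + e)) <= rho - 1.
  rewrite -subr_ge0 (_ : _ - _ = ((1 + e) * rho - (1 - gm)) / (1 + e)); last first.
    by field; rewrite gt_eqF.
  by rewrite divr_ge0 ?subr_ge0// ltW.
have [e1|e1] := leP 1 e.
  rewrite (error_bound_infty e0 gp0 (or_introl e1)) (error_bound_infty e0 gh0 (or_introl e1)).
  by rewrite !leey lee_fin.
have mono : (error_bound e gp%:E <= error_bound e gh%:E)%E.
  have [g1|g1] := leP 1 gh; first by rewrite (error_bound_infty e0 gh0 (or_intror g1)) leey.
  rewrite !error_bound_fin ?e0 ?e1 ?gp0 ?gh0 ?g1//; last exact: le_lt_trans gph g1.
  have h1 : 0 < 1 - gh by rewrite subr_gt0.
  have h2 : 0 < 1 - gp by rewrite subr_gt0 (le_lt_trans gph).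
  have h3 : 0 < 1 - e by rewrite subr_gt0.
  rewrite lee_fin ler_pdivrMr ?mulr_gt0// mulrAC ler_pdivlMr ?mulr_gt0//.
  by rewrite mulrCA [leRHS]mulrCA ler_pM2l//; nra.
have up : ((rho - 1)%:E <= error_bound e gp%:E)%E.
  have [g1|g1] := leP 1 gp; first by rewrite (error_bound_infty e0 gp0 (or_intror g1)) leey.
  rewrite error_bound_fin ?e0 ?gp0// lee_fin.
  have h2 : 0 < 1 - gp by rewrite subr_gt0.
  have h3 : 0 < 1 - e by rewrite subr_gt0.
  rewrite ler_pdivlMr ?mulr_gt0//.
  by have := rho2 e1; have := mulr_ge0 (ltW e0) gp0; lra.
split; [by rewrite lee_fin|exact: up|exact: mono|].
have [rp|rn] := leP 0 (rho - 1).
  by rewrite ger0_norm//; exact: le_trans up mono.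
rewrite ltr0_norm//.
have [g1|g1] := leP 1 gh; first by rewrite (error_bound_infty e0 gh0 (or_intror g1)) leey.
rewrite error_bound_fin ?e0 ?gh0// lee_fin.
have h1 : 0 < 1 - gh by rewrite subr_gt0.
have h3 : 0 < 1 - e by rewrite subr_gt0.
apply: (@le_trans _ _ (e + gh)).
  apply: (@le_trans _ _ ((e + gm) / (1 + e))); first by rewrite lerNl.
  rewrite ler_pdivrMr//.
  by have := mulr_ge0 (ltW e0) (addr_ge0 (ltW e0) gh0); lra.
rewrite ler_pdivlMr ?mulr_gt0//.
rewrite -[leRHS]mulr1 ler_wpM2l ?addr_ge0 ?(ltW e0)//.
by rewrite mulr_ile1 ?(ltW h1) ?(ltW h3)//; lra.
Qed.

Lemma erm_chain (dl A N0 Nh Q n rs : R) : 0 < dl < 1 -> 0 < n -> 0 < N0 ->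
  Nh = N0 + Q -> 0 <= Q -> rs = n * A -> Q <= dl ^+ 2 * Nh ->
  (1 - dl) * Nh <= A -> A <= (1 + dl) * N0 ->
  Nh - N0 <= dl ^+ 2 / ((1 - dl) * (1 - dl ^+ 2) * n) * rs <=
    dl ^+ 2 / (1 - dl) ^+ 2 * N0.
Proof.
move=> /andP[d0 d1] n0 N00 -> Q0 -> Qd Ah A0.
have h1 : 0 < 1 - dl by rewrite subr_gt0.
have h2 : 0 < 1 + dl by rewrite addr_gt0.
have h3 : 0 < 1 - dl ^+ 2 by rewrite (_ : _ - _ = (1 - dl) * (1 + dl)) ?mulr_gt0//; ring.
have A1 : 0 <= A.
  by apply: le_trans Ah; rewrite mulr_ge0 ?(ltW h1)// addr_ge0// ltW.
have -> : dl ^+ 2 / ((1 - dl) * (1 - dl ^+ 2) * n) * (n * A) =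
    dl ^+ 2 * (A / ((1 - dl) * (1 - dl ^+ 2))) by field; rewrite !gt_eqF.
apply/andP; split.
  rewrite addrAC subrr add0r (le_trans Qd)// ler_wpM2l ?sqr_ge0//.
  rewrite ler_pdivlMr ?mulr_gt0// mulrA [_ * (1 - dl)]mulrC.
  apply: (@le_trans _ _ (A * (1 - dl ^+ 2))); first by rewrite ler_wpM2r// ltW.
  by rewrite -[leRHS]mulr1 ler_wpM2l// lerBlDr lerDl sqr_ge0.
have -> : dl ^+ 2 / (1 - dl) ^+ 2 * N0 =
    dl ^+ 2 * ((1 + dl) * N0 / ((1 - dl) * (1 - dl ^+ 2))).
  field; rewrite !gt_eqF//.
by rewrite ler_wpM2l ?sqr_ge0// ler_pM2r// invr_gt0 mulr_gt0.
Qed.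

End ErrorBound.

Section EmpiricalRisk.
Variables (R : realType) (dT : measure_display) (T : measurableType dT).
Variables (P : probability T R) (d : nat) (Z : {RV P >-> obs R d}).
Variables (theta_s : 'rV[R]_d).
Hypotheses (sqi : square_integrable Z) (mini : is_risk_minimizer Z theta_s).
Hypothesis (N0_gt0 : 0 < popN Z theta_s 1).
Variables (n : nat) (zs : 'I_n -> obs R d) (theta_hat : 'rV[R]_d).
Hypotheses (n0 : (0 < n)%N) (erm : is_erm zs theta_hat).

(** The excess risk is the squared population norm of the difference of the two
    minimizers.  It is also the value, on this difference and the empirical
    minimizer, of the population form minus the empirical one, because the
    latter vanishes there by the empirical first-order condition; the
    approximation of the forms on the two points theta_hat +- eta / dl then
    gives a bound of the second order in dl. *)
Lemma erm_excess (dl : R) : 0 < dl < 1 ->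
  (forall theta xi, `|empN zs theta xi - popN Z theta xi| <= dl * popN Z theta xi) ->
  popN Z theta_hat 1 - popN Z theta_s 1
    <= dl ^+ 2 / ((1 - dl) * (1 - dl ^+ 2) * n%:R) * rss zs theta_hat
    <= dl ^+ 2 / (1 - dl) ^+ 2 * popN Z theta_s 1.
Proof.
move=> dl01 app; have /andP[dl0 dl1] := dl01.
have nn : 0 < n%:R :> R by rewrite ltr0n.
set eta := theta_hat - theta_s; set Q := dot (eta *m gram Z) eta.
have Q0 : 0 <= Q by exact: gram_quad_ge0.
have popE t : popN Z (theta_hat + t *: eta) 1 = popN Z theta_s 1 + (1 + t) ^+ 2 * Q.
  rewrite (popN_pythagoras sqi mini _ 1) expr1n mul1r scale1r.
  have -> : theta_hat + t *: eta - theta_s = (1 + t) *: eta.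
    by rewrite scalerDl scale1r addrAC.
  by rewrite -scalemxAl dotZl dotC dotZl dotC -/Q; ring.
have NhE : popN Z theta_hat 1 = popN Z theta_s 1 + Q.
  by have := popE 0; rewrite scale0r addr0 addr0 expr1n mul1r.
have empE theta : empN zs theta 1 = n%:R^-1 * rss zs theta by [].
pose Qe := \sum_(i < n) dot eta (covariate (zs i)) ^+ 2.
pose Be := \sum_(i < n) residual theta_hat 1 (zs i) * dot eta (covariate (zs i)).
have rssE t : rss zs (theta_hat + t *: eta) =
    rss zs theta_hat + (t ^+ 2 * Qe - 2 * t * Be).
  rewrite /rss /Qe /Be !mulr_sumr -sumrB -big_split /=; apply: eq_bigr => i _.
  by rewrite /residual dotDl dotZl; ring.
have Be0 : Be = 0.
  apply: (@quad_linear_eq0 _ Qe); first by apply: sumr_ge0 => i _; exact: sqr_ge0.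
  by move=> t; have := erm (theta_hat + t *: eta); rewrite rssE lerDl.
have app1 theta : (1 - dl) * popN Z theta 1 <= empN zs theta 1 <= (1 + dl) * popN Z theta 1.
  have := app theta 1; rewrite ler_norml => /andP[h1 h2].
  by apply/andP; split; lra.
have rE : rss zs theta_hat = n%:R * empN zs theta_hat 1.
  by rewrite empE mulrA divff ?mul1r// gt_eqF.
apply: (erm_chain dl01 nn N0_gt0 NhE Q0 rE).
- have /andP[_ h1] := app1 (theta_hat + (- dl^-1) *: eta).
  have /andP[h2 _] := app1 (theta_hat + dl^-1 *: eta).
  have same : empN zs (theta_hat + (- dl^-1) *: eta) 1 = empN zs (theta_hat + dl^-1 *: eta) 1.
    by rewrite !empE !rssE Be0 !mulr0 sqrrN.
  rewrite !popE in h1 h2; rewrite same in h1.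
  have := le_trans h2 h1; rewrite NhE => h.
  have dln : dl != 0 by rewrite gt_eqF.
  have : dl^-1 * (4 * Q) <= dl^-1 * (2 * Q + 2 * dl ^+ 2 * (popN Z theta_s 1 + Q)).
    move: h; rewrite -subr_ge0 => h; rewrite -subr_ge0.
    by rewrite (_ : _ - _ = (1 + dl) * (popN Z theta_s 1 + (1 - dl^-1) ^+ 2 * Q) -
      (1 - dl) * (popN Z theta_s 1 + (1 + dl^-1) ^+ 2 * Q)) //; field.
  by rewrite ler_pM2l ?invr_gt0//; lra.
- by have /andP[] := app1 theta_hat.
- have /andP[_] := app1 theta_s; apply: le_trans.
  by rewrite !empE ler_pM2l ?invr_gt0.
Qed.

End EmpiricalRisk.

(** * Orders of magnitude *)

Section Asymptotics.
Variable R : realType.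

Lemma limsup_ratio_le_near (c : R) (A : nat -> \bar R) (B : nat -> R) (N : nat) :
  (forall n, (N <= n)%N -> (A n / (B n)%:E <= c%:E)%E) -> limsup_ratio_le c A B.
Proof.
move=> h; rewrite /limsup_ratio_le /limn_esup /limf_esup.
apply: (@le_trans _ _ (ereal_sup ((fun n => (A n / (B n)%:E)%E) @` [set n | (N <= n)%N]))).
  apply: ereal_inf_lbound; exists [set n | (N <= n)%N] => //.
  by exists N.
by apply: ge_ereal_sup => _ [n Nn <-]; exact: h.
Qed.

(** Any power of a logarithm is dominated by the eighth root. *)
Lemma log_power_le (a b r : R) : 0 <= a -> 0 <= b -> 0 < r ->
  exists2 C, 0 <= C & forall x : R, 1 <= x ->
    (a + b * ln x) `^ r <= C * x `^ 8^-1.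
Proof.
move=> a0 b0 r0; pose s := (8 * r)^-1.
have s0 : 0 < s by rewrite invr_gt0 mulr_gt0.
exists ((a + b / s) `^ r) => [|x x1]; first exact: powR_ge0.
have x0 : 0 < x := lt_le_trans ltr01 x1.
have xs1 : 1 <= x `^ s.
  by apply: (@le_trans _ _ (x `^ 0)); [rewrite powRr0|rewrite ler_powR// ltW].
have l0 : 0 <= ln x by exact: ln_ge0.
have lnx : b * ln x <= b / s * x `^ s.
  rewrite -mulrA ler_wpM2l// mulrC ler_pdivlMr//.
  by rewrite mulrC -ln_powR ltW// ln_sublinear// powR_gt0.
have E : (x `^ s) `^ r = x `^ 8^-1.
  by rewrite -powRrM; congr (_ `^ _); rewrite /s; field; rewrite gt_eqF.
rewrite -E -powRM ?powR_ge0 ?addr_ge0 ?divr_ge0 ?(ltW s0)//.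
apply: ge0_ler_powR; rewrite ?nnegrE ?(ltW r0)//.
- by rewrite addr_ge0// mulr_ge0.
- by rewrite mulr_ge0 ?powR_ge0// addr_ge0// divr_ge0// ltW.
by rewrite mulrDl lerD// ler_peMr.
Qed.

Variables (d : nat) (k1 k2 eps : R).
Hypotheses (d0 : (0 < d)%N) (k10 : 0 <= k1) (k20 : 0 <= k2).
Hypotheses (K1 : 1 <= bigK k1 k2) (eps01 : 0 < eps <= 1).

Let K := bigK k1 k2.
Let C := complexity d eps.
Let L := ln eps^-1.
Let V := (k1 + k2) * (d%:R + L).

Let L0 : 0 <= L. Proof. by have [] := complexity_ge d eps01. Qed.

Let d1 : 1 <= d%:R :> R. Proof. by rewrite ler1n. Qed.

Let DE : d.+1%:R = d%:R + 1 :> R. Proof. by rewrite natr1. Qed.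

Let C0 : 0 <= C.
Proof.
have [_ h] := complexity_ge d eps01; apply: le_trans h.
by apply: mulr_ge0; [lra|exact: ler0n].
Qed.

Let CV : C <= 2 * (d%:R + L).
Proof. by rewrite /C /complexity DE -/L; have := d1; have := L0; lra. Qed.

Let KV : K <= 2 * (k1 + k2).
Proof.
rewrite /K /bigK /sumsqrt sqrrD !sqr_sqrtr// mulr2n.
have := sqr_ge0 (Num.sqrt k1 - Num.sqrt k2).
by rewrite sqrrB !sqr_sqrtr// mulr2n; set z := _ * _; lra.
Qed.

Let KdV : K * (d%:R + L) <= 2 * V.
Proof. by rewrite /V mulrA ler_wpM2r// addr_ge0. Qed.

Let V0 : 0 < V.
Proof.
rewrite /V mulr_gt0//; last by have := d1; have := L0; lra.
by have := KV; have := K1; rewrite -/K; lra.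
Qed.

Let sumsqrt_sqr : sumsqrt k1 k2 ^+ 2 = K. Proof. by []. Qed.

(** The coefficient 5/2 + 1 / (2 (K - 1)) explodes as K tends to 1; the hypothesis on
    K bounds it. *)
Lemma min_sample_size_le : 4 <= K ->
  min_sample_size d k1 k2 eps <= 4000 * V.
Proof.
move=> K4; rewrite /min_sample_size -/K -/C.
have K0 : 0 < K - 1 by lra.
set b := 5 / 2 + 1 / (2 * (K - 1)).
have b3 : b <= 3.
  have : 1 / (2 * (K - 1)) <= 1 / 2 by rewrite ler_pdivrMr; lra.
  by rewrite /b; lra.
have b0 : 0 <= b by rewrite addr_ge0 ?divr_ge0// mulr_ge0// ltW.
set x := 20 * _ * _; set y := b * _.
have x2 : x ^+ 2 = 400 * (K * d.+1%:R).
  by rewrite /x !exprMn sqr_sqrtr ?ler0n// sumsqrt_sqr; ring.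
have y2 : y ^+ 2 <= 18 * (K * C).
  rewrite /y exprMn sqr_sqrtr; last by rewrite mulr_ge0// mulr_ge0// ltW.
  have h1 : b ^+ 2 <= 3 ^+ 2 by rewrite lerXn2r// nnegrE.
  have h2 : 0 <= 2 * (K - 1) * C by rewrite mulr_ge0// mulr_ge0// ltW.
  apply: le_trans (ler_wpM2r h2 h1) _.
  by have := C0; lra.
have KC : K * C <= 2 * (K * (d%:R + L)).
  by rewrite mulrCA ler_wpM2l//; have := K1; rewrite -/K; lra.
have Kd : K * d.+1%:R <= 2 * (K * (d%:R + L)).
  rewrite mulrCA ler_wpM2l ?(le_trans ler01 K1)// DE.
  by have := d1; have := L0; lra.
have : (x + y) ^+ 2 <= 2 * x ^+ 2 + 2 * y ^+ 2.
  rewrite -subr_ge0 (_ : _ - _ = (x - y) ^+ 2) ?sqr_ge0//; ring.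
move: KdV KC Kd y2; rewrite x2.
set k := K * _; set z := K * C; set u := K * d.+1%:R; set v := y ^+ 2.
set w := (x + y) ^+ 2; have := V0; lra.
Qed.

Let M := Num.sqrt (2 * (K - 1) * C) + 681 / 100 * sumsqrt k1 k2 * Num.sqrt (2 * d.+1%:R).

Let mu_hatE n : (0 < n)%N -> mu_hat d k1 k2 eps n = M / Num.sqrt n%:R.
Proof.
move=> n0; have nn : 0 < n%:R :> R by rewrite ltr0n.
have sn : 0 < Num.sqrt (n%:R : R) by rewrite sqrtr_gt0.
have K0 : 0 <= 2 * (K - 1) * C by rewrite mulr_ge0// mulr_ge0// subr_ge0.
have sd (x : R) : 0 <= x -> Num.sqrt (x / n%:R) = Num.sqrt x / Num.sqrt n%:R.
  by move=> x0; rewrite sqrtrM// sqrtrV// ltW.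
rewrite /mu_hat -/K -/C (_ : 2 * (K - 1) / n%:R * C = 2 * (K - 1) * C / n%:R); last by ring.
by rewrite sd// sd ?mulr_ge0// /M; ring.
Qed.

Let M0 : 0 <= M.
Proof.
apply: addr_ge0; first exact: sqrtr_ge0.
apply: mulr_ge0; last exact: sqrtr_ge0.
by apply: mulr_ge0; [lra|exact: sumsqrt_ge0].
Qed.

Let MV : M <= 28 * Num.sqrt V.
Proof.
rewrite -(@ler_pXn2r _ 2)// ?nnegrE ?mulr_ge0 ?sqrtr_ge0//.
rewrite exprMn sqr_sqrtr ?(ltW V0)// /M.
set x := Num.sqrt (2 * (K - 1) * C); set y := _ * Num.sqrt (2 * d.+1%:R).
have x2 : x ^+ 2 = 2 * (K - 1) * C.
  by rewrite sqr_sqrtr// mulr_ge0// mulr_ge0// subr_ge0.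
have y2 : y ^+ 2 <= 47 * (2 * (K * d.+1%:R)).
  have c2 : (681 / 100) ^+ 2 <= 47 :> R by lra.
  have kd : 0 <= 2 * (K * d.+1%:R).
    by rewrite mulr_ge0// mulr_ge0// (le_trans ler01 K1).
  have -> : y ^+ 2 = (681 / 100) ^+ 2 * (2 * (K * d.+1%:R)).
    rewrite /y exprMn sqr_sqrtr ?mulr_ge0// exprMn sumsqrt_sqr.
    by move: ((681 / 100) ^+ 2) => c; ring.
  exact: ler_wpM2r kd _ _ c2.
have KC : K * C <= 2 * (K * (d%:R + L)).
  by rewrite mulrCA ler_wpM2l// (le_trans ler01 K1).
have Kd : K * d.+1%:R <= 2 * (K * (d%:R + L)).
  rewrite mulrCA ler_wpM2l ?(le_trans ler01 K1)// DE.
  by have := d1; have := L0; lra.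
have : (x + y) ^+ 2 <= 2 * x ^+ 2 + 2 * y ^+ 2.
  rewrite -subr_ge0 (_ : _ - _ = (x - y) ^+ 2) ?sqr_ge0//; ring.
move: KdV KC Kd y2; rewrite x2 (_ : 2 * (K - 1) * C = 2 * (K * C) - 2 * C); last by ring.
set k := K * _; set z := K * C; set u := K * d.+1%:R; set v := y ^+ 2.
set w := (x + y) ^+ 2; have := V0; have := C0; lra.
Qed.

Variables (p q alpha1 alpha2 eta1 eta2 : R).
Hypotheses (p0 : 0 < p) (q0 : 0 < q) (alpha10 : 0 < alpha1) (alpha20 : 0 < alpha2).
Hypotheses (eta10 : 0 < eta1) (eta20 : 0 < eta2).

Local Notation e := (delta_hat d k1 k2 eps).
Local Notation g := (gamma_hat d k1 k2 eps p q alpha1 alpha2 eta1 eta2).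
Local Notation rate := (rate d k1 k2 eps).

Let sumsqrt_gt0 : 0 < sumsqrt k1 k2.
Proof.
rewrite lt_neqAle sumsqrt_ge0 andbT; apply/eqP => h.
by move: K1; rewrite /bigK -h expr0n/= ler10.
Qed.

Let M_gt0 : 0 < M.
Proof.
apply: ltr_wpDl; first exact: sqrtr_ge0.
apply: mulr_gt0; last by rewrite sqrtr_gt0 mulr_gt0.
by apply: mulr_gt0; [lra|exact: sumsqrt_gt0].
Qed.

Let gamma_hat_le : exists2 D, 0 <= D & forall n (w : R), 0 < w -> w ^+ 8 = n%:R ->
  (0 < n)%N -> 0 <= e n <= 4^-1 -> 0 <= g n <= D / w ^+ 6.
Proof.
have dp : 0 <= d%:R `^ p + eta1 by rewrite addr_ge0 ?powR_ge0// ltW.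
have e2 : 0 <= 1 + eta2 by rewrite addr_ge0// ltW.
have a1 : 0 <= 2 * alpha1^-1 by rewrite mulr_ge0// invr_ge0 ltW.
have a2 : 0 <= 2 * alpha2^-1 by rewrite mulr_ge0// invr_ge0 ltW.
have [C1 C10 h1] := log_power_le dp a1 (divr_gt0 (ltr0n R 2) p0).
have [C2 C20 h2] := log_power_le e2 a2 (divr_gt0 (ltr0n R 2) q0).
pose D := ((C1 + C2) * eps^-1 `^ 8^-1) ^+ 2.
have /andP[ep0 ep1] := eps01.
have Q0 : 0 <= 2 * C / (3 * (K - 1)).
  by apply: divr_ge0; apply: mulr_ge0 => //; rewrite subr_ge0.
have D0 : 0 <= D by exact: sqr_ge0.
exists (2 * C / (3 * (K - 1)) * 2 * D) => [|n w w0 wn n0 /andP[en0 en1]].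
  by rewrite mulr_ge0// mulr_ge0.
have nn : 0 < n%:R :> R by rewrite ltr0n.
have x1 : 1 <= n%:R / eps by rewrite ler_pdivlMr// mul1r (le_trans ep1)// ler1n.
have xE : (n%:R / eps) `^ 8^-1 = w * eps^-1 `^ 8^-1.
  rewrite powRM ?invr_ge0 ?ler0n ?(ltW ep0)//; congr (_ * _).
  by rewrite -wn -powR_mulrn ?(ltW w0)// -powRrM divff ?powRr1// ltW.
have := h1 _ x1; have := h2 _ x1; rewrite xE /gamma_hat -/C -/K.
set u1 := _ `^ (2 / p); set u2 := _ `^ (2 / q) => v2 v1.
have u10 : 0 <= u1 by exact: powR_ge0.
have u20 : 0 <= u2 by exact: powR_ge0.
have B2 : (u1 + u2) ^+ 2 <= D * w ^+ 2.
  rewrite /D -exprMn lerXn2r ?nnegrE ?addr_ge0//.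
    by rewrite mulr_ge0 ?(ltW w0)// mulr_ge0 ?powR_ge0// addr_ge0.
  have -> : (C1 + C2) * eps^-1 `^ 8^-1 * w =
    C1 * (w * eps^-1 `^ 8^-1) + C2 * (w * eps^-1 `^ 8^-1) by ring.
  exact: lerD.
have E2 : (1 + e n) ^+ 2 <= 2.
  apply: (@le_trans _ _ ((5 / 4) ^+ 2)); last by lra.
  by rewrite lerXn2r ?nnegrE//; lra.
have -> : 2 * C * (1 + e n) ^+ 2 / (3 * (K - 1) * n%:R) =
    2 * C / (3 * (K - 1)) * (1 + e n) ^+ 2 / n%:R by rewrite invfM; ring.
apply/andP; split.
  by rewrite mulr_ge0 ?sqr_ge0// divr_ge0 ?(ltW nn)// mulr_ge0 ?sqr_ge0.
have -> : 2 * C / (3 * (K - 1)) * 2 * D / w ^+ 6 =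
    2 * C / (3 * (K - 1)) * 2 / n%:R * (D * w ^+ 2).
  rewrite -wn; have : w != 0 by rewrite gt_eqF.
  by move: (2 * C / _) => c wN; field.
apply: ler_pM => //; first by rewrite divr_ge0 ?(ltW nn)// mulr_ge0 ?sqr_ge0.
  exact: sqr_ge0.
by rewrite ler_pM2r ?invr_gt0// ler_wpM2l.
Qed.

(** With w the eighth root of n, delta_hat is of order w^-4, like the square
    root of the rate, while gamma_hat is at most of order w^-6. *)
Lemma delta_eventually : exists N, forall n, (N <= n)%N ->
  [/\ 0 < rate n, 0 < e n < 1, 0 <= g n < 1 &
      delta_of (e n) (g n) <= 114 * Num.sqrt (rate n)].
Proof.
have [D D0 HD] := gamma_hat_le.
have sV : 0 < Num.sqrt V by rewrite sqrtr_gt0.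
pose W := 1 + 8 * M + 4 * D + D / Num.sqrt V.
have DV : 0 <= D / Num.sqrt V by rewrite divr_ge0// ltW.
have W0 : 0 <= W by rewrite /W; have := M0; lra.
exists (Num.bound (W ^+ 8)) => n Nn.
have Wn : W ^+ 8 < n%:R.
  apply: (@lt_le_trans _ _ (Num.bound (W ^+ 8))%:R); last by rewrite ler_nat.
  by apply: archi_boundP; exact: exprn_ge0.
have nn : 0 < n%:R :> R by apply: le_lt_trans Wn; exact: exprn_ge0.
have n0 : (0 < n)%N by rewrite -(ltr0n R).
pose w : R := n%:R `^ 8^-1.
have w0 : 0 < w by rewrite powR_gt0.
have wn : w ^+ 8 = n%:R.
  by rewrite -powR_mulrn ?(ltW w0)// -powRrM mulVf ?powRr1// ltW.
have Ww : W <= w by rewrite -(@ler_pXn2r _ 8)// ?nnegrE ?(ltW w0)// wn ltW.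
have [w1 wM wD wDV] : [/\ 1 <= w, 8 * M <= w, 4 * D <= w & D / Num.sqrt V <= w].
  by move: Ww; rewrite /W; have := M0; split; lra.
have w4 : 0 < w ^+ 4 by exact: exprn_gt0.
have sn : Num.sqrt n%:R = w ^+ 4.
  by rewrite -wn (exprM w 4 2) sqrtr_sqr ger0_norm// ltW.
have ww k : (0 < k)%N -> w <= w ^+ k by move=> k0; rewrite -[leLHS]expr1 ler_weXn2l.
have rE : Num.sqrt (rate n) = Num.sqrt V / w ^+ 4.
  by rewrite /Defs.rate -/L -/V sqrtrM ?(ltW V0)// sqrtrV ?(ltW nn)// sn.
have mE := mu_hatE n0; rewrite sn in mE.
have mu0 : 0 < mu_hat d k1 k2 eps n by rewrite mE divr_gt0.
have mu1 : mu_hat d k1 k2 eps n <= 8^-1.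
  rewrite mE ler_pdivrMr//; have := ww 4%N isT.
  by move: (w ^+ 4) wM => z; lra.
have e0 : 0 < e n by rewrite /delta_hat divr_gt0//; lra.
have e2 : e n <= 2 * mu_hat d k1 k2 eps n.
  rewrite /delta_hat ler_pdivrMr; last by lra.
  by move: (mu_hat _ _ _ _ _) mu0 mu1 => m m0 m1; nra.
have e1 : e n <= 4^-1 by lra.
have er : e n <= 56 * Num.sqrt (rate n).
  rewrite rE; apply: le_trans e2 _; rewrite mE !mulrA ler_pM2r ?invr_gt0//.
  by have := MV; lra.
have /andP[g0 gD] : 0 <= g n <= D / w ^+ 6 by apply: HD => //; rewrite (ltW e0).
have g1 : g n <= 4^-1.
  apply: le_trans gD _; rewrite ler_pdivrMr ?exprn_gt0//; have := ww 6%N isT.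
  by move: (w ^+ 6) wD => z; lra.
have gr : g n <= Num.sqrt (rate n).
  apply: le_trans gD _; rewrite rE (exprD w 2 4) invfM mulrA ler_pM2r ?invr_gt0//.
  rewrite ler_pdivrMr ?exprn_gt0// mulrC -ler_pdivrMr//.
  by apply: le_trans wDV _; exact: ww.
split; first by rewrite divr_gt0.
- by rewrite e0; lra.
- by rewrite g0; lra.
have s0 : 0 <= Num.sqrt (rate n) by exact: sqrtr_ge0.
rewrite /delta_of.
have den : 2^-1 <= (1 - e n) * (1 - g n) by nra.
rewrite ler_pdivrMr; last by lra.
apply: (@le_trans _ _ (114 * Num.sqrt (rate n) * 2^-1)); first by lra.
by rewrite ler_wpM2l// mulr_ge0.
Qed.

Lemma limsup_bound : limsup_ratio_le 114
  (fun n => error_bound (e n) (g n)%:E) (fun n => Num.sqrt (rate n)).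
Proof.
have [N HN] := delta_eventually.
apply: (@limsup_ratio_le_near _ _ _ N) => n /HN[r0 e01 g01 dl].
have s0 : 0 < Num.sqrt (rate n) by rewrite sqrtr_gt0.
rewrite error_bound_fin// inver (gt_eqF s0) -EFinM lee_fin.
by rewrite ler_pdivrMr.
Qed.

Lemma limsup_delta_sqr : limsup_ratio_le (114 ^+ 2)
  (fun n => (delta_of (e n) (g n) ^+ 2)%:E) (fun n => rate n).
Proof.
have [N HN] := delta_eventually.
apply: (@limsup_ratio_le_near _ _ _ N) => n /HN[r0 /andP[e0 e1] /andP[g0 g1] dl].
rewrite inver (gt_eqF r0) -EFinM lee_fin ler_pdivrMr//.
rewrite -[X in _ * X](sqr_sqrtr (ltW r0)) -exprMn lerXn2r//.
  rewrite nnegrE divr_ge0 ?addr_ge0 ?(ltW e0)//.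
  by rewrite mulr_ge0 ?subr_ge0 ?(ltW e1) ?(ltW g1).
by rewrite nnegrE mulr_ge0 ?sqrtr_ge0.
Qed.

End Asymptotics.

(** * Conclusion *)

Section Conclusion.
Variables (R : realType) (dT : measure_display) (T : measurableType dT).
Variables (P : probability T R) (d : nat) (Z : {RV P >-> obs R d}).
Variables (theta_s : 'rV[R]_d) (S H : 'M[R]_d).
Variables (p q alpha1 alpha2 eta1 eta2 : R).

Local Notation N0 := (popN Z theta_s 1).
Local Notation k1 := (kappa1 Z).
Local Notation k2 := (kappa2 Z theta_s).

Hypothesis d0 : (0 < d)%N.
Hypotheses (sqi : square_integrable Z) (mini : is_risk_minimizer Z theta_s).
Hypotheses (N0_gt0 : 0 < N0) (pinv : is_pseudo_inverse (gram Z) H).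
Hypothesis (sq : is_symmetric_sqrt H S).
Hypotheses (p0 : 0 < p) (q0 : 0 < q) (alpha10 : 0 < alpha1) (alpha20 : 0 < alpha2).
Hypotheses (eta10 : 0 < eta1) (eta20 : 0 < eta2).
Hypothesis mom1 : covariate_exp_moment Z S p alpha1 eta1.
Hypothesis mom2 : noise_exp_moment Z theta_s q alpha2 eta2.

Variables (n : nat) (eps : R) (Zs : 'I_n -> {RV P >-> obs R d}).
Hypotheses (eps0 : 0 < eps) (ind : independent_copies Z Zs).
Hypothesis nmin : min_sample_size d k1 k2 eps < n%:R.

Local Notation e := (delta_hat d k1 k2 eps n).
Local Notation gm := (gamma_minus d k1 k2 eps n).
Local Notation gh := (gamma_hat d k1 k2 eps p q alpha1 alpha2 eta1 eta2 n).
Local Notation sample w := (fun i => Zs i w).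

Lemma risk_ratio_event : exists A : set T,
  [/\ measurable A, ((1 - 4 * eps)%:E <= P A)%E &
    forall w, A w -> [/\ (0 < n)%N, 0 < e, 0 <= gh &
    forall theta xi,
      (popN Z theta xi = 0 -> empN (sample w) theta xi = 0) /\
      let ratio := equot (empN (sample w) theta xi)%:E (popN Z theta xi)%:E in
      let bound_R :=
        error_bound e (gamma_plus d k1 k2 eps n (sample_radius Z (sample w))) in
      [/\ ((- ((e + gm) / (1 + e)))%:E <= ratio - 1)%E,
          (ratio - 1 <= bound_R)%E,
          (bound_R <= error_bound e gh%:E)%E &
          (`|ratio - 1| <= error_bound e gh%:E)%E]]].
Proof.
have [eps1|eps1] := ltP 1 eps.
  (* the claimed probability is negative *)
  by exists set0; split=> //; rewrite measure0 lee_fin; lra.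
have eps01 : 0 < eps <= 1 by rewrite eps0.
have [L0 CL] := complexity_ge d eps01.
have C0 : 0 <= complexity d eps.
  by apply: le_trans CL; apply: mulr_ge0; [lra|exact: ler0n].
have [k1K k2K] := kappa_le_bigK sqi N0_gt0 pinv sq p0 q0 alpha10 alpha20 mom1 mom2.
have K1 : 1 <= bigK k1 k2.
  by apply: le_trans k2K; exact: kappa2_ge1 sqi N0_gt0 q0 alpha20 mom2.
have [n0 _ _ e0 _] := delta_hat_balance K1 C0 nmin.
have gm0 : 0 <= gm.
  apply: divr_ge0; first by rewrite mulr_ge0.
  by rewrite mulr_ge0// mulr_ge0// subr_ge0.
have [A [mA PA HA]] := concentration d0 sqi mini N0_gt0 pinv sq p0 q0 alpha10
  alpha20 eta10 eta20 mom1 mom2 eps01 ind nmin.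
exists A; split=> // w /HA[r [rE r0 rB conc]].
have B2 := radius_base_ge2 d0 p0 q0 alpha10 alpha20 eta10 eta20 n0 eps01.
have ghE : gh = gm * (1 + e) ^+ 2 *
   ((d%:R `^ p + eta1 + 2 * alpha1^-1 * ln (n%:R / eps)) `^ (2 / p)
     + (1 + eta2 + 2 * alpha2^-1 * ln (n%:R / eps)) `^ (2 / q)) ^+ 2.
  by rewrite /gamma_hat /gamma_minus; congr (_ * _); rewrite mulrAC.
move: ghE rB B2; set B := (_ `^ (2 / p) + _) => ghE rB B2.
have e1 : 1 <= (1 + e) ^+ 2 by rewrite exprn_ege1// lerDl ltW.
have Bsq : 1 <= B ^+ 2 by rewrite exprn_ege1//; lra.
have ge1 : gm <= gm * (1 + e) ^+ 2 by rewrite ler_peMr.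
have gmh : gm <= gh.
  by rewrite ghE (le_trans ge1)// ler_peMr// (le_trans gm0).
have gph : gm * r ^+ 4 * (1 + e) ^+ 2 <= gh.
  by rewrite ghE mulrAC ler_wpM2l// (le_trans gm0).
have gp0 : 0 <= gm * r ^+ 4 * (1 + e) ^+ 2.
  by rewrite mulr_ge0 ?sqr_ge0// mulr_ge0// exprn_ge0.
split=> //; first exact: le_trans gm0 gmh.
move=> theta xi; have [c1 c2] := conc theta xi; split=> //.
rewrite rE (_ : gamma_plus _ _ _ _ _ _ = (gm * r ^+ 4 * (1 + e) ^+ 2)%:E); last first.
  by rewrite /gamma_plus -EFin_expe -!EFinM.
exact: (ratio_bounds e0 gm0 gp0 gmh gph (popN_ge0 Z theta xi) c1 c2).
Qed.

Local Notation dl := (delta_of e gh).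

Lemma erm_event (theta_hat : T -> 'rV[R]_d) :
  (forall w, is_erm (sample w) (theta_hat w)) ->
  (error_bound e gh%:E < 1)%E ->
  prob_ge P (1 - 4 * eps) [set w |
    popN Z (theta_hat w) 1 - N0
      <= dl ^+ 2 / ((1 - dl) * (1 - dl ^+ 2) * n%:R) * rss (sample w) (theta_hat w)
      <= dl ^+ 2 / (1 - dl) ^+ 2 * N0].
Proof.
move=> erm bd1; have [A [mA PA HA]] := risk_ratio_event.
exists A; split=> // w /HA[n0 e0 gh0 ev] /=.
have e1 : e < 1.
  rewrite ltNge; apply/negP => h.
  by move: bd1; rewrite (error_bound_infty e0 gh0 (or_introl h)).
have g1 : gh < 1.
  rewrite ltNge; apply/negP => h.
  by move: bd1; rewrite (error_bound_infty e0 gh0 (or_intror h)).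
have bdE : error_bound e gh%:E = dl%:E by rewrite error_bound_fin ?e0 ?gh0.
have dl1 : dl < 1 by move: bd1; rewrite bdE lte_fin.
have dl0 : 0 < dl by rewrite divr_gt0 ?mulr_gt0 ?subr_gt0// ltr_pwDl.
apply: (erm_excess sqi mini N0_gt0 n0 (erm w)); first by rewrite dl0.
move=> theta xi; have [null [_ _ _]] := ev theta xi.
have := popN_ge0 Z theta xi; rewrite le_eqVlt => /predU1P[N1|N1].
  by rewrite null// -N1 subrr normr0 mulr0.
rewrite bdE /equot !eqe (gt_eqF N1) andbF inver (gt_eqF N1) -EFinM.
rewrite -[(_ - 1)%E]/((_ - 1)%:E) lee_fin => h.
rewrite (_ : _ - _ = (empN (sample w) theta xi / popN Z theta xi - 1) * popN Z theta xi).
  by rewrite normrM (gtr0_norm N1) ler_wpM2r// ltW.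
by rewrite mulrBl mul1r divfK// gt_eqF.
Qed.

End Conclusion.

Theorem proposition4p6 (R : realType) :
  exists c1 c2 c3 : R,
  forall (dT : measure_display) (T : measurableType dT) (P : probability T R)
    (d : nat) (Z : {RV P >-> obs R d}) (theta_s : 'rV[R]_d) (S : 'M[R]_d)
    (p q alpha1 alpha2 eta1 eta2 eps : R),
  (0 < d)%N ->
  square_integrable Z ->
  is_risk_minimizer Z theta_s ->
  0 < popN Z theta_s 1 ->
  is_inv_sqrt (gram Z) S ->
  0 < p <= 1 -> 0 < q <= 1 ->
  0 < alpha1 -> 0 < alpha2 -> 0 < eta1 -> 0 < eta2 ->
  covariate_exp_moment Z S p alpha1 eta1 ->
  noise_exp_moment Z theta_s q alpha2 eta2 ->
  0 < eps ->
  let k1 := kappa1 Z in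
  let k2 := kappa2 Z theta_s in
  let dhat := delta_hat d k1 k2 eps in
  let gminus := gamma_minus d k1 k2 eps in
  let gplus := gamma_plus d k1 k2 eps in
  let ghat := gamma_hat d k1 k2 eps p q alpha1 alpha2 eta1 eta2 in
  let bound := fun n => error_bound (dhat n) (ghat n)%:E in
  let delta := fun n => delta_of (dhat n) (ghat n) in
  (forall (n : nat) (Zs : 'I_n -> {RV P >-> obs R d}),
     independent_copies Z Zs ->
     min_sample_size d k1 k2 eps < n%:R ->
     let sample := fun w i => Zs i w in
     prob_ge P (1 - 4 * eps) [set w |
       forall (theta : 'rV[R]_d) (xi : R),
       let ratio := equot (empN (sample w) theta xi)%:E (popN Z theta xi)%:E in
       let bound_R := error_bound (dhat n) (gplus n (sample_radius Z (sample w))) in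
       [/\ ((- ((dhat n + gminus n) / (1 + dhat n)))%:E <= ratio - 1)%E,
           (ratio - 1 <= bound_R)%E,
           (bound_R <= bound n)%E &
           (`|ratio - 1| <= bound n)%E]] /\
     (forall theta_hat : T -> 'rV[R]_d,
        (forall w, is_erm (sample w) (theta_hat w)) ->
        (bound n < 1)%E ->
        prob_ge P (1 - 4 * eps) [set w |
          popN Z (theta_hat w) 1 - popN Z theta_s 1
            <= delta n ^+ 2 / ((1 - delta n) * (1 - delta n ^+ 2) * n%:R)
               * rss (sample w) (theta_hat w)
            <= delta n ^+ 2 / (1 - delta n) ^+ 2 * popN Z theta_s 1])) /\
  (eps <= 1 ->
     [/\ gram Z != 0 ->
         min_sample_size d k1 k2 eps <= c1 * ((k1 + k2) * (d%:R + ln eps^-1)),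
         limsup_ratio_le c2 bound (fun n => Num.sqrt (rate d k1 k2 eps n)) &
         limsup_ratio_le c3 (fun n => (delta n ^+ 2)%:E)
           (fun n => rate d k1 k2 eps n)]).
Proof.
exists 4000, 114, (114 ^+ 2).
move=> dT T P d Z theta_s S p q alpha1 alpha2 eta1 eta2 eps d0 sqi mini N0_gt0.
move=> [H pinv sq] /andP[p0 _] /andP[q0 _] alpha10 alpha20 eta10 eta20 mom1 mom2 eps0.
cbv zeta; split.
  move=> n Zs ind nmin; split.
    have [A [mA PA HA]] := risk_ratio_event d0 sqi mini N0_gt0 pinv sq p0 q0
      alpha10 alpha20 eta10 eta20 mom1 mom2 eps0 ind nmin.
    exists A; split=> // w /HA[_ _ _ ev] theta xi.
    by have [_] := ev theta xi.
  move=> theta_hat erm bd1.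
  exact: (erm_event d0 sqi mini N0_gt0 pinv sq p0 q0
      alpha10 alpha20 eta10 eta20 mom1 mom2 eps0 ind nmin erm bd1).
move=> eps1; have eps01 : 0 < eps <= 1 by rewrite eps0.
have [k1K k2K] := kappa_le_bigK sqi N0_gt0 pinv sq p0 q0 alpha10 alpha20 mom1 mom2.
have k2_ge1 := kappa2_ge1 sqi N0_gt0 q0 alpha20 mom2.
have [k10 _] := kappa1P sqi pinv sq p0 alpha10 mom1.
have k20 : 0 <= kappa2 Z theta_s := le_trans ler01 k2_ge1.
have K1 := le_trans k2_ge1 k2K.
split.
- move=> G0; have k1_ge1 := kappa1_ge1 sqi pinv sq p0 alpha10 mom1 G0.
  apply: min_sample_size_le => //; rewrite /bigK /sumsqrt.
  have h (x : R) : 1 <= x -> 1 <= Num.sqrt x.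
    by move=> x1; rewrite -[leLHS]sqrtr1 ler_wsqrtr.
  rewrite (_ : 4 = 2 ^+ 2 :> R) ?lerXn2r ?nnegrE ?addr_ge0 ?sqrtr_ge0//; last by ring.
  by have := h _ k1_ge1; have := h _ k2_ge1; lra.
- exact: limsup_bound.
- exact: limsup_delta_sqr.
Qed.
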